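(* Let $P\in\mathbb{F}_2[z]$ with $P(0)=1$ and $P=P_1P_2\cdots P_j$, where the $P_i$ are irreducible polynomials in $\mathbb{F}_2[z]$. For $1\leq i\leq j$ let $q_i$ be the order of $P_i$, $r_i$ the order of $2$ modulo $q_i$, and set $c=\min_{1\leq i\leq j} c(q_i)\,r_i/\varphi(q_i)$, where for an odd positive integer $q$, $c(q)=3/2$ if the set $\mathcal{E}'(q)$ of semi-bad classes modulo $q$ is nonempty and $c(q)=1$ otherwise. Let $\mathcal{A}(P)$ be the unique set of positive integers such that $\sum_{n\geq 0}p(\mathcal{A}(P),n)z^n\equiv P(z)\pmod 2$ and $A(P,x)=|\{n:1\leq n\leq x,\ n\in\mathcal{A}(P)\}|$. Then, as $x\to\infty$, $$A(P,x)\ll \frac{x}{(\log x)^{c}},$$ where the implied constant depends on $q_1,\dots,q_j$.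
   Context: For a set $\mathcal{A}$ of positive integers, $p(\mathcal{A},n)$ is the number of partitions of $n$ with parts in $\mathcal{A}$ (with $p(\mathcal{A},0)=1$). The order of an irreducible $Q\in\mathbb{F}_2[z]$ with $Q(0)=1$ is the smallest positive integer $\beta$ with $Q(z)\mid 1+z^\beta$ (it is odd). For an odd positive integer $q$, the order $r$ of $2$ modulo $q$ is the least positive integer with $2^r\equiv1\pmod q$; the bad classes are the elements of $\mathcal{E}(q)=\{1,2,\dots,2^{r-1}\}\subset(\mathbb{Z}/q\mathbb{Z})^*$; a class of $(\mathbb{Z}/q\mathbb{Z})^*$ is semi-bad if it is not in $\mathcal{E}(q)$ but its square is; $\mathcal{E}'(q)$ is the set of semi-bad classes. $\varphi$ is Euler's function. *)

(* Defs.v *)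
From HB Require Import structures.
From mathcomp Require Import all_boot all_order all_algebra.
From mathcomp Require Import cyclic.
From mathcomp Require Import all_classical all_reals all_analysis.

Set Implicit Arguments.
Unset Strict Implicit.
Unset Printing Implicit Defensive.

Import Order.TTheory GRing.Theory Num.Theory.
Local Open Scope ring_scope.

(* A partition of [n] is given by its multiplicities: [m i] is the number of
   parts equal to [i.+1], so that no part is [0].  Parts and multiplicities
   are both at most [n]. *)
Definition partition_count (A : set nat) (n : nat) : nat :=
  #|[pred m : {ffun 'I_n -> 'I_n.+1} |
      (\sum_(i < n) m i * i.+1 == n)%N &&
      [forall i, (0 < m i)%N ==> (i.+1 \in A)]]|.

Definition counting_function (R : realType) (A : set nat) (x : R) : nat :=
  (\sum_(1 <= n < (Num.truncn x).+1 | n \in A) 1)%N.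

Definition is_poly_order (Q : {poly 'F_2}) (b : nat) : Prop :=
  [/\ (0 < b)%N, Q %| 1 + 'X^b &
      forall b' : nat, (0 < b')%N -> Q %| 1 + 'X^b' -> (b <= b')%N].

Lemma order2_ex (q : nat) :
  exists r : nat, odd q ==> ((0 < r)%N && (2 ^ r == 1 %[mod q])%N).
Proof.
exists (totient q); apply/implyP => q_odd.
rewrite totient_gt0 odd_gt0 //=.
by apply/eqP/Euler_exp_totient; rewrite coprime2n.
Qed.

(* Only meaningful for odd [q]; the value for even [q] is [0]. *)
Definition order2 (q : nat) : nat := ex_minn (order2_ex q).

(* Residue classes modulo [q] are represented by natural numbers rather than
   by ['Z_q], which is not Z/qZ for [q = 1] (the order of [1 + 'X]). *)
Definition bad_class (q a : nat) : bool :=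
  [exists k : 'I_(order2 q), a == 2 ^ k %[mod q]]%N.

Definition semi_bad_class (q a : nat) : bool :=
  [&& coprime a q, ~~ bad_class q a & bad_class q (a ^ 2)%N].

Definition c_factor (R : realType) (q : nat) : R :=
  if [exists a : 'I_q, semi_bad_class q a] then 3 / 2 else 1.

Definition local_exponent (R : realType) (q : nat) : R :=
  c_factor R q * (order2 q)%:R / (totient q)%:R.

(* The base value of the iterated minimum is itself one of the terms. *)
Definition exponent (R : realType) (j : nat) (q : 'I_j.+1 -> nat) : R :=
  \big[Order.min/local_exponent R (q ord0)]_(i < j.+1)
    local_exponent R (q i).

(* Main.v *)
Require Import Defs.
From HB Require Import structures.
From mathcomp Require Import all_boot all_order all_algebra.
From mathcomp Require Import fingroup cyclic separable cyclotomic complex.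
From mathcomp Require Import all_classical all_reals all_analysis.
From mathcomp Require Import zify ring lra.

Set Implicit Arguments.
Unset Strict Implicit.
Unset Printing Implicit Defensive.

Import Order.TTheory GRing.Theory Num.Theory.
Local Open Scope ring_scope.

(** Lift each P_i to F_i in Z[X] with constant term 1.  Taking logarithmic derivatives in
    (prod F_i) * prod_{a in A} (1 - X^a) = 1 mod 2 shows that, modulo 2^(k+1), the sum of the
    elements of A dividing 2^k n is the sum over i of power sums s_i(2^k n) of F_i, and
    s_i(2^k n) depends only on the class of n modulo q_i, up to multiplication by 2.  Moebius
    inversion over the primes of an odd m then shows that 2^k m can belong to A only if, for
    some i, m has no prime factor that is bad modulo q_i and at most k + 1 prime factors in any
    given semi-bad coset a<2>.

    Such integers are counted as follows.  From ln m = sum of ln p over the prime powers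
    dividing m and Chebyshev's bound, their number up to x is
    O(x / ln x) times the sum of 1/n over them.  Replacing 1/n by n^(-s) with s = 1 + 1/ln x and
    summing over k first gives a prime p the weight 0, 1/2 or 1 according as it is bad, in the
    coset, or neither, so the sum is at most the exponential of the weighted sum of p^(-s).
    Dirichlet's theorem, in the form of a lower bound for the sum of p^(-s) over the primes in
    a subgroup of (Z/q)^*, applied to <2> and to the union of <2> and a<2>, gives the
    exponent. *)

(** * Power sums of truncated power series *)

(** The modulus [2^(k+1)] is what isolates [2^k m]. After Moebius inversion only the divisors
    [2^i m] survive on the side of [A], and the divisor sum becomes [m] times the sum of the [2^i],
    [i <= k], with [2^i m] in [A]. That sum is less than [2^(k+1)] and [m] is odd, so divisibility
    by [2^(k+1)] forces it to vanish and excludes [2^k m].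

    The exponent comes from a subtraction. Weight 0 on [<2>], 1/2 on [a<2>] and 1 elsewhere is the
    sum over all primes minus half the sum over [<2>] minus half the sum over the union of [<2>] and
    [a<2>]. These subgroups have densities [r / phi(q)] and [2 r / phi(q)], whence
    [3/2 * r / phi(q)]; without a semi-bad class both halves are taken over [<2>]. An upper bound is
    then needed only for the sum over all primes.

    No infinite series and no complex logarithm occur: [L(s, chi)] is replaced by partial sums whose
    length is chosen after [s], its logarithm by [ln |L|], and [L(1, chi) <> 0] by a positive lower
    bound for all long partial sums. *)

Section Truncation.
Variable K : comNzRingType.
Implicit Types A B F G : {poly K}.

(** Congruence modulo [X^(N+1)]; identities between formal power series are stated through it, on
    polynomials. *)
Definition eq_upto N A B := forall i, (i <= N)%N -> A`_i = B`_i.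

Lemma eq_upto_sym N A B : eq_upto N A B -> eq_upto N B A.
Proof. by move=> h i iN; rewrite h. Qed.

Lemma eq_upto_trans N A B F : eq_upto N A B -> eq_upto N B F -> eq_upto N A F.
Proof. by move=> h1 h2 i iN; rewrite h1 // h2. Qed.

Lemma eq_uptoD N A B A' B' : eq_upto N A A' -> eq_upto N B B' -> eq_upto N (A + B) (A' + B').
Proof. by move=> h1 h2 i iN; rewrite !coefD h1 // h2. Qed.

Lemma eq_uptoM N A B A' B' : eq_upto N A A' -> eq_upto N B B' -> eq_upto N (A * B) (A' * B').
Proof.
move=> h1 h2 i iN; rewrite !coefM; apply: eq_bigr => j _.
by rewrite h1 ?h2 //; [apply: leq_trans iN; apply: leq_subr|apply: leq_trans iN; rewrite -ltnS].
Qed.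

Lemma eq_upto_prod N (I : Type) (r : seq I) (P : pred I) (A B : I -> {poly K}) :
  (forall i, P i -> eq_upto N (A i) (B i)) ->
  eq_upto N (\prod_(i <- r | P i) A i) (\prod_(i <- r | P i) B i).
Proof.
by move=> h; apply: (big_ind2 (eq_upto N)) => // *; apply: eq_uptoM.
Qed.

Lemma eq_upto_leq M N A B : (M <= N)%N -> eq_upto N A B -> eq_upto M A B.
Proof. by move=> MN h i iM; apply: h; apply: leq_trans MN. Qed.

Lemma eq_upto_Xn N k A : (N < k)%N -> eq_upto N ('X^k * A) 0.
Proof. by move=> Nk i iN; rewrite coefXnM coef0 (leq_ltn_trans iN Nk). Qed.

Lemma coef_mulX_deriv A i : ('X * A^`())`_i = A`_i *+ i.
Proof. by case: i => [|i]; rewrite coefXM ?mulr0n // coef_deriv. Qed.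

Lemma eq_upto_deriv N A B : eq_upto N A B -> eq_upto N ('X * A^`()) ('X * B^`()).
Proof. by move=> h i iN; rewrite !coef_mulX_deriv h. Qed.

Lemma coef0_factorX A : A`_0 = 0 -> exists B, A = 'X * B.
Proof.
move=> A0; exists (\poly_(i < size A) A`_i.+1); apply/polyP => i.
rewrite coefXM; case: i => [//|i] /=; rewrite coef_poly; case: ltnP => // h.
by rewrite nth_default // leqW.
Qed.

Lemma eq_upto_expX N A k : A`_0 = 0 -> (N < k)%N -> eq_upto N (A ^+ k) 0.
Proof. by move=> /coef0_factorX[B ->] Nk; rewrite exprMn; apply: eq_upto_Xn. Qed.

(** The inverse of [F] modulo [X^(N+1)] as a geometric series in [1 - F]: when [F] has constant term
    1, [X^(N+1)] divides [(1 - F)^(N+1)]. *)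
Definition geom_inv N F : {poly K} := \sum_(j < N.+1) (1 - F) ^+ j.

Lemma geom_invP N F : F`_0 = 1 -> eq_upto N (F * geom_inv N F) 1.
Proof.
move=> F0; have -> : F * geom_inv N F = 1 - (1 - F) ^+ N.+1.
  rewrite /geom_inv -[X in X * _](_ : 1 - (1 - F) = F) ; last by rewrite opprB addrCA subrr addr0.
  by rewrite -opprB mulNr -subrX1 opprB.
have e : eq_upto N ((1 - F) ^+ N.+1) 0.
  by apply: eq_upto_expX => //; rewrite coefB coef1 F0 subrr.
by move=> i iN; rewrite coefB e // coef0 subr0.
Qed.

Lemma eq_upto_cancel N F A B : F`_0 = 1 -> eq_upto N (F * A) (F * B) -> eq_upto N A B.
Proof.
move=> F0 h.
have e C : eq_upto N C (geom_inv N F * (F * C)).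
  rewrite mulrA -{1}[C]mul1r; apply: eq_uptoM => //.
  by apply: eq_upto_sym; rewrite mulrC; apply: geom_invP.
apply: eq_upto_trans (e A) _; apply: eq_upto_trans (eq_upto_sym (e B)).
exact: eq_uptoM.
Qed.

(* The coefficient of [X^M] in the power series [X F' / F]; for [F = prod (1 - a X)] it is
   minus the [M]-th power sum of the [a]. *)
Definition psum F M : K := ('X * F^`() * geom_inv M F)`_M.

Definition psum_poly N F : {poly K} := \poly_(i < N.+1) psum F i.

Lemma psum_polyP N F : F`_0 = 1 -> eq_upto N (F * psum_poly N F) ('X * F^`()).
Proof.
move=> F0.
have e : eq_upto N (psum_poly N F) ('X * F^`() * geom_inv N F).
  move=> i iN; rewrite coef_poly ltnS iN /psum.
  apply: (@eq_uptoM i) => // {}i' i'i; rewrite /geom_inv.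
  rewrite -!(big_mkord xpredT (fun j => (1 - F) ^+ j)).
  rewrite (big_cat_nat (n := i.+1) (p := N.+1)) //= coefD.
  rewrite [X in _ = _ + X]coef_sum [X in _ = _ + X]big_nat_cond [X in _ = _ + X]big1 ?addr0 // => j /andP[/andP[ij _] _].
  rewrite (@eq_upto_expX i' (1 - F) j) ?coef0 //; last exact: leq_ltn_trans ij.
  by rewrite coefB coef1 F0 subrr.
apply: eq_upto_trans (eq_uptoM (fun i _ => erefl) e) _.
rewrite mulrCA -[X in eq_upto _ _ X]mulr1; apply: eq_uptoM => //; exact: geom_invP.
Qed.

(** Newton's identities determine the power sums: as the constant term of [F] is 1, [F S = X F'] can
    be solved for [S] in only one way. Most computations of a [psum] below exhibit such an [S]. *)
Lemma psum_unique N F S : F`_0 = 1 -> eq_upto N (F * S) ('X * F^`()) ->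
  forall M, (M <= N)%N -> psum F M = S`_M.
Proof.
move=> F0 h M MN.
have : eq_upto N (psum_poly N F) S.
  apply: (eq_upto_cancel F0); refine (eq_upto_trans (psum_polyP F0) _).
  exact: eq_upto_sym.
by move=> /(_ M MN) <-; rewrite coef_poly ltnS MN.
Qed.

Lemma psumM F G M : F`_0 = 1 -> G`_0 = 1 -> psum (F * G) M = psum F M + psum G M.
Proof.
move=> F0 G0; have FG0 : (F * G)`_0 = 1 by rewrite coef0M F0 G0 mulr1.
rewrite (@psum_unique M _ (psum_poly M F + psum_poly M G) FG0 _ M) //.
  by rewrite coefD !coef_poly ltnSn.
have -> : F * G * (psum_poly M F + psum_poly M G) =
  G * (F * psum_poly M F) + F * (G * psum_poly M G) by ring.
have -> : 'X * (F * G)^`() = G * ('X * F^`()) + F * ('X * G^`()).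
  by rewrite derivM; ring.
by apply: eq_uptoD; apply: eq_uptoM => //; apply: psum_polyP.
Qed.

Lemma psum1 M : psum 1 M = 0.
Proof. by rewrite /psum -polyC1 derivC mulr0 mul0r coef0. Qed.

Lemma psum_prod (I : Type) (r : seq I) (P : pred I) (F : I -> {poly K}) M :
  (forall i, P i -> (F i)`_0 = 1) ->
  psum (\prod_(i <- r | P i) F i) M = \sum_(i <- r | P i) psum (F i) M.
Proof.
move=> h.
suff [] : (\prod_(i <- r | P i) F i)`_0 = 1 /\
  psum (\prod_(i <- r | P i) F i) M = \sum_(i <- r | P i) psum (F i) M by [].
apply: (big_ind2 (fun (A : {poly K}) s => A`_0 = 1 /\ psum A M = s)).
- by rewrite coef1 psum1.
- by move=> A a B b [A0 <-] [B0 <-]; rewrite coef0M A0 B0 mulr1 psumM.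
- by move=> i /h.
Qed.

Lemma eq_upto_compX2 N A B : eq_upto N A B -> eq_upto N.*2.+1 (A \Po 'X^2) (B \Po 'X^2).
Proof.
move=> h i iN; rewrite !coef_comp_poly_Xn //; case: ifP => // _; apply: h; lia.
Qed.

Lemma psum_compX2 F M : F`_0 = 1 -> psum (F \Po 'X^2) M.*2 = psum F M *+ 2.
Proof.
move=> F0; have FG0 : (F \Po 'X^2)`_0 = 1 by rewrite coef_comp_poly_Xn // dvdn0 div0n.
rewrite (@psum_unique M.*2.+1 _ ((psum_poly M F \Po 'X^2) *+ 2) FG0 _ M.*2) //.
  rewrite coefMn coef_comp_poly_Xn // -muln2 dvdn_mull // mulnK //.
  by rewrite coef_poly ltnSn.
have -> : 'X * (F \Po 'X^2)^`() = (('X * F^`()) \Po 'X^2) *+ 2.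
  by rewrite deriv_comp derivXn /= expr1 comp_polyM comp_polyX; ring.
have -> : (F \Po 'X^2) * ((psum_poly M F \Po 'X^2) *+ 2) = ((F * psum_poly M F) \Po 'X^2) *+ 2.
  by rewrite comp_polyM mulrnAr.
have := eq_upto_compX2 (psum_polyP (N := M) F0).
by move=> h i iN; rewrite !coefMn h.
Qed.

Lemma psum_one_subXn a M : (0 < a)%N ->
  psum (1 - 'X^a) M = - (if (0 < M)%N && (a %| M)%N then a%:R else 0).
Proof.
move=> a0.
have F0 : (1 - 'X^a : {poly K})`_0 = 1 by rewrite coefB coef1 coefXn (ltn_eqF a0) subr0.
pose S := \poly_(i < M.+1) - (if (0 < i)%N && (a %| i)%N then a%:R else 0 : K).
rewrite (@psum_unique M _ S F0 _ M) ?coef_poly ?ltnSn // => i iM.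
rewrite coef_mulX_deriv mulrBl mul1r !coefB coef1 coefXn coefXnM !coef_poly !ltnS iM.
have [-> |i0] := posnP i; first by rewrite a0 /= ?mulr0n ?oppr0 ?subr0 ?addr0.
have [ia|ai] := ltnP i a.
  rewrite (ltn_eqF ia) gtnNdvd //= !(subr0, oppr0, mul0rn) ?addr0 ?mul0rn ?oppr0 //.
rewrite (leq_trans (leq_subr _ _) iM) subn_gt0 dvdn_subl //.
have [->|nai] := eqVneq i a.
  by rewrite ltnn dvdnn /= !(if_same, subr0, oppr0, sub0r, mulNrn).
by rewrite ltn_neqAle eq_sym nai ai /= !subrr mul0rn.
Qed.

End Truncation.

(** * Congruences between power sums modulo powers of 2 *)

Section TwoAdic.
Implicit Types (F G U W : {poly int}) (M N v k : nat).

Lemma dvdz_pow2_mul v j (c : int) : (0 < j)%N ->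
  (2 ^+ v %| c *+ j)%Z -> (2 ^+ v.+1 %| 2 ^+ j * c)%Z.
Proof.
move=> j0; rewrite -(mulr_natl c j) !dvdzE !abszM !abszX (natz j) /= => h.
have [j' cj' ej] := pfactor_coprime (isT : prime 2) j0.
have lj := ltn_logl 2 j0.
have h1 : (2 ^ v %| 2 ^ logn 2 j * `|c|)%N.
  have : (2 ^ v %| j' * (2 ^ logn 2 j * `|c|))%N by rewrite mulnA -ej.
  by rewrite (@Gauss_dvdr _ j') ?coprimeXl.
rewrite expnS; apply: (dvdn_trans (dvdn_mul (dvdnn 2) h1)).
by rewrite mulnA -expnS dvdn_mul // dvdn_exp2l.
Qed.

Lemma coef0_even_part U : (1 + 2 * U)`_0 = 1 -> U`_0 = 0.
Proof.
by rewrite coefD coef1 mulr_natl coefMn /=; lia.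
Qed.

(* The series [log (1 + 2 U)] is the sum of [+- 2^j U^j / j], and [j] divides [2^(j-1)]
   up to an odd factor. *)
Lemma psum_one_add_double U M v : (1 + 2 * U)`_0 = 1 -> (2 ^ v %| M)%N ->
  (2 ^+ v.+1 %| psum (1 + 2 * U) M)%Z.
Proof.
move=> H0 vM; have U0 := coef0_even_part H0.
pose T := 2 * ('X * U^`()) * \sum_(j < M.+1) (- (2 * U)) ^+ j.
have -> : psum (1 + 2 * U) M = T`_M.
  rewrite (@psum_unique _ M _ T H0 _ M) //.
  have -> : (1 + 2 * U) * T = 2 * ('X * U^`()) * (1 - (- (2 * U)) ^+ M.+1).
    have := subrX1 (- (2 * U)) M.+1; rewrite /T.
    set S := \sum_(_ < _) _ => e.
    have -> : 1 - (- (2 * U)) ^+ M.+1 = (1 + 2 * U) * S by rewrite -opprB e; ring.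
    by ring.
  have -> : 'X * (1 + 2 * U)^`() = 2 * ('X * U^`()) * 1.
    by rewrite derivD -polyC1 derivC add0r mulr_natl derivMn; ring.
  apply: eq_uptoM => // i iM; rewrite coefB (@eq_upto_expX _ M) ?subr0 //.
    by rewrite coef0 subr0.
  by rewrite coefN mulr_natl coefMn U0 mul0rn oppr0.
rewrite /T mulr_sumr coef_sum; apply: rpred_sum => j _.
have -> : 2 * ('X * U^`()) * (- (2 * U)) ^+ j =
   (((-1) ^+ j * 2 ^+ j.+1)%:P) * ('X * U^`() * U ^+ j).
  rewrite rmorphM /= !rmorphXn /= rmorphN rmorph1 (polyC_natr _ 2).
  by rewrite exprNn exprMn exprS; move: (_ ^+ j) (2 ^+ j) (U ^+ j) => a b c; ring.
rewrite coefCM -(mulrA ((-1) ^+ j)); apply: dvdz_mull; apply: dvdz_pow2_mul => //.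
(* [X (U^(j+1))' = (j+1) X U' U^j], and [X d/dX] multiplies the coefficient of [X^M] by [M], hence
   by a multiple of [2^v]. *)
have -> : ('X * U^`() * U ^+ j)`_M *+ j.+1 = (U ^+ j.+1)`_M *+ M.
  by rewrite -coef_mulX_deriv -coefMn deriv_exp mulrnAr mulrA.
rewrite -(mulr_natr _ M); apply: dvdz_mull; rewrite dvdzE abszX (natz M) /=; exact: vM.
Qed.

Lemma psum_eq_upto F G N M : F`_0 = 1 -> G`_0 = 1 -> eq_upto N F G -> (M <= N)%N ->
  psum F M = psum G M.
Proof.
move=> F0 G0 e MN; rewrite (@psum_unique _ N F (psum_poly N G) F0 _ M) //.
  by rewrite coef_poly ltnS MN.
apply: eq_upto_trans (eq_uptoM e (fun _ _ => erefl)) _.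
apply: eq_upto_trans (psum_polyP G0) _; apply: eq_upto_sym; exact: eq_upto_deriv.
Qed.

(** Modulo [X^(N+1)], [F / G = 1 + 2 W / G], and [psum] turns the quotient into a difference. One
    more factor 2 is gained than [M] is known to contain, so that [M = 2^k n] yields the modulus
    [2^(k+1)]. *)
Lemma psum_congr F G W N M v : F`_0 = 1 -> G`_0 = 1 -> eq_upto N F (G + 2 * W) ->
  (M <= N)%N -> (2 ^ v %| M)%N -> (2 ^+ v.+1 %| psum F M - psum G M)%Z.
Proof.
move=> F0 G0 e MN vM; pose I := geom_inv N G.
have GI : eq_upto N (G * I) 1 by apply: geom_invP.
have I0 : I`_0 = 1 by have := GI 0%N isT; rewrite coef0M G0 mul1r coef1.
have FI : eq_upto N (F * I) (1 + 2 * (W * I)).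
  apply: eq_upto_trans (eq_uptoM e (fun _ _ => erefl)) _.
  by rewrite mulrDl -mulrA; apply: eq_uptoD.
have FI0 : (F * I)`_0 = 1 by rewrite coef0M F0 I0.
have H0 : (1 + 2 * (W * I))`_0 = 1 by rewrite -FI.
have -> : psum F M - psum G M = psum (1 + 2 * (W * I)) M.
  rewrite -(psum_eq_upto FI0 H0 FI MN) psumM //.
  have : psum (G * I) M = 0.
    by rewrite (psum_eq_upto _ _ GI MN) ?psum1 ?coef1 // coef0M G0 I0.
  by rewrite psumM // => /eqP; rewrite addrC addr_eq0 => /eqP ->.
exact: psum_one_add_double.
Qed.

Local Notation mod2 := (map_poly (intr : int -> 'F_2)).

Lemma mod2_eq_upto F G N : eq_upto N (mod2 F) (mod2 G) ->
  exists W, eq_upto N F (G + 2 * W).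
Proof.
move=> h; exists (\poly_(i < N.+1) ((F`_i - G`_i) %/ 2)%Z) => i iN.
have := h i iN; rewrite !coef_map /= => /eqP; rewrite -subr_eq0 -rmorphB /=.
rewrite -(dvdz_pcharf (pchar_Fp (isT : prime 2))) => d2.
rewrite coefD mulr_natl coefMn coef_poly ltnS iN mulr2n; move: (divzK d2).
by move: (_ %/ _)%Z => y; move: F`_i G`_i => a b; lia.
Qed.

Lemma polyF2_sqr (p : {poly 'F_2}) : p ^+ 2 = p \Po 'X^2.
Proof.
have two0 : 2%:R = 0 :> {poly 'F_2} by rewrite -polyC_natr (pchar_Fp_0 (isT : prime 2)).
elim/poly_ind: p => [|p c IH]; first by rewrite comp_poly0 expr0n.
rewrite sqrrD -mulr_natr two0 mulr0 addr0 exprMn IH.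
rewrite comp_polyD comp_polyM comp_polyX comp_polyC -rmorphXn /=.
by congr (_ + _%:P); case: c => -[|[|//]] c; apply: val_inj.
Qed.

(* [F(X)^2] and [F(X^2)] agree modulo 2, and their power sums at [2M] are twice those of [F]
   at [2M] and at [M]. *)
Lemma psum_double F M v : F`_0 = 1 -> (2 ^ v %| M.*2)%N ->
  (2 ^+ v %| psum F M.*2 - psum F M)%Z.
Proof.
move=> F0 vM.
have F20 : (F ^+ 2)`_0 = 1 by rewrite expr2 coef0M F0.
have FX0 : (F \Po 'X^2)`_0 = 1 by rewrite coef_comp_poly_Xn // dvdn0 div0n.
have [W hW] : exists W, eq_upto M.*2 (F ^+ 2) (F \Po 'X^2 + 2 * W).
  apply: mod2_eq_upto => i _; rewrite rmorphXn /= polyF2_sqr.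
  by rewrite map_comp_poly map_polyXn.
have := psum_congr F20 FX0 hW (leqnn _) vM.
rewrite expr2 psumM // psum_compX2 // -mulr2n -mulrnBl exprS -(mulr_natl (psum F M.*2 - psum F M) 2).
by rewrite dvdz_mul2l.
Qed.

Lemma poly_lift (p : {poly 'F_2}) : exists P : {poly int},
  [/\ mod2 P = p, (size P <= size p)%N & p`_0 = 1 -> P`_0 = 1].
Proof.
exists (\poly_(i < size p) Posz (nat_of_ord p`_i)); split.
- apply/polyP => i; rewrite coef_map coef_poly; case: ltnP => h /=.
    by rewrite -[LHS]/((nat_of_ord p`_i)%:R) natr_Zp.
  by rewrite nth_default.
- exact: size_poly.
- rewrite coef_poly => p0; case: ltnP; first by rewrite p0.
  by rewrite leqn0 size_poly_eq0 => /eqP pz; move: p0; rewrite pz coef0.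
Qed.

Lemma size_deriv_le (K : nzRingType) (p : {poly K}) : (size ('X * p^`())%R <= size p)%N.
Proof.
apply/leq_sizeP => i ip; case: i ip => [|i] ip; rewrite coefXM //= coef_deriv.
by rewrite nth_default // mul0rn.
Qed.

(* The degree bounds make [V X F'] a polynomial of degree at most [2^k q], so that it does
   not contribute to the coefficients compared in [psum_periodic]. *)
Lemma X_pow_order F q (d := size F) : (0 < q)%N -> mod2 F %| 1 + 'X^q -> size (mod2 F) = d ->
  forall k, exists U V : {poly int},
   [/\ 'X^(2 ^ k * q) = 1 + 2 ^+ k.+1 * U + F * V,
    (size U <= (2 ^ k * q).+1)%N & (size V + d <= 2 ^ k * q + 2)%N].
Proof.
move=> q0 dv sd; elim => [|k [U [V [e sU sV]]]].
  have sX : size (1 + 'X^q : {poly 'F_2}) = q.+1.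
    by rewrite addrC size_polyDl size_polyXn // size_poly1.
  have nz : 1 + 'X^q != 0 :> {poly 'F_2} by rewrite -size_poly_eq0 sX.
  have [r er] : exists r, 1 + 'X^q = r * mod2 F by move/dvdpP: dv.
  have rnz : r != 0 by apply: contraNneq nz => rz; rewrite er rz mul0r.
  have fnz : mod2 F != 0 by apply: contraNneq nz => fz; rewrite er fz mulr0.
  have [V [eV sV _]] := poly_lift r.
  have sr : (size r + d = q + 2)%N.
    have := congr1 (fun p : {poly 'F_2} => size p) er; rewrite sX size_mul // sd.
    by rewrite -size_poly_gt0 in rnz; move=> e1; rewrite addn2 e1 prednK // addn_gt0 rnz.
  have [W hW] : exists W, eq_upto q (1 + 'X^q) (F * V + 2 * W).
    apply: mod2_eq_upto => i _.
    by rewrite rmorphD rmorphM rmorph1 /= map_polyXn eV er mulrC.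
  have [sV' d0] : (size V + d <= q + 2 /\ 0 < d)%N.
    by split; [rewrite -sr leq_add2r | rewrite -sd size_poly_gt0].
  have sFV : (size (F * V)%R <= q.+1)%N.
    by apply: leq_trans (size_polyMleq _ _) _; rewrite -/d; lia.
  pose W' := \poly_(i < q.+1) W`_i.
  have eW : 1 + 'X^q = F * V + 2 * W'.
    apply/polyP => i; have [iq|qi] := leqP i q.
      by rewrite hW // !coefD !mulr_natl !coefMn coef_poly ltnS iq.
    rewrite !coefD mulr_natl coefMn coef_poly ltnNge qi /= mul0rn addr0.
    rewrite coef1 coefXn (gtn_eqF qi) (gtn_eqF (leq_ltn_trans (leq0n q) qi)).
    by rewrite nth_default // (leq_trans sFV).
  exists (W' - 1), V; rewrite expn0 mul1n; split => //.
    have -> : 'X^q = (1 + 'X^q) - 1 :> {poly int} by rewrite addrC addKr.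
    by rewrite eW expr1; ring.
  apply: leq_trans (size_polyD _ _) _; rewrite geq_max size_poly size_polyN size_poly1.
  by [].
(* With [a = 1 + 2^(k+1) U], squaring gives [(a + F V)^2 = a^2 + F V (2 a + F V)] and
   [a^2 = 1 + 2^(k+2) (U + 2^k U^2)]: the exponent [2^k q] doubles and one power of 2 is gained. *)
exists (U + 2 ^+ k * U ^+ 2), (V * (2 * (1 + 2 ^+ k.+1 * U) + F * V)); split.
- rewrite expnS -mulnA mulnC exprM e !exprS; move: (2 ^+ k) => a; ring.
- have c2 : (size (2 ^+ k : {poly int}) <= 1)%N.
    by rewrite -[2]polyC_natr -rmorphXn /= size_polyC; case: (_ == _).
  apply: leq_trans (size_polyD _ _) _; rewrite geq_max; apply/andP; split.
    by apply: leq_trans sU _; rewrite expnS; lia.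
  apply: leq_trans (size_polyMleq _ _) _.
  have := size_polyMleq U U; rewrite -expr2 expnS; lia.
- have c2 : (size (2 ^+ k.+1 * U)%R <= (2 ^ k * q).+1)%N.
    rewrite -[2]polyC_natr -rmorphXn /= mul_polyC.
    exact: leq_trans (size_scale_leq _ _) sU.
  have s1 : (size (2 * (1 + 2 ^+ k.+1 * U) + F * V)%R <= (2 ^ k * q).+1)%N.
    apply: leq_trans (size_polyD _ _) _; rewrite geq_max; apply/andP; split.
      rewrite -[X in X * (_ + _)]polyC_natr mul_polyC; apply: leq_trans (size_scale_leq _ _) _.
      by apply: leq_trans (size_polyD _ _) _; rewrite geq_max size_poly1.
    by apply: leq_trans (size_polyMleq _ _) _; rewrite -/d; lia.
  have := size_polyMleq V (2 * (1 + 2 ^+ k.+1 * U) + F * V).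
  rewrite expnS; lia.
Qed.

(** Multiplying [X^Q = 1 + 2^(k+1) U + F V], [Q = 2^k q], by [S = X F' / F] gives
    [(X^Q - 1) S = 2^(k+1) U S + V X F']. The last term has degree at most [Q], which is below
    [M + Q] because [M > 0]; the coefficients of [X^(M + Q)] are then compared. *)
Lemma psum_periodic F q k M : F`_0 = 1 -> (0 < q)%N -> mod2 F %| 1 + 'X^q ->
  size (mod2 F) = size F -> (0 < M)%N ->
  (2 ^+ k.+1 %| psum F (M + 2 ^ k * q) - psum F M)%Z.
Proof.
move=> F0 q0 dv sF M0; have [U [V [e sU sV]]] := X_pow_order q0 dv sF k.
pose Q := (2 ^ k * q)%N; rewrite -/Q in e sU sV *.
pose S := psum_poly (M + Q) F.
have hS := psum_polyP (N := (M + Q)%N) F0.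
have E : ('X^Q * S - S)`_(M + Q) = (2 ^+ k.+1 * (U * S))`_(M + Q).
  have -> : 'X^Q * S - S = 2 ^+ k.+1 * (U * S) + V * (F * S) by rewrite e; ring.
  rewrite coefD (eq_uptoM (fun _ _ => erefl V`__) hS) //.
  rewrite [X in _ + X]nth_default ?addr0 //.
  apply: leq_trans (size_polyMleq _ _) _.
  have h : (size V + size ('X * F^`())%R <= Q + 2)%N.
    by apply: leq_trans sV; rewrite leq_add2l size_deriv_le.
  by rewrite -subn1 leq_subLR; apply: leq_trans h _; rewrite addnC addnA leq_add2r add1n.
have := E; rewrite coefB coefXnM ltnNge leq_addl /= addnK.
rewrite /S !coef_poly !ltnS leqnn leq_addr -opprB -[2]polyC_natr -rmorphXn /= coefCM.
move/(congr1 (fun x => - x)); rewrite opprK => ->.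
by rewrite -mulrN dvdz_mulr.
Qed.

End TwoAdic.

(** * The generating function of the partitions with parts in [A] *)

Section PartitionSeries.
Variables (K : comNzRingType) (A : set nat).

Definition part_factor n (i : nat) : {poly K} :=
  \sum_(j < n.+1) (if (0 < j)%N ==> (i.+1 \in A) then 'X^(j * i.+1) else 0).

Definition part_series n : {poly K} := \prod_(i < n) part_factor n i.

Definition part_inverse n : {poly K} :=
  \prod_(i < n) (if i.+1 \in A then 1 - 'X^(i.+1) else 1).

Lemma coef_part_series n : (part_series n)`_n = (partition_count A n)%:R.
Proof.
rewrite /part_series bigA_distr_bigA /=.
have E (f : {ffun 'I_n -> 'I_n.+1}) :
   \prod_(i < n) (if (0 < f i)%N ==> (i.+1 \in A) then 'X^(f i * i.+1) else 0) =
   if [forall i, (0 < f i)%N ==> (i.+1 \in A)] then 'X^(\sum_(i < n) f i * i.+1)%N else 0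
   :> {poly K}.
  case: ifPn => [/forallP h|/forallPn[i hi]].
    rewrite -prodrXr; apply: eq_bigr => i _.
    by rewrite (h i).
  by rewrite (bigD1 i) //= (negbTE hi) mul0r.
under eq_bigr do rewrite E.
rewrite coef_sum /partition_count -sum1_card natr_sum big_mkcond /=.
rewrite [LHS](eq_bigr (fun f => if f \in [pred m : {ffun 'I_n -> 'I_n.+1} |
      (\sum_(i < n) m i * i.+1 == n)%N &&
      [forall i, (0 < m i)%N ==> (i.+1 \in A)]] then 1 else 0)).
  by rewrite -!big_mkcond.
move=> f _; rewrite inE; case: ifP => _; rewrite ?andbF ?andbT ?coef0 // coefXn eq_sym.
by case: eqP.
Qed.

Lemma part_factor_inverse n i :
  eq_upto n (part_factor n i * (if i.+1 \in A then 1 - 'X^(i.+1) else 1)) 1.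
Proof.
rewrite /part_factor; case: ifP => iA.
  under eq_bigr do rewrite implybT mulnC exprM.
  have := subrX1 ('X^(i.+1) : {poly K}) n.+1.
  move=> /(congr1 (fun x => - x)); rewrite -mulNr !opprB mulrC => <-.
  rewrite -exprM => k kn; rewrite coefB coefXn ltn_eqF ?subr0 //.
  by apply: leq_ltn_trans kn _; rewrite mulSn mulnS; lia.
rewrite mulr1 big_ord_recl /= mul0n expr0 big1 ?addr0 // => j _.
Qed.

Lemma part_series_inverse n : eq_upto n (part_series n * part_inverse n) 1.
Proof.
have -> : part_series n * part_inverse n =
    \prod_(i < n) (part_factor n i * (if i.+1 \in A then 1 - 'X^(i.+1) else 1)).
  by rewrite big_split.
rewrite [X in eq_upto _ _ X](_ : 1 = \prod_(i < n) 1); last by rewrite big1.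
by apply: eq_upto_prod => i _; apply: part_factor_inverse.
Qed.

Lemma part_inverse_stable n N : (n <= N)%N -> eq_upto n (part_inverse N) (part_inverse n).
Proof.
move=> nN; rewrite /part_inverse -!(big_mkord xpredT (fun i => if i.+1 \in A then 1 - 'X^(i.+1) else 1)).
rewrite (big_cat_nat (n := n)) //= -[X in eq_upto _ _ X]mulr1.
apply: eq_uptoM => //; rewrite big_nat_cond.
rewrite [X in eq_upto _ _ X](_ : 1 = \prod_(n <= i < N | (n <= i < N)%N && true) 1); last by rewrite big1.
apply: eq_upto_prod => i /andP[/andP[ni _] _] k kn; case: ifP => // _.
by rewrite coefB coefXn ltn_eqF ?subr0 // ltnS (leq_trans kn).
Qed.

Lemma part_inverse0 n : (part_inverse n)`_0 = 1.
Proof.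
rewrite /part_inverse; apply: (big_ind (fun p : {poly K} => p`_0 = 1)); first by rewrite coef1.
  by move=> p r p0 r0; rewrite coef0M p0 r0 mulr1.
by move=> i _; case: ifP; rewrite ?coefB ?coef1 // coefXn subr0.
Qed.

(** Each coefficient of [P] is known from a different finite product, [part_series n] for the
    [n]-th; so [P] is identified with the inverse of [part_inverse N] one coefficient at a time. *)
Lemma series_mul_part_inverse (P : {poly K}) N :
  (forall n, (partition_count A n)%:R = P`_n) -> eq_upto N (P * part_inverse N) 1.
Proof.
move=> hP; set G := part_inverse N.
have e : eq_upto N P (geom_inv N G).
  move=> n nN; rewrite -hP -coef_part_series.
  suff : eq_upto n (part_series n) (geom_inv N G) by apply.
  apply: (eq_upto_cancel (part_inverse0 N)).
  apply: eq_upto_trans (_ : eq_upto n _ 1) _; last first.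
    by apply: eq_upto_sym; apply: (eq_upto_leq nN); apply: geom_invP; apply: part_inverse0.
  apply: eq_upto_trans (eq_uptoM (part_inverse_stable nN) (fun _ _ => erefl)) _.
  by rewrite mulrC; apply: part_series_inverse.
apply: eq_upto_trans (eq_uptoM e (fun _ _ => erefl)) _.
by rewrite mulrC; apply: geom_invP; apply: part_inverse0.
Qed.

End PartitionSeries.

Definition sigma_in (A : set nat) (M : nat) : nat :=
  \sum_(1 <= a < M.+1 | (a \in A) && (a %| M)%N) a.

Lemma psum_part_inverse (A : set nat) N M : (0 < M)%N -> (M <= N)%N ->
  psum (part_inverse int A N) M = - (sigma_in A M)%:R.
Proof.
move=> M0 MN; rewrite /part_inverse psum_prod; last first.
  by move=> i _; case: ifP; rewrite ?coefB ?coef1 // coefXn subr0.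
rewrite -(big_mkord xpredT (fun i => psum (if i.+1 \in A then 1 - 'X^(i.+1) else 1 : {poly int}) M)).
rewrite -(big_add1 _ _ 0 N.+1 xpredT (fun i => psum (if i \in A then 1 - 'X^i else 1 : {poly int}) M)).
rewrite /sigma_in natr_sum -sumrN (big_cat_nat (n := M.+1)) //=.
rewrite [X in _ + X]big_nat_cond [X in _ + X]big1 ?addr0; last first.
  move=> a /andP[/andP[Ma _] _]; case: ifP => _; last exact: psum1.
  by rewrite psum_one_subXn ?(leq_trans _ Ma) // gtnNdvd // andbF oppr0.
rewrite [RHS]big_mkcond [LHS]big_nat_cond [RHS]big_nat_cond.
apply: eq_bigr => a; rewrite andbT => /andP[a0 _]; case: ifP => aA /=; last exact: psum1.
by rewrite psum_one_subXn // M0 /=; case: ifP; rewrite ?oppr0.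
Qed.

Local Notation mod2 := (map_poly (intr : int -> 'F_2)).

Lemma part_inverse_mod2 A N : mod2 (part_inverse int A N) = part_inverse 'F_2 A N.
Proof.
rewrite rmorph_prod; apply: eq_bigr => i _; case: ifP => _; last by rewrite rmorph1.
by rewrite rmorphB rmorph1 /= map_polyXn.
Qed.

(** The lifts keep the degrees of the [Pf i], on which the periodicity of their power sums rests. *)
Lemma sigma_congruence (I : finType) (P : {poly 'F_2}) (Pf : I -> {poly 'F_2}) (A : set nat) :
  P = \prod_i Pf i -> P.[0] = 1 ->
  (forall n, (partition_count A n)%:R = P`_n) ->
  exists F : I -> {poly int},
    (forall i, [/\ (F i)`_0 = 1, mod2 (F i) = Pf i & size (mod2 (F i)) = size (F i)]) /\
    forall M v, (0 < M)%N -> (2 ^ v %| M)%N ->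
      (2 ^+ v.+1 %| \sum_i psum (F i) M - (sigma_in A M)%:R)%Z.
Proof.
move=> eP P0 hP.
have Pf0 i : (Pf i)`_0 = 1.
  have : (Pf i)`_0 != 0.
    apply/eqP => z; move: P0; rewrite horner_coef0 eP.
    rewrite -horner_coef0 horner_prod (bigD1 i) //= horner_coef0 z mul0r => /eqP.
    by rewrite eq_sym oner_eq0.
  by case: ((Pf i)`_0) => -[|[|//]] h // _; apply: val_inj.
have [F hF] := choice (fun i => poly_lift (Pf i)).
exists F.
have F0 i : (F i)`_0 = 1 by case: (hF i) => _ _; apply.
split => [i|M v M0 vM].
  case: (hF i) => e s _; split => //; apply/eqP; rewrite eqn_leq {2}e s andbT.
  exact: size_poly.
have FF0 : (\prod_i F i)`_0 = 1.
  by apply: (big_ind (fun p : {poly int} => p`_0 = 1)) => [|p r p0 r0|i _];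
    rewrite ?coef1 // coef0M p0 r0.
have G0 := part_inverse0 int A M.
have FG0 : (\prod_i F i * part_inverse int A M)`_0 = 1 by rewrite coef0M FF0 G0.
have [W hW] : exists W, eq_upto M (\prod_i F i * part_inverse int A M) (1 + 2 * W).
  apply: mod2_eq_upto; rewrite rmorphM rmorph1 /= part_inverse_mod2 rmorph_prod /=.
  rewrite (eq_bigr Pf) -?eP; first exact: series_mul_part_inverse.
  by move=> i _; case: (hF i).
have := psum_congr FG0 (coef1 _ 0 : (1 : {poly int})`_0 = 1) hW (leqnn M) vM.
by rewrite psum1 subr0 psumM // psum_prod // psum_part_inverse.
Qed.

(** * Alternating sums over the prime divisors *)

Section Alternating.
Implicit Types (f g : nat -> int) (ps : seq nat) (n p : nat).

(* Moebius inversion without divisions: [alt ps f n] is the sum of [mu (prod ps / d) * f (d n)]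
   over the divisors [d] of the squarefree number [prod ps]. *)
Fixpoint alt ps f n : int :=
  if ps is p :: ps' then alt ps' f (p * n) - alt ps' f n else f n.

Lemma alt_diff p ps f n : alt (p :: ps) f n = alt ps (fun k => f (p * k)%N - f k) n.
Proof.
elim: ps f n => [//|r ps IH] f n /=.
rewrite -!IH /= [(r * (p * n))%N]mulnCA; ring.
Qed.

Lemma alt_perm ps ps' f n : perm_eq ps ps' -> alt ps f n = alt ps' f n.
Proof.
have swap p r s m : alt (p :: r :: s) f m = alt (r :: p :: s) f m.
  by rewrite /= [(p * (r * m))%N]mulnCA; ring.
have mid p s m : alt (p :: s) f m = alt (rcons s p) f m.
  elim: s m => [//|r s IH] m; rewrite swap /=.
  by rewrite -!IH.
have inner s p t m : alt (s ++ p :: t) f m = alt (p :: s ++ t) f m.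
  by elim: s m => [//|r s IH] m; rewrite cat_cons [RHS]swap /= !IH.
elim: ps ps' n => [|p ps IH] ps' n e.
  by move: e; rewrite perm_sym => /perm_nilP ->.
have pin : p \in ps' by rewrite -(perm_mem e) mem_head.
case/splitPr: pin e => s t e.
have e' : perm_eq ps (s ++ t).
  by rewrite -(perm_cons p); apply: perm_trans e _; rewrite perm_catC /= perm_cons perm_catC.
by rewrite inner /= !(IH _ _ e').
Qed.

Lemma alt_congr (D : int) ps f g n :
  (forall k, (k %| n * \prod_(p <- ps) p)%N -> (D %| f k - g k)%Z) ->
  (D %| alt ps f n - alt ps g n)%Z.
Proof.
elim: ps n => [|p ps IH] n h /=; first by apply: h; rewrite big_nil muln1.
have -> : alt ps f (p * n) - alt ps f n - (alt ps g (p * n) - alt ps g n) =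
  (alt ps f (p * n) - alt ps g (p * n)) - (alt ps f n - alt ps g n) by ring.
apply: rpredB; apply: IH => k kd; apply: h; rewrite big_cons.
  by rewrite mulnCA mulnA.
by apply: dvdn_trans kd _; rewrite mulnCA dvdn_mull.
Qed.

Lemma alt_sum (I : Type) (r : seq I) (P : pred I) (F : I -> nat -> int) ps n :
  alt ps (fun k => \sum_(i <- r | P i) F i k) n = \sum_(i <- r | P i) alt ps (F i) n.
Proof. by elim: ps n => [//|p ps IH] n /=; rewrite !IH sumrB. Qed.

Lemma alt_scale (c : int) f ps n : alt ps (fun k => c * f k) n = c * alt ps f n.
Proof. by elim: ps n => [//|p ps IH] n /=; rewrite !IH mulrBr. Qed.

(** Inclusion-exclusion over the primes of [ps]: the difference for one prime [p] leaves those [d]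
    that divide the number with [p] but not without it. *)
Lemma alt_dvd_indicator (c d : nat) ps n : all prime ps -> uniq ps ->
  alt ps (fun k => (d %| c * k)%N%:R) n =
  ((d %| c * (n * \prod_(p <- ps) p))%N &&
    all (fun p => ~~ (d %| c * (n * \prod_(p <- ps) p) %/ p)%N) ps)%:R.
Proof.
elim: ps n => [|p ps IH] n /=; first by rewrite big_nil muln1 andbT.
move=> /andP[pp aps] /andP[pn ups]; rewrite !IH // big_cons.
set Q := \prod_(_ <- ps) _.
have p0 := prime_gt0 pp.
have -> : (c * (p * n * Q) = p * (c * (n * Q)))%N by rewrite -mulnA mulnCA.
have -> : (c * (n * (p * Q)) = p * (c * (n * Q)))%N by rewrite [(n * _)%N]mulnCA mulnCA.
set m := (c * (n * Q))%N; rewrite mulKn //.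
have rm r : r \in ps -> (r %| m)%N.
  move=> rps; rewrite /m /Q dvdn_mull // dvdn_mull //.
  by rewrite (big_rem r rps) /= dvdn_mulr.
have [dm|ndm] := boolP (d %| m)%N; last by rewrite /= subr0.
rewrite (dvdn_mull _ dm) /=.
suff -> : all (fun r => ~~ (d %| p * m %/ r)%N) ps = all (fun r => ~~ (d %| m %/ r)%N) ps.
  by rewrite subrr.
apply: eq_in_all => r rps; congr (~~ _).
have pr := allP aps r rps; have r0 := prime_gt0 pr.
rewrite -muln_divA ?rm //; apply/idP/idP => [h|h]; last exact: dvdn_mull.
(* [d] divides both [p m / r] and [m], hence their greatest common divisor [m / r], as [p] and [r]
   are distinct primes. *)
have : (d %| gcdn (p * (m %/ r)) (r * (m %/ r)))%N.
  by rewrite dvdn_gcd h [(r * _)%N]mulnC (divnK (rm r rps)).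
rewrite -muln_gcdl (_ : gcdn p r = 1%N) ?mul1n //.
apply/eqP; rewrite -/(coprime p r) prime_coprime // dvdn_prime2 //.
by apply: contraNneq pn => ->.
Qed.

Lemma prod_primes_gt0 ps : all prime ps -> (0 < \prod_(p <- ps) p)%N.
Proof.
move=> aps; rewrite big_seq; apply: prodn_cond_gt0 => p /(allP aps).
exact: prime_gt0.
Qed.

Section Class.
Variables (q k : nat) (f : nat -> int).
Hypothesis q0 : (0 < q)%N.
Let D : int := 2 ^+ k.+1.
Hypothesis f_period : forall n, (0 < n)%N -> (D %| f (n + q)%N - f n)%Z.
Hypothesis f_double : forall n, (0 < n)%N -> (D %| f (2 * n)%N - f n)%Z.

Lemma class_congr n n' : (0 < n)%N -> (0 < n')%N -> (n = n' %[mod q])%N ->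
  (D %| f n - f n')%Z.
Proof.
wlog le : n n' / (n' <= n)%N => [W|].
  move=> n0 n'0 e; have [le|/ltnW le] := leqP n' n; first exact: W.
  by rewrite -opprB rpredN; apply: W.
move=> n0 n'0 /eqP; rewrite eqn_mod_dvd // => /dvdnP[t et].
have -> : n = (n' + t * q)%N by rewrite -et subnKC.
elim: t {et} => [|t IH]; first by rewrite addn0 subrr rpred0.
rewrite mulSn addnCA addnC -[f _ - _](subrKA (f (n' + t * q)%N)).
by rewrite rpredD // f_period // addn_gt0 n'0.
Qed.

Lemma class_pow2 e n : (0 < n)%N -> (D %| f (2 ^ e * n)%N - f n)%Z.
Proof.
move=> n0; elim: e => [|e IH]; first by rewrite mul1n subrr rpred0.
rewrite expnS -mulnA -[f _ - _](subrKA (f (2 ^ e * n)%N)).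
by rewrite rpredD // f_double // muln_gt0 expn_gt0.
Qed.

Lemma class_pow2_congr e e' n n' : (0 < n)%N -> (0 < n')%N ->
  (2 ^ e * n = 2 ^ e' * n' %[mod q])%N -> (D %| f n - f n')%Z.
Proof.
move=> n0 n'0 h.
have h1 := class_pow2 e n0; have h2 := class_pow2 e' n'0.
have h3 : (D %| f (2 ^ e * n)%N - f (2 ^ e' * n')%N)%Z.
  by apply: class_congr; rewrite // muln_gt0 expn_gt0.
have -> : f n - f n' = (f (2 ^ e * n)%N - f (2 ^ e' * n')%N) - (f (2 ^ e * n)%N - f n)
   + (f (2 ^ e' * n')%N - f n') by ring.
by rewrite rpredD // rpredB.
Qed.

Definition in_coset (a p : nat) := [exists e : 'I_(order2 q), p == a * 2 ^ e %[mod q]]%N.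

(** Multiplication by a bad prime does not change [f] modulo [D]; moved to the front of [ps], it
    makes the innermost difference vanish. *)
Lemma alt_bad ps n p : (0 < n)%N -> all prime ps -> p \in ps -> bad_class q p ->
  (D %| alt ps f n)%Z.
Proof.
move=> n0 aps pps /existsP[e /eqP he].
have pe : perm_eq ps (p :: rem p ps) by apply: perm_to_rem.
rewrite (alt_perm _ _ pe) alt_diff -[alt _ _ _]subr0.
have <- : alt (rem p ps) (fun _ => 0) n = 0.
  by elim: (rem p ps) n {n0} => [//|r s IH] n /=; rewrite !IH subrr.
have ap : all prime (rem p ps) by apply/allP => r /mem_rem /(allP aps).
have pr0 : (0 < \prod_(r <- rem p ps) r)%N.
  exact: prod_primes_gt0.
apply: alt_congr => t td; rewrite subr0.
have t0 : (0 < t)%N by apply: dvdn_gt0 td; rewrite muln_gt0 n0.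
apply: (@class_pow2_congr 0 e) => //; first by rewrite muln_gt0 t0 prime_gt0 // (allP aps).
by rewrite mul1n -modnMml he modnMml.
Qed.

(* A semi-bad prime acts on [f] by an involution [T] depending only on its coset, and
   [(T - 1)^s = (-2)^(s-1) (T - 1)]. *)
Lemma alt_semi_bad a ps n : (0 < n)%N -> all prime ps -> bad_class q (a ^ 2) ->
  (k.+1 < count (in_coset a) ps)%N -> (D %| alt ps f n)%Z.
Proof.
move=> n0 aps /existsP[b /eqP hb].
have : perm_eq ps (seq.filter (in_coset a) ps ++ seq.filter (predC (in_coset a)) ps).
  by rewrite perm_sym perm_filterC.
rewrite -size_filter; move: (filter_all (in_coset a) ps).
move: (seq.filter (in_coset a) ps) (seq.filter (predC (in_coset a)) ps) => s t sa pe.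
rewrite (alt_perm _ _ pe) => sk.
have ast : all prime (s ++ t) by rewrite -(perm_all _ pe).
have key p s' : all (in_coset a) (p :: s') -> all prime (p :: s' ++ t) ->
   (2 ^+ minn (size s') k.+1 %| alt (p :: s' ++ t) f n)%Z.
  elim: s' => [|r s' IH] /=; first by rewrite min0n expr0 dvd1z.
  move=> /and3P[cp cr cs] /and3P[pp pr ap].
  have {}IH := IH (introT andP (conj cp cs)) (introT andP (conj pp ap)).
  (* [p] and [r] lie in the same coset, so [f (p x) = f (r x)]; their product lies in
     [a^2 <2> = <2>], so [f (p r x) = f x], both modulo [D]. Hence adding [r] multiplies by -2. *)
  have main : (D %| alt (p :: r :: s' ++ t) f n - (-2) * alt (p :: s' ++ t) f n)%Z.
    rewrite (alt_diff p (r :: s' ++ t)) (alt_diff r (s' ++ t)) (alt_diff p (s' ++ t)) -alt_scale.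
    apply: alt_congr => x xd.
    have x0 : (0 < x)%N.
      by apply: dvdn_gt0 xd; rewrite muln_gt0 n0 prod_primes_gt0.
    have [p0 r0] := (prime_gt0 pp, prime_gt0 pr).
    case/existsP: cp => e1 /eqP h1; case/existsP: cr => e2 /eqP h2.
    have pr_ : (D %| f (p * x)%N - f (r * x)%N)%Z.
      apply: (@class_pow2_congr e2 e1); rewrite ?muln_gt0 ?p0 ?r0 //.
      rewrite [(2 ^ e2 * _)%N]mulnCA [(2 ^ e1 * _)%N]mulnCA.
      rewrite -[LHS]modnMml h1 modnMml -[RHS]modnMml h2 modnMml.
      by congr (_ %% _)%N; rewrite -!mulnA; congr (a * _)%N; rewrite mulnCA.
    have prx : (D %| f (p * (r * x))%N - f x)%Z.
      apply: (@class_pow2_congr 0 (e1 + e2 + b)); rewrite ?muln_gt0 ?p0 ?r0 //.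
      have e0 : (p * r = a * 2 ^ e1 * (a * 2 ^ e2) %[mod q])%N.
        by rewrite -modnMm h1 h2 modnMm.
      rewrite expn0 mul1n mulnA -[LHS]modnMml e0 modnMml.
      have -> : (a * 2 ^ e1 * (a * 2 ^ e2) * x = a ^ 2 * (2 ^ e1 * 2 ^ e2 * x))%N.
        by rewrite mulnACA mulnn -[LHS]mulnA.
      by rewrite -[LHS]modnMml hb modnMml; congr (_ %% _)%N; rewrite !expnD mulnA [(2 ^ b * _)%N]mulnC.
    have -> : f (p * (r * x))%N - f (r * x)%N - (f (p * x)%N - f x) -
        -2 * (f (p * x)%N - f x) =
        (f (p * (r * x))%N - f x) + (f (p * x)%N - f (r * x)%N) by ring.
    exact: rpredD.
  suff : (2 ^+ minn (size s').+1 k.+1 %| alt (p :: r :: s' ++ t) f n)%Z by [].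
  have -> : alt (p :: r :: s' ++ t) f n =
     (alt (p :: r :: s' ++ t) f n - -2 * alt (p :: s' ++ t) f n) + -2 * alt (p :: s' ++ t) f n.
    by rewrite subrK.
  have dD m : (m <= k.+1)%N -> (2 ^+ m %| D)%Z by move=> mk; apply: dvdz_exp2l.
  apply: rpredD; first by apply: (dvdz_trans _ main); apply: dD; rewrite geq_minr.
  rewrite mulNr rpredN; apply: (@dvdz_trans (2 * 2 ^+ minn (size s') k.+1)).
    by rewrite -exprS; apply: dvdz_exp2l; lia.
  by apply: dvdz_mul.
case: s sa pe sk ast => [|p s] // sa pe sk ast.
have := key p s sa ast; rewrite (_ : minn (size s) k.+1 = k.+1) //.
by apply/minn_idPr; move: sk => /=; rewrite ltnS.
Qed.

End Class.
End Alternating.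

(** Over [F_2], [1 + X^(2h) = (1 + X^h)^2], and an irreducible divisor of a square divides its root,
    against the minimality of [2h]. *)
Lemma poly_order_odd (p : {poly 'F_2}) q : irreducible_poly p -> is_poly_order p q -> odd q.
Proof.
move=> [sp ip] [q0 pq qmin]; apply: contraT => ev.
have eq : q = (q./2 + q./2)%N by rewrite addnn even_halfK.
have h0 : (0 < q./2)%N by rewrite half_gt0; case: q ev q0 {pq qmin eq} => [|[|]].
have two0 : 2%:R = 0 :> {poly 'F_2} by rewrite -polyC_natr (pchar_Fp_0 (isT : prime 2)).
have sq : 1 + 'X^q = (1 + 'X^(q./2)) * (1 + 'X^(q./2)) :> {poly 'F_2}.
  rewrite -expr2 sqrrD expr1n mul1r -mulr_natr two0 mulr0 addr0.
  by rewrite {1}eq exprD expr2.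
have : p %| 1 + 'X^(q./2).
  set g := gcdp p (1 + 'X^(q./2)).
  have [sg|sg] := eqVneq (size g) 1%N.
    by have := pq; rewrite sq Gauss_dvdpr // /coprimep -/g sg.
  have := ip g sg (dvdp_gcdl _ _).
  by move=> /andP[_ pg]; apply: dvdp_trans pg (dvdp_gcdr _ _).
move=> /(qmin _ h0); rewrite {1}eq; lia.
Qed.

(** Write [a = 2^i a'] with [a'] odd. If [a'] is a proper divisor of [m], removing a prime factor of
    [m / a'] from [2^k m] still leaves a multiple of [a]. *)
Lemma dvdn_full_divisor k m a : odd m -> (0 < a)%N ->
  (a %| 2 ^ k * m)%N && all (fun p => ~~ (a %| 2 ^ k * m %/ p)%N) (primes m) =
  (a \in [seq (2 ^ i * m)%N | i <- iota 0 k.+1]).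
Proof.
move=> om a0; have m0 : (0 < m)%N by apply: odd_gt0.
have c2 i : coprime (2 ^ i) m by rewrite coprimeXl // coprime2n.
apply/andP/mapP => [[ad /allP al] | [ i] ]; last first.
  rewrite mem_iota add0n ltnS => /= ik ->; split; first by rewrite dvdn_pmul2r // dvdn_exp2l.
  apply/allP => p; rewrite mem_primes => /and3P[pp _ pm].
  rewrite -muln_divA //; apply/negP => h.
  have : (m %| m %/ p)%N.
    have : (m %| 2 ^ k * (m %/ p))%N by apply: dvdn_trans h; rewrite dvdn_mull.
    by rewrite Gauss_dvdr // coprime_sym.
  move/dvdn_leq; rewrite divn_gt0 ?prime_gt0 // (dvdn_leq m0 pm) => /(_ isT).
  by rewrite leqNgt ltn_Pdiv // prime_gt1.
have [a' ca' ea] := pfactor_coprime (isT : prime 2) a0.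
have a'm : (a' %| m)%N.
  have : (a' %| 2 ^ k * m)%N by apply: dvdn_trans ad; rewrite ea dvdn_mulr.
  by rewrite Gauss_dvdr // coprime_sym coprimeXl.
have ik : (2 ^ logn 2 a %| 2 ^ k)%N.
  have : (2 ^ logn 2 a %| 2 ^ k * m)%N by apply: dvdn_trans ad; rewrite {2}ea dvdn_mull.
  by rewrite Gauss_dvdl.
have [ema|nam] := eqVneq a' m.
  exists (logn 2 a); last by rewrite {1}ea ema mulnC.
  by rewrite mem_iota add0n /= ltnS -(dvdn_Pexp2l _ _ (isT : (1 < 2)%N)).
have a'0 : (0 < a')%N by apply: dvdn_gt0 a'm.
have d1 : (1 < m %/ a')%N.
  by rewrite ltn_divRL // mul1n ltn_neqAle nam dvdn_leq.
have pp := pdiv_prime d1; set p := pdiv _ in pp.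
have pd : (p * a' %| m)%N by rewrite -[m in X in (_ %| X)%N](divnK a'm) dvdn_pmul2r // pdiv_dvd.
have pm : (p %| m)%N by apply: dvdn_trans pd; rewrite dvdn_mulr.
have := al p; rewrite mem_primes pp m0 pm => /(_ isT) /negP; case.
rewrite -muln_divA // ea mulnC dvdn_mul // dvdn_divRL // mulnC //.
Qed.

Lemma support_structure (I : finType) (q : I -> nat) (P : {poly 'F_2})
    (Pf : I -> {poly 'F_2}) (A : set nat) (k m : nat) :
  P.[0] = 1 -> P = \prod_i Pf i ->
  (forall i, irreducible_poly (Pf i)) -> (forall i, is_poly_order (Pf i) (q i)) ->
  (forall n : nat, (partition_count A n)%:R = P`_n :> 'F_2) ->
  odd m -> A (2 ^ k * m)%N ->
  exists i, ~~ has (bad_class (q i)) (primes m) /\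
    forall a, semi_bad_class (q i) a -> (count (in_coset (q i) a) (primes m) <= k.+1)%N.
Proof.
move=> P0 eP irr ord hP om Am; have m0 : (0 < m)%N by apply: odd_gt0.
have [F [hF sF]] := sigma_congruence eP P0 hP.
apply: contrapT => H.
set ps := primes m.
have aps : all prime ps by apply/allP => p; rewrite mem_primes => /andP[].
have ups : uniq ps := primes_uniq m.
have dQ : (\prod_(p <- ps) p %| m)%N.
  rewrite [X in (_ %| X)%N]prod_prime_decomp // prime_decompE big_map.
  suff S s : {subset s <= primes m} ->
      (\prod_(p <- s) p %| \prod_(p <- s) p ^ logn p m)%N by apply: S.
  elim: s => [|p s IH] h; first by rewrite !big_nil.
  rewrite !big_cons dvdn_mul //; last by apply: IH => r rs; apply: h; rewrite inE rs orbT.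
  have := h p (mem_head _ _); rewrite -logn_gt0 => l0.
  by rewrite -{1}[p]expn1 dvdn_exp2l.
(* [alt ps] at [n0] runs over the quotients of [m] by its squarefree divisors, as Moebius inversion
   at [m] requires. *)
pose n0 := (m %/ \prod_(p <- ps) p)%N.
have en : (n0 * \prod_(p <- ps) p = m)%N by rewrite divnK.
have n00 : (0 < n0)%N by move: m0; rewrite -en muln_gt0 => /andP[].
pose D : int := 2 ^+ k.+1.
pose f i n := psum (F i) (2 ^ k * n).
pose s n : int := (sigma_in A (2 ^ k * n))%:R.
have pow0 t : (0 < t)%N -> (0 < 2 ^ k * t)%N by rewrite muln_gt0 expn_gt0.
have tm t : (t %| n0 * \prod_(p <- ps) p)%N -> (0 < t)%N /\ (t %| m)%N.
  by rewrite en => tm; split => //; apply: dvdn_gt0 tm.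
have Df i : (D %| alt ps (f i) n0)%Z.
  have [F0 eF szF] := hF i; have [q0 dq _] := ord i.
  have per n : (0 < n)%N -> (D %| f i (n + q i)%N - f i n)%Z.
    by move=> n1; rewrite /f mulnDr; apply: psum_periodic => //; [rewrite eF | exact: pow0].
  have dbl n : (0 < n)%N -> (D %| f i (2 * n)%N - f i n)%Z.
    move=> n1; rewrite /f; have -> : (2 ^ k * (2 * n) = (2 ^ k * n).*2)%N by rewrite -mul2n; lia.
    by apply: psum_double; rewrite // -mul2n mulnA -expnS dvdn_mulr.
  have [hb|nb] := boolP (has (bad_class (q i)) (primes m)).
    case/hasP: hb => p pm pb; exact: (alt_bad per dbl n00 aps pm pb).
  have [a sa ca] : exists2 a, semi_bad_class (q i) a &
      (k.+1 < count (in_coset (q i) a) (primes m))%N.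
    apply: contrapT => H'; apply: H; exists i; split => // a sa.
    by rewrite leqNgt; apply/negP => ca; apply: H'; exists a.
  case/and3P: sa => _ _ sa; exact: (alt_semi_bad q0 per dbl n00 aps sa ca).
have Ds : (D %| alt ps s n0)%Z.
  rewrite -[alt ps s n0](subrK (alt ps (fun n => \sum_i f i n) n0)); apply: rpredD.
    apply: alt_congr => t /tm[t0 _]; rewrite -opprB rpredN /s /f; apply: sF.
      exact: pow0.
    exact: dvdn_mulr.
  by rewrite alt_sum; apply: rpred_sum => i _.
pose B := (2 ^ k * m)%N.
(* The sum over [a] is taken up to a bound that does not depend on [n], so that [alt] can be
   exchanged with it. *)
pose g n : int := \sum_(1 <= a < B.+1 | a \in A) a%:R * (a %| 2 ^ k * n)%N%:R.
have es : alt ps s n0 = alt ps g n0.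
  apply/eqP; rewrite -subr_eq0 -dvd0z; apply: alt_congr => t /tm[t0 td].
  rewrite dvd0z subr_eq0 /s /g /sigma_in natr_sum.
  have tB : (2 ^ k * t <= B)%N by rewrite leq_mul2l dvdn_leq ?orbT.
  rewrite [X in _ == X](big_cat_nat (n := (2 ^ k * t).+1)) //= [X in _ + X]big_nat_cond.
  rewrite [X in _ + X]big1 ?addr0; last first.
    by move=> a /andP[/andP[ta _] _]; rewrite gtnNdvd ?mulr0 // pow0.
  rewrite big_mkcondr; apply/eqP; apply: eq_bigr => a _.
  by case: (_ %| _)%N; rewrite ?mulr1 ?mulr0.
have eg : alt ps g n0 = (m * \sum_(i < k.+1 | (2 ^ i * m)%N \in A) 2 ^ i)%N%:R.
  rewrite /g alt_sum; under eq_bigr do rewrite alt_scale alt_dvd_indicator // en.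
  rewrite big_distrr natr_sum /=.
  rewrite big_nat_cond (eq_bigr (fun a : nat =>
    if a \in [seq (2 ^ i * m)%N | i <- iota 0 k.+1] then a%:R else 0)); last first.
    move=> a /andP[/andP[a0 _] _]; rewrite dvdn_full_divisor //.
    by case: (_ \in _); rewrite ?mulr1 ?mulr0.
  rewrite -big_nat_cond -big_mkcondr /= -big_filter.
  rewrite -(big_mkord (fun i => (2 ^ i * m)%N \in A) (fun i => (m * 2 ^ i)%N%:R)).
  rewrite [RHS](eq_bigr (fun i => (2 ^ i * m)%N%:R)); last by move=> i _; rewrite mulnC.
  rewrite -(big_map (fun i => 2 ^ i * m)%N (fun a => a \in A) (fun a => a%:R)).
  rewrite -[RHS]big_filter; apply: perm_big; apply: uniq_perm.
  - by rewrite filter_uniq // iota_uniq.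
  - rewrite filter_uniq // map_inj_uniq ?iota_uniq // => i i' /eqP.
    by rewrite eqn_pmul2r // eqn_exp2l // => /eqP.
  move=> a; rewrite !mem_filter /index_iota subn0 mem_iota.
  case: (boolP (a \in A)) => // aA.
  case: (boolP (a \in [seq (2 ^ i * m)%N | i <- iota 0 k.+1])) => [/mapP[ i]|_]; last by [].
  rewrite mem_iota => /= ik ->; rewrite subSS subn0 add1n muln_gt0 expn_gt0 m0 /=.
  by rewrite ltnS leq_mul2r leq_exp2l // -ltnS ik orbT.
move: Ds; rewrite es eg natz dvdzE abszX /= Gauss_dvdr; last by rewrite coprimeXl // coprime2n.
set T := (\sum_(_ < _ | _) _)%N => /dvdn_leq h.
have T0 : (0 < T)%N.
  rewrite /T (bigD1 ord_max) /=; first by rewrite addn_gt0 expn_gt0.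
  exact/mem_set.
have Tle : (T <= \sum_(i < k.+1) 2 ^ i)%N.
  by rewrite /T big_mkcond; apply: leq_sum => i _; case: ifP.
have e2 := predn_exp 2 k.+1; rewrite mul1n in e2.
have p2 : (0 < 2 ^ k.+1)%N by rewrite expn_gt0.
suff : (T < 2 ^ k.+1)%N by rewrite ltnNge (h T0).
by rewrite -(prednK p2) ltnS e2 Tle.
Qed.

(** * Dirichlet characters *)

Section Characters.
Variables (F : numClosedFieldType) (gT : finGroupType) (n : nat).
Variables (e : 'I_n.+1 -> gT) (r : gT -> 'I_n.+1).
Hypotheses (eK : cancel e r) (rK : cancel r e).

Definition regular_mx (x : gT) : 'M[F]_n.+1 :=
  \matrix_(i, j) (e j == (e i * x)%g)%:R.

Lemma regular_mxM (x y : gT) : regular_mx x * regular_mx y = regular_mx (x * y)%g.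
Proof.
apply/matrixP => i j; rewrite !mxE (bigD1 (r (e i * x)%g)) //=.
rewrite !mxE !rK eqxx mul1r mulgA big1 ?addr0 // => k kne.
rewrite !mxE; case: eqP => [ek|_]; last by rewrite mul0r.
by case/eqP: kne; rewrite -ek eK.
Qed.

Lemma regular_mx1 : regular_mx 1%g = 1.
Proof.
by apply/matrixP => i j; rewrite !mxE mulg1 (can_eq eK) eq_sym.
Qed.

Lemma regular_mxX (x : gT) k : regular_mx x ^+ k = regular_mx (x ^+ k)%g.
Proof.
elim: k => [|k IH]; first by rewrite expr0 expg0 regular_mx1.
by rewrite exprS IH regular_mxM expgS.
Qed.

Lemma tr_regular_mx (x : gT) :
  \tr (regular_mx x) = if x == 1%g then n.+1%:R else 0.
Proof.
rewrite /mxtrace; case: eqP => [->|xn].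
  under eq_bigr => i _ do rewrite mxE mulg1 eqxx.
  by rewrite sumr_const card_ord.
apply: big1 => i _; rewrite mxE; case: eqP => // ee; case: xn.
by apply: (mulgI (e i)); rewrite mulg1.
Qed.

Lemma diagonalizable_root_of_unity m (M : 'M[F]_m.+1) N :
  (0 < N)%N -> M ^+ N = 1 -> diagonalizable M.
Proof.
move=> N0 MN; apply/diagonalizableP.
have mon : ('X^N - 1 : {poly F}) \is monic by apply: monic_Xn_sub_1.
have [rs ers] := closed_field_poly_normal ('X^N - 1 : {poly F}).
rewrite (monicP mon) scale1r in ers.
exists rs; first by rewrite -separable_prod_XsubC -ers separable_Xn_sub_1 // pnatr_eq0 -lt0n.
by rewrite -ers mxminpoly_min // rmorphB /= rmorphXn /= horner_mx_X MN rmorph1 subrr.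
Qed.

(** The matrices of the regular representation commute and have finite order, so they are
    diagonalizable simultaneously; the characters are their diagonal entries in a common eigenbasis.
    The sum over the characters is the trace, which conjugation preserves and which is read off the
    permutation matrices. *)
Lemma exists_characters_of_enum : abelian [set: gT] ->
  exists chi : 'I_n.+1 -> gT -> F,
    [/\ forall i, chi i 1%g = 1,
        forall i x y, chi i (x * y)%g = chi i x * chi i y &
        forall x, \sum_i chi i x = if x == 1%g then n.+1%:R else 0].
Proof.
move=> abl.
have comm (x y : gT) : (x * y = y * x)%g.
  by move/centsP: abl => /(_ x (finset.in_setT x) y (finset.in_setT y)).
have [P Pu /allP /= Pd] : codiagonalizable [seq regular_mx x | x : gT].
  apply/codiagonalizableP; split => [f g /mapP[x _ ->] /mapP[y _ ->]|f /mapP[x _ ->]].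
    rewrite /comm_mx -[LHS]/(regular_mx x * regular_mx y).
    by rewrite -[RHS]/(regular_mx y * regular_mx x) !regular_mxM comm.
  apply: (@diagonalizable_root_of_unity _ _ #[x]%g); first exact: order_gt0.
  by rewrite regular_mxX expg_order regular_mx1.
pose D x := P * regular_mx x * P^-1.
have PU : P \is a GRing.unit by [].
have DM x y : D (x * y)%g = D x * D y.
  by rewrite /D -regular_mxM !mulrA divrK.
have D1 : D 1%g = 1 by rewrite /D regular_mx1 mulr1 divrr.
have Ddiag x : is_diag_mx (D x).
  have /Pd : regular_mx x \in [seq regular_mx x | x : gT].
    by apply: map_f; rewrite mem_enum.
  by rewrite /similar_to conjumx.
exists (fun i x => D x i i); split => [i|i x y|x].
- by rewrite D1 mxE eqxx.
- rewrite DM mxE (bigD1 i) //= big1 ?addr0 // => k ki.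
  by have /is_diag_mxP/(_ i k) -> := Ddiag x; rewrite ?mul0r // eq_sym.
- have -> : \sum_i D x i i = \tr (D x) by [].
  rewrite /D mxtrace_mulC -[X in mxtrace X]/(P^-1 * (P * regular_mx x)).
  by rewrite mulrA mulVr // mul1r tr_regular_mx.
Qed.

End Characters.

Lemma exists_characters (F : numClosedFieldType) (gT : finGroupType) :
  abelian [set: gT] ->
  exists (n : nat) (chi : 'I_n -> gT -> F), n = #|gT| /\
    [/\ forall i, chi i 1%g = 1,
        forall i x y, chi i (x * y)%g = chi i x * chi i y &
        forall x, \sum_i chi i x = if x == 1%g then n%:R else 0].
Proof.
move=> abl; have c0 : (0 < #|gT|)%N by apply/card_gt0P; exists 1%g.
have ec : #|gT| = #|gT|.-1.+1 by rewrite prednK.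
have eK : cancel (fun i => enum_val (cast_ord (esym ec) i) : gT)
                 (fun x => cast_ord ec (enum_rank x)).
  by move=> i; rewrite enum_valK cast_ordKV.
have rK : cancel (fun x => cast_ord ec (enum_rank x))
            (fun i => enum_val (cast_ord (esym ec) i) : gT).
  by move=> x; rewrite cast_ordK enum_rankK.
have [chi H] := exists_characters_of_enum F eK rK abl.
by exists #|gT|.-1.+1, chi; split.
Qed.

Definition dirichlet_character (F : fieldType) (q : nat) (chi : nat -> F) :=
  [/\ chi 1%N = 1, forall a b, chi (a * b)%N = chi a * chi b,
      forall a, chi (a %% q)%N = chi a &
      forall a, ~~ coprime q a -> chi a = 0].

Lemma exists_dirichlet_characters (F : numClosedFieldType) (q : nat) :
  (0 < q)%N ->
  exists chi : 'I_(totient q) -> nat -> F,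
    (forall i, dirichlet_character q (chi i)) /\
    forall a, \sum_i chi i a = if a == 1 %[mod q] then (totient q)%:R else 0.
Proof.
case: q => // -[_|q' _].
  (* ['Z_1] has two elements, so the modulus 1 is treated apart, with the constant 1 as its only
     character. *)
  have -> : totient 1 = 1%N by [].
  exists (fun _ _ => 1); split => [i|a]; last by rewrite big_ord1 !modn1.
  by split=> [|a b|a|a] //=; rewrite ?mulr1 ?coprime1n.
set q := q'.+2; have q1 : (1 < q)%N by [].
have [n [chi [en [chi1 chiM chiS]]]] := exists_characters F (units_Zp_abelian q).
have cn : n = totient q by rewrite en -card_units_Zp // cardsT.
move: chi chi1 chiM chiS; rewrite {n en}cn => chi chi1 chiM chiS.
pose un (a : nat) : option {unit 'Z_q} := insub (a%:R : 'Z_q).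
pose X i a := if un a is Some u then chi i u else 0.
have unP a : if coprime q a then exists2 u, un a = Some u & val u = a%:R else un a = None.
  case: ifPn => ca; rewrite /un.
    by case: insubP => [u _ eu|]; [exists u | rewrite unitZpE // ca].
  by rewrite insubF // unitZpE // (negbTE ca).
have un1 : un 1%N = Some 1%g.
  have := unP 1%N; rewrite coprimen1 => -[u -> eu]; congr Some.
  exact: val_inj.
exists X; split => [i|a].
  split => [|a b|a|a ca].
  - by rewrite /X un1 chi1.
  - have := unP (a * b)%N; have := unP a; have := unP b; rewrite coprimeMr /X.
    case: (coprime q a) => /=; last by move=> _ -> ->; rewrite mul0r.
    case: (coprime q b) => /=; last by move=> -> _ ->; rewrite mulr0.
    move=> [u -> eu] [v -> ev] [w -> ew].
    have -> : w = (v * u)%g by apply: val_inj; rewrite /= ew natrM eu ev.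
    by rewrite chiM.
  - by rewrite /X /un Zp_nat_mod.
  - by have := unP a; rewrite (negbTE ca) /X => ->.
have -> : (a == 1 %[mod q]) = (un a == Some 1%g).
  apply/eqP/eqP => [e|].
    by rewrite -un1 /un -[in LHS]Zp_nat_mod // e Zp_nat_mod.
  have := unP a; case: ifP => _; last by move=> ->.
  move=> [u -> eu] [u1]; have /(congr1 (@nat_of_ord _)) : a%:R = 1%:R :> 'Z_q.
    by rewrite -eu u1.
  by rewrite !val_Zp_nat.
rewrite /X; case: (un a) => [u|]; first by rewrite chiS.
by rewrite big1.
Qed.

(** * Dirichlet series of characters *)

Local Notation cabs := ComplexField.Normc.normc.
Local Notation "x %:C" := (real_complex _ x).

Section ComplexAbs.
Variable R : realType.
Implicit Types (z : R[i]) (x : R).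

Lemma cabs_ge0 z : 0 <= cabs z.
Proof. by case: z => a b; rewrite sqrtr_ge0. Qed.

Lemma cabs_real x : cabs x%:C = `|x|.
Proof. by rewrite /= expr0n addr0 sqrtr_sqr. Qed.

Lemma cabs0 : cabs (0 : R[i]) = 0.
Proof. by rewrite (cabs_real 0) normr0. Qed.

Lemma cabs1 : cabs (1 : R[i]) = 1.
Proof. by rewrite (cabs_real 1) normr1. Qed.

Lemma cabsM z1 z2 : cabs (z1 * z2) = cabs z1 * cabs z2.
Proof. exact: ComplexField.Normc.normcM. Qed.

Lemma cabsX z n : cabs (z ^+ n) = cabs z ^+ n.
Proof. by elim: n => [|n IH]; rewrite ?expr0 ?cabs1 // !exprS cabsM IH. Qed.

Lemma cabsD z1 z2 : cabs (z1 + z2) <= cabs z1 + cabs z2.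
Proof. exact: le_normcD. Qed.

Lemma cabsN z : cabs (- z) = cabs z.
Proof. exact: normcN. Qed.

Lemma cabsB z1 z2 : cabs (z1 - z2) <= cabs z1 + cabs z2.
Proof. by rewrite -(cabsN z2) cabsD. Qed.

Lemma cabs_distC z1 z2 : cabs (z1 - z2) = cabs (z2 - z1).
Proof. by rewrite -cabsN opprB. Qed.

Lemma cabs_sub_ge z1 z2 : cabs z1 - cabs z2 <= cabs (z1 - z2).
Proof. by rewrite lerBlDr -{1}(subrK z2 z1) cabsD. Qed.

Lemma cabs_sum (I : Type) (r : seq I) (P : pred I) (F : I -> R[i]) :
  cabs (\sum_(i <- r | P i) F i) <= \sum_(i <- r | P i) cabs (F i).
Proof.
elim/big_rec2: _ => [|i x y _ IH]; first by rewrite cabs0.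
by apply: le_trans (cabsD _ _) _; rewrite lerD2l.
Qed.

Lemma cabs_prod (I : Type) (r : seq I) (P : pred I) (F : I -> R[i]) :
  cabs (\prod_(i <- r | P i) F i) = \prod_(i <- r | P i) cabs (F i).
Proof. by apply: (big_morph _ cabsM cabs1). Qed.

Lemma cabs_sqr z : cabs z ^+ 2 = complex.Re z ^+ 2 + complex.Im z ^+ 2.
Proof. by case: z => a b /=; rewrite sqr_sqrtr // addr_ge0 // sqr_ge0. Qed.

Lemma Re_le_cabs z : `|complex.Re z| <= cabs z.
Proof.
rewrite -[leLHS]ger0_norm // -[leRHS]ger0_norm ?cabs_ge0 // -ler_sqr ?nnegrE //.
by rewrite normr_id !real_normK ?num_real // cabs_sqr lerDl sqr_ge0.
Qed.

End ComplexAbs.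

Section PowerSums.
Variable R : realType.
Implicit Types (s : R) (n : nat).

Lemma powRS_diff s n : 0 <= s -> (0 < n)%N ->
  s * (n.+1%:R : R) `^ (- (s + 1)) <= n%:R `^ (- s) - n.+1%:R `^ (- s)
  /\ n%:R `^ (- s) - n.+1%:R `^ (- s) <= s * (n%:R : R) `^ (- (s + 1)).
Proof.
move=> s0 n0.
have n0' : (0 : R) < n%:R by rewrite ltr0n.
have nS0 : (0 : R) < n.+1%:R by rewrite ltr0n.
(* The convex function [x^(-s)] lies above its tangent at [a]. With [b] on either side of [a] this
   gives both bounds. *)
have E (a b : R) : 0 < a -> 0 < b ->
    a `^ (- s) - b `^ (- s) <= s * (b - a) * a `^ (- (s + 1)).
  move=> a0 b0.
  have -> : a `^ (- (s + 1)) = a `^ (- s) / a.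
    rewrite opprD powRD; last by apply/implyP => _; rewrite gt_eqF.
    by rewrite powR_inv1 // ltW.
  have -> : b `^ (- s) = a `^ (- s) * expR (- s * ln (b / a)).
    rewrite -[in LHS](divfK (lt0r_neq0 a0) b) powRM ?divr_ge0 ?ltW // mulrC.
    by congr (_ * _); rewrite /powR gt_eqF // divr_gt0.
  have h1 : 1 + - s * ln (b / a) <= expR (- s * ln (b / a)) by apply: expR_ge1Dx.
  have h2 : ln (b / a) <= (b - a) / a.
    have -> : b / a = 1 + (b - a) / a by field; rewrite gt_eqF.
    apply: le_ln1Dx; rewrite -subr_gt0 opprK.
    have -> : (b - a) / a + 1 = b / a by field; rewrite gt_eqF.
    exact: divr_gt0.
  have pa : 0 < a `^ (- s) by apply: powR_gt0.
  have h3 : s * ln (b / a) <= s * ((b - a) / a) by apply: ler_wpM2l.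
  rewrite [leRHS](_ : _ = a `^ (- s) * (s * ((b - a) / a))); last by ring.
  rewrite -{1}[a `^ (- s)]mulr1 -mulrBr ler_pM2l //.
  lra.
split.
  have := E _ _ nS0 n0'; rewrite -[n.+1%:R]natr1; lra.
by have := E _ _ n0' nS0; rewrite -[n.+1%:R]natr1 addrAC subrr add0r mulr1.
Qed.

Lemma sum_powRN_le s M N : 0 < s -> (0 < M)%N -> (M <= N)%N ->
  \sum_(M <= n < N) (n.+1%:R : R) `^ (- (s + 1)) <= M%:R `^ (- s) / s.
Proof.
move=> s0 M0 MN; rewrite ler_pdivlMr // mulrC mulr_sumr.
apply: (@le_trans _ _ (\sum_(M <= n < N) (n%:R `^ (- s) - n.+1%:R `^ (- s)))).
  rewrite [leLHS]big_nat_cond [leRHS]big_nat_cond; apply: ler_sum => n.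
  rewrite andbT => /andP[Mn _].
  by case: (powRS_diff (ltW s0) (leq_trans M0 Mn)).
rewrite -[leLHS]opprK -sumrN; under eq_bigr do rewrite opprB.
by rewrite telescope_sumr // opprB gerBl powR_ge0.
Qed.

Lemma sum_powRN_ge s N : 0 < s ->
  (1 - N.+1%:R `^ (- s)) / s <= \sum_(1 <= n < N.+1) (n%:R : R) `^ (- (s + 1)).
Proof.
move=> s0; rewrite ler_pdivrMr // mulrC mulr_sumr.
apply: (@le_trans _ _ (\sum_(1 <= n < N.+1) (n%:R `^ (- s) - n.+1%:R `^ (- s)))); last first.
  rewrite [leLHS]big_nat_cond [leRHS]big_nat_cond; apply: ler_sum => n.
  rewrite andbT => /andP[Mn _].
  by case: (powRS_diff (ltW s0) Mn).
rewrite -[leRHS]opprK -sumrN; under eq_bigr do rewrite opprB.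
by rewrite telescope_sumr // opprB powR1.
Qed.

Lemma powRN_lt_eventually s (e : R) : 0 < s -> 0 < e ->
  exists N0 : nat, forall N, (N0 <= N)%N -> (N%:R : R) `^ (- s) < e.
Proof.
move=> s0 e0; have [N0 hN0] : exists N0 : nat, (e^-1 `^ s^-1) < N0%:R.
  by exists (Num.truncn (e^-1 `^ s^-1)).+1; rewrite truncnS_gt.
exists N0 => N N0N.
have hN : e^-1 `^ s^-1 < N%:R by apply: lt_le_trans hN0 _; rewrite ler_nat.
have ei : 0 < e^-1 by rewrite invr_gt0.
rewrite powRN -[e]invrK ltf_pV2 ?posrE //; last first.
  by apply: powR_gt0; apply: lt_trans hN; apply: powR_gt0.
rewrite -[ltLHS]powRr1 ?(ltW ei) // -[X in _ `^ X](mulVf (lt0r_neq0 s0)) powRrM.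
apply: gt0_ltr_powR => //; rewrite ?inE ?nnegrE ?powR_ge0 ?ler0n //.
Qed.

End PowerSums.

Section Abel.
Variable R : realType.

Lemma abel_summation (a : nat -> R[i]) (w : nat -> R) M N : (M <= N)%N ->
  \sum_(M <= n < N) a n * (w n)%:C =
  (\sum_(M <= n < N) a n) * (w N)%:C +
  \sum_(M <= n < N) (\sum_(M <= k < n.+1) a k) * (w n - w n.+1)%:C.
Proof.
elim: N => [|N IH].
  by rewrite leqn0 => /eqP ->; rewrite !big_geq // mul0r addr0.
rewrite leq_eqVlt ltnS => /predU1P[->|MN].
  by rewrite !big_geq // mul0r addr0.
rewrite !big_nat_recr //= IH // !rmorphB /=; ring.
Qed.

Lemma abel_bound (a : nat -> R[i]) (w : nat -> R) (B : R) M N : (M <= N)%N ->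
  (forall n, (M <= n)%N -> 0 <= w n) ->
  (forall n, (M <= n)%N -> w n.+1 <= w n) ->
  (forall k, cabs (\sum_(M <= n < k) a n) <= B) ->
  cabs (\sum_(M <= n < N) a n * (w n)%:C) <= B * w M.
Proof.
move=> MN w0 wS hB; rewrite abel_summation //.
apply: le_trans (cabsD _ _) _.
have -> : B * w M = B * w N + B * (w M - w N) by ring.
apply: lerD.
  by rewrite cabsM cabs_real ger0_norm ?w0 // ler_wpM2r ?w0.
apply: le_trans (cabs_sum _ _ _) _.
have -> : w M - w N = \sum_(M <= n < N) (w n - w n.+1).
  rewrite -[RHS]opprK -sumrN; under [in RHS]eq_bigr do rewrite opprB.
  by rewrite telescope_sumr // opprB.
rewrite mulr_sumr [leLHS]big_nat_cond [leRHS]big_nat_cond; apply: ler_sum => n.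
rewrite andbT => /andP[Mn _]; rewrite cabsM cabs_real ger0_norm ?subr_ge0 ?wS //.
by rewrite ler_wpM2r // subr_ge0 wS.
Qed.

End Abel.

Section Series.
Variable R : realType.
Implicit Types (e : R) (n : nat).

(** The parameter is [e = s - 1], so that [e = 0] is the point 1 and [Lsum] below is a partial sum
    of [L(1 + e, chi)]. *)
Definition twist (chi : nat -> R[i]) e n : R[i] := chi n * ((n%:R : R) `^ (- (e + 1)))%:C.
Definition Lsum (chi : nat -> R[i]) e N : R[i] := \sum_(1 <= n < N.+1) twist chi e n.

Lemma powRN_antitone e n : 0 <= e -> (0 < n)%N ->
  (n.+1%:R : R) `^ (- (e + 1)) <= n%:R `^ (- (e + 1)).
Proof.
move=> e0 n0; rewrite !powRN lef_pV2 ?posrE ?powR_gt0 ?ltr0n //.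
by apply: ge0_ler_powR; rewrite ?nnegrE ?ler0n ?ler_nat ?addr_ge0.
Qed.

Lemma powRN_le_inv e n : 0 <= e -> (0 < n)%N -> (n%:R : R) `^ (- (e + 1)) <= n%:R^-1.
Proof.
move=> e0 n0; rewrite -powR_inv1 ?ler0n //; apply: ler_powR; first by rewrite ler1n.
by rewrite opprD gerDr oppr_le0.
Qed.

Lemma twist_tail_bound chi (B : R) e M N :
  (forall M N, cabs (\sum_(M <= n < N) chi n) <= B) ->
  0 <= e -> (0 < M)%N -> (M <= N)%N ->
  cabs (\sum_(M <= n < N) twist chi e n) <= B / M%:R.
Proof.
move=> hB e0 M0 MN.
have B0 : 0 <= B by apply: le_trans (hB 0%N 0%N); rewrite cabs_ge0.
apply: le_trans (_ : B * M%:R `^ (- (e + 1)) <= _); last first.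
  by apply: ler_wpM2l => //; apply: powRN_le_inv.
apply: (abel_bound (w := fun n => n%:R `^ (- (e + 1)))) => // n Mn.
by apply: powRN_antitone => //; apply: leq_trans Mn.
Qed.

Lemma Lsum_dist chi (B : R) e M N :
  (forall M N, cabs (\sum_(M <= n < N) chi n) <= B) ->
  0 <= e -> (M <= N)%N ->
  cabs (Lsum chi e N - Lsum chi e M) <= B / M.+1%:R.
Proof.
move=> hB e0 MN; rewrite /Lsum (big_cat_nat (n := M.+1)) //= addrAC subrr add0r.
exact: twist_tail_bound.
Qed.

Lemma Lsum_bound chi (B : R) e N :
  (forall M N, cabs (\sum_(M <= n < N) chi n) <= B) ->
  0 <= e -> cabs (Lsum chi e N) <= B.
Proof.
by move=> hB e0; have := twist_tail_bound hB e0 (ltn0Sn 0) (ltn0Sn N); rewrite divr1.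
Qed.

Lemma tail_summation (a : nat -> R[i]) (v : nat -> R) N : (0 < N)%N ->
  \sum_(1 <= n < N) a n * (v n - v 1%N)%:C =
  \sum_(1 <= k < N) (v k.+1 - v k)%:C * \sum_(k.+1 <= n < N) a n.
Proof.
elim: N => // -[|N] IH _; first by rewrite !big_geq.
rewrite big_nat_recr //= IH // [RHS]big_nat_recr //= (@big_geq _ _ _ N.+2 N.+2) // mulr0 addr0.
transitivity (\sum_(1 <= k < N.+1) (v k.+1 - v k)%:C * (\sum_(k.+1 <= n < N.+1) a n + a N.+1)).
  under [in RHS]eq_bigr do rewrite mulrDr.
  rewrite big_split /=; congr (_ + _); rewrite -mulr_suml mulrC; congr (_ * _).
  by rewrite -(rmorph_sum (real_complex R)) /= telescope_sumr.
rewrite [LHS]big_nat_cond [RHS]big_nat_cond; apply: eq_bigr => k; rewrite andbT => /andP[k1 kN].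
by rewrite [in RHS]big_nat_recr.
Qed.

(** Continuity at [s = 1], uniformly in [N], by summation by parts against [n^(-e)]: its increments
    are at most [e / k], the tails of the series at 1 are at most [B / (k + 1)], and the sum of the
    [1 / (k (k + 1))] telescopes. *)
Lemma Lsum_diff chi (B : R) e N :
  (forall M N, cabs (\sum_(M <= n < N) chi n) <= B) ->
  0 <= e -> cabs (Lsum chi e N - Lsum chi 0 N) <= B * e.
Proof.
move=> hB e0.
have B0 : 0 <= B by apply: le_trans (hB 0%N 0%N); rewrite cabs_ge0.
pose v n : R := n%:R `^ (- e).
have -> : Lsum chi e N - Lsum chi 0 N = \sum_(1 <= n < N.+1) twist chi 0 n * (v n - v 1%N)%:C.
  rewrite /Lsum -sumrB [LHS]big_nat_cond [RHS]big_nat_cond; apply: eq_bigr => n.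
  rewrite andbT => /andP[n1 _]; rewrite /twist -mulrBr -mulrA; congr (_ * _).
  rewrite -rmorphB -rmorphM /=; congr real_complex_def.
  rewrite /v powR1 add0r opprD powRD; last by apply/implyP => _; rewrite pnatr_eq0 -lt0n.
  by ring.
rewrite tail_summation //; apply: le_trans (cabs_sum _ _ _) _.
apply: (@le_trans _ _ (\sum_(1 <= k < N.+1) B * e * (k%:R^-1 - k.+1%:R^-1))); last first.
  rewrite -mulr_sumr -[leRHS]mulr1; apply: ler_wpM2l; first exact: mulr_ge0.
  rewrite -[leLHS]opprK -sumrN; under eq_bigr do rewrite opprB.
  by rewrite telescope_sumr // opprB invr1 gerBl invr_ge0.
rewrite [leLHS]big_nat_cond [leRHS]big_nat_cond; apply: ler_sum => k.
rewrite andbT => /andP[k1 kN]; rewrite cabsM cabs_real.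
have [h1 h2] := powRS_diff e0 k1.
have h0 : 0 <= v k - v k.+1 by apply: le_trans h1; rewrite mulr_ge0 // powR_ge0.
rewrite distrC ger0_norm //.
have kp : 0 < k%:R :> R by rewrite ltr0n.
have h3 : v k - v k.+1 <= e * k%:R^-1.
  by apply: le_trans h2 _; apply: ler_wpM2l => //; apply: powRN_le_inv.
have h4 := twist_tail_bound hB (lexx 0) (ltn0Sn k) kN.
apply: le_trans (ler_pM h0 (cabs_ge0 _) h3 h4) _.
rewrite le_eqVlt; apply/orP; left; apply/eqP.
have kp1 : 0 < k.+1%:R :> R by rewrite ltr0n.
rewrite -[k.+1%:R]natr1 in kp1 *.
by field; rewrite !gt_eqF.
Qed.

End Series.

(** * Euler products for partial sums *)

Section Euler.
Variable R : realType.
Variables (f : nat -> R[i]) (e : R).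
Hypotheses (e0 : 0 < e) (f1 : f 1%N = 1) (fM : forall a b, f (a * b)%N = f a * f b).
Hypothesis fb : forall n, (0 < n)%N -> cabs (f n) <= (n%:R : R) `^ (- (e + 1)).

Lemma mult_tail_bound (P : pred nat) M N : (0 < M)%N -> (M <= N)%N ->
  cabs (\sum_(M <= n < N | P n) f n.+1) <= M%:R `^ (- e) / e.
Proof.
move=> M0 MN; apply: le_trans (sum_powRN_le e0 M0 MN).
apply: le_trans (cabs_sum _ _ _) _; rewrite [leRHS](bigID P) /= -[leLHS]addr0.
apply: lerD; first by apply: ler_sum => n _; apply: fb.
by apply: sumr_ge0 => n _; apply: powR_ge0.
Qed.

Lemma mult_tail_boundS (P : pred nat) M N : (0 < M)%N -> (M <= N)%N ->
  cabs (\sum_(M.+1 <= n < N.+1 | P n) f n) <= M%:R `^ (- e) / e.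
Proof.
by move=> M0 MN; rewrite big_add1 /=; apply: (mult_tail_bound (fun n => P n.+1)).
Qed.

Definition sifted (ps : seq nat) (n : nat) := all (fun p => ~~ (p %| n)%N) ps.

Lemma sifted_sum_step p ps N : prime p -> all prime ps -> p \notin ps ->
  \sum_(1 <= n < N.+1 | sifted (p :: ps) n) f n =
  \sum_(1 <= n < N.+1 | sifted ps n) f n -
    f p * \sum_(1 <= n < (N %/ p).+1 | sifted ps n) f n.
Proof.
move=> pp aps pn; apply/eqP; rewrite eq_sym subr_eq; apply/eqP.
rewrite [LHS](bigID (fun n => p %| n)%N) /= addrC; congr (_ + _).
  by apply: eq_bigl => n; rewrite andbC.
have p0 := prime_gt0 pp.
rewrite mulr_sumr; under [RHS]eq_bigr => n _ do rewrite -fM.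
have -> : \sum_(1 <= n < N.+1 | sifted ps n && (p %| n)%N) f n =
   \sum_(n < N.+1 | (0 < n)%N && (sifted ps n && (p %| n)%N)) f n.
  by rewrite -[in RHS](big_mkord (fun n => (0 < n)%N && (sifted ps n && (p %| n)%N)) f)
       [in RHS]big_ltn_cond //= [LHS]big_nat_cond [RHS]big_nat_cond;
     apply: eq_bigl => n; case: n.
have -> : \sum_(1 <= n < (N %/ p).+1 | sifted ps n) f (p * n)%N =
   \sum_(n < (N %/ p).+1 | (0 < n)%N && sifted ps n) f (p * n)%N.
  by rewrite -[in RHS](big_mkord (fun n => (0 < n)%N && sifted ps n) (fun n => f (p * n)%N))
       [in RHS]big_ltn_cond //= [LHS]big_nat_cond [RHS]big_nat_cond;
     apply: eq_bigl => n; case: n.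
have sif n : sifted ps (p * n)%N = sifted ps n.
  rewrite /sifted; apply: eq_in_all => r rps; rewrite Euclid_dvdM ?(allP aps) //.
  rewrite dvdn_prime2 ?(allP aps r rps) //; case: (eqVneq r p) => //= er.
  by rewrite er (negbTE pn) in rps.
rewrite (reindex_onto (fun i : 'I_(N %/ p).+1 => inord (p * i)%N : 'I_N.+1)
                      (fun j : 'I_N.+1 => inord (j %/ p)%N)) /=; last first.
  move=> j /and3P[j0 _ pj]; apply: val_inj => /=.
  rewrite inordK; last first.
    by rewrite ltnS inordK ?ltnS ?leq_div2r -1?ltnS // mulnC divnK // -ltnS.
  by rewrite inordK ?ltnS ?leq_div2r -1?ltnS // mulnC divnK.
have small (i : 'I_(N %/ p).+1) : (p * i < N.+1)%N.
  by rewrite ltnS mulnC -leq_divRL // -ltnS.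
apply: eq_big => [i|i _]; rewrite inordK ?small // sif dvdn_mulr // andbT.
rewrite muln_gt0 p0 /=; case: (0 < i)%N => //=; case: (sifted ps i) => //=.
by apply/eqP/val_inj; rewrite /= inordK mulKn.
Qed.

(** Sieving by [p] subtracts [f p] times the sum up to [N %/ p] instead of [N]; the difference is a
    tail that tends to 0, so the product formula holds in the limit. *)
Lemma sifted_sum_limit ps : all prime ps -> uniq ps -> forall eta : R, 0 < eta ->
  exists N0 : nat, forall N, (N0 <= N)%N ->
   cabs (\sum_(1 <= n < N.+1 | sifted ps n) f n -
         (\sum_(1 <= n < N.+1) f n) * \prod_(p <- ps) (1 - f p)) <= eta.
Proof.
elim: ps => [_ _ eta eta0|p ps IH /= /andP[pp aps] /andP[pn ups] eta eta0].
  by exists 0%N => N _; rewrite big_nil mulr1 subrr cabs0 ltW.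
have eta4 : 0 < eta / 4 by apply: divr_gt0.
have [N1 hN1] := IH aps ups _ eta4.
have eta2 : 0 < eta / 2 * e by rewrite mulr_gt0 // divr_gt0.
have [N2 hN2] := powRN_lt_eventually e0 eta2.
exists (maxn N1 (p * maxn 1 N2)) => N; rewrite geq_max => /andP[NN1 NN2].
have p0 := prime_gt0 pp.
have M0 : (maxn 1 N2 <= N %/ p)%N by rewrite leq_divRL // mulnC.
rewrite sifted_sum_step // big_cons.
set S := \sum_(1 <= n < N.+1 | sifted ps n) f n.
set S' := \sum_(1 <= n < (N %/ p).+1 | sifted ps n) f n.
set L := \sum_(1 <= n < N.+1) f n.
set Q := \prod_(_ <- _) _.
have -> : S - f p * S' - L * ((1 - f p) * Q) =
  (S - L * Q) - (f p * (S - L * Q)) + f p * (S - S') by ring.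
have hS : cabs (S - L * Q) <= eta / 4 by apply: hN1.
have hSS : cabs (S - S') <= eta / 2.
  have -> : S - S' = \sum_((N %/ p).+1 <= n < N.+1 | sifted ps n) f n.
    by rewrite /S (big_cat_nat (n := (N %/ p).+1)) //= ?ltnS ?leq_div // addrAC subrr add0r.
  apply: le_trans (mult_tail_boundS _ _ _) _; rewrite ?leq_div //.
    exact: leq_trans (leq_maxl _ _) M0.
  rewrite ler_pdivrMr //; apply/ltW/hN2; exact: leq_trans (leq_maxr _ _) M0.
have fp1 : cabs (f p) <= 1.
  apply: le_trans (fb p0) _; apply: le_trans (powRN_le_inv (ltW e0) p0) _.
  by rewrite invf_le1 ?ler1n ?ltr0n.
apply: le_trans (cabsD _ _) _.
apply: le_trans (lerD (cabsB _ _) (lexx _)) _; rewrite !cabsM.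
have h1 : cabs (f p) * cabs (S - L * Q) <= 1 * (eta / 4) by apply: ler_pM; rewrite ?cabs_ge0.
have h2 : cabs (f p) * cabs (S - S') <= 1 * (eta / 2) by apply: ler_pM; rewrite ?cabs_ge0.
lra.
Qed.

(** An integer above 1 with no prime factor up to [Y] exceeds [Y], so the sifted sum is [f 1 = 1] up
    to a tail. The error 1/2 keeps the product between 1/2 and 3/2 in absolute value, enough for a
    logarithm with bounded error. *)
Lemma euler_product : exists Y0 : nat, forall Y, (Y0 <= Y)%N ->
  exists N0 : nat, forall N, (N0 <= N)%N ->
  cabs ((\sum_(1 <= n < N.+1) f n) * \prod_(0 <= p < Y.+1 | prime p) (1 - f p) - 1)
    <= 2^-1.
Proof.
have e4 : 0 < 4^-1 * e by rewrite mulr_gt0 // invr_gt0.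
have [Y0 hY0] := powRN_lt_eventually e0 e4.
exists (maxn 1 Y0) => Y; rewrite geq_max => /andP[Y1 YY0].
pose ps := [seq p <- index_iota 0 Y.+1 | prime p].
have aps : all prime ps by apply: filter_all.
have ups : uniq ps by rewrite filter_uniq // iota_uniq.
have q4 : 0 < 4^-1 :> R by rewrite invr_gt0.
have [N0 hN0] := sifted_sum_limit aps ups q4.
exists (maxn N0 Y) => N; rewrite geq_max => /andP[NN0 NY].
have := hN0 _ NN0; rewrite /ps big_filter.
set L := \sum_(1 <= n < N.+1) f n; set Q := \prod_(_ <- _ | _) _.
set S := \sum_(_ <= _ < _ | _) _ => hS.
have hS1 : cabs (S - 1) <= 4^-1.
  have -> : S - 1 = \sum_(Y.+1 <= n < N.+1 | sifted ps n) f n.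
    rewrite /S (big_cat_nat (n := Y.+1)) //= ?ltnS //.
    rewrite big_ltn_cond // {1}/sifted.
    have -> : all (fun p => ~~ (p %| 1)%N) ps.
      apply/allP => p /(allP aps) pp; rewrite dvdn1; apply: contraTneq pp => -> //.
    rewrite f1 big_nat_cond big1 ?addr0; first by rewrite addrAC subrr add0r.
    move=> n /andP[/andP[n1 nY] /allP sn].
    have := sn (pdiv n); rewrite pdiv_dvd /ps mem_filter mem_iota pdiv_prime //=.
    by rewrite pdiv_gt0 add1n ltnS (leq_trans (pdiv_leq (ltnW n1))) // => /(_ isT).
  apply: le_trans (mult_tail_boundS _ _ _) _ => //.
  by rewrite ler_pdivrMr //; apply/ltW/hY0.
have -> : L * Q - 1 = (S - 1) - (S - L * Q) by ring.
apply: le_trans (cabsB _ _) _; lra.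
Qed.

End Euler.

Section LogBounds.
Variable R : realType.

Lemma cabs_one_sub_sqr (z : R[i]) :
  cabs (1 - z) ^+ 2 = 1 + (- 2 * complex.Re z + cabs z ^+ 2).
Proof. by rewrite !cabs_sqr; case: z => a b /=; ring. Qed.

(** With [|1 - z|^2 = 1 + u] and [u = - 2 Re z + |z|^2], real inequalities for [ln (1 + u)] suffice.
    Since [1 + u >= 1/4] and [|u| <= 5/2 |z|], the error [u^2 / (1 + u)] is at most [25 |z|^2];
    halving gives a constant below 13. *)
Lemma ln_cabs_one_sub (z : R[i]) : cabs z <= 2^-1 ->
  [/\ 0 < cabs (1 - z),
      ln (cabs (1 - z)) <= - complex.Re z + cabs z ^+ 2 &
      - complex.Re z - 13 * cabs z ^+ 2 <= ln (cabs (1 - z))].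
Proof.
move=> zh; set t := cabs z in zh *; set x := complex.Re z.
have t0 : 0 <= t by apply: cabs_ge0.
have xt : - t <= x <= t by rewrite -ler_norml; apply: Re_le_cabs.
have c2 : 2^-1 <= cabs (1 - z).
  have := cabs_sub_ge 1 z; rewrite cabs1 -/t; lra.
have c0 : 0 < cabs (1 - z) by apply: lt_le_trans c2; rewrite invr_gt0.
have := cabs_one_sub_sqr z; rewrite -/t -/x; set u := - 2 * x + t ^+ 2 => eu.
have lnu : ln (cabs (1 - z)) *+ 2 = ln (1 + u) by rewrite -lnXn // eu.
have u1 : 1 + u >= 4^-1 by rewrite -eu; nra.
have up : ln (1 + u) <= u by apply: le_ln1Dx; lra.
have u0 : 0 < 1 + u by lra.
have lo : u - u ^+ 2 / (1 + u) <= ln (1 + u).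
  have -> : ln (1 + u) = - ln (1 + - (u / (1 + u))).
    rewrite -lnV; last by rewrite posrE; have -> : 1 + - (u / (1 + u)) = (1 + u)^-1;
      [by field; rewrite gt_eqF | rewrite invr_gt0].
    by congr ln; field; rewrite gt_eqF //= addrK oner_neq0.
  have h : -1 < - (u / (1 + u)).
    rewrite ltrN2 ltr_pdivrMr //; lra.
  have := le_ln1Dx h.
  have -> : u - u ^+ 2 / (1 + u) = u / (1 + u) by field; rewrite gt_eqF.
  lra.
have ub : - (5/2 * t) <= u <= 5/2 * t.
  have tt : 0 <= t ^+ 2 <= t / 2 by rewrite sqr_ge0 /=; nra.
  rewrite /u; lra.
have u2 : u ^+ 2 / (1 + u) <= 25 * t ^+ 2.
  rewrite ler_pdivrMr //.
  have : u ^+ 2 <= (25/4) * t ^+ 2 by nra.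
  have : 0 <= t ^+ 2 by apply: sqr_ge0.
  nra.
have t2 := sqr_ge0 t.
have lo2 : u - 25 * t ^+ 2 <= ln (1 + u) by lra.
rewrite mulr2n in lnu; move: lnu up lo2; rewrite {1 2}/u => lnu up lo2.
have eu' : u = - 2 * x + t ^+ 2 by [].
by split => //; lra.
Qed.

End LogBounds.

(** * Orthogonality relations and subgroups of the residue classes *)

Section DirichletCharacters.
Variables (R : realType) (q : nat).
Hypothesis q0 : (0 < q)%N.
Implicit Types chi psi : nat -> R[i].

Lemma char_cabs chi a : dirichlet_character q chi -> coprime q a -> cabs (chi a) = 1.
Proof.
move=> [c1 cM cm _] ca.
have cX k : chi (a ^ k)%N = chi a ^+ k by elim: k => // k IH; rewrite expnS cM IH exprS.
have : cabs (chi a) ^+ totient q = 1.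
  rewrite -cabsX -cX -cm Euler_exp_totient 1?coprime_sym // cm c1; exact: cabs1.
by move/eqP; rewrite pexpr_eq1 ?cabs_ge0 ?totient_gt0 // => /eqP.
Qed.

Lemma char_cabs_le1 chi a : dirichlet_character q chi -> cabs (chi a) <= 1.
Proof.
move=> H; have [ca|nca] := boolP (coprime q a); first by rewrite (char_cabs H).
by case: H => _ _ _ /(_ _ nca) ->; rewrite cabs0.
Qed.

Definition trivial_char chi := forall a, coprime q a -> chi a = 1.

Lemma nontrivial_char chi : ~ trivial_char chi -> exists2 b, coprime q b & chi b <> 1.
Proof.
move=> H; apply: contrapT => H'; apply: H => a ca; apply: contrapT => c1.
by apply: H'; exists a.
Qed.

Definition residue_group (K : pred nat) :=
  [/\ K 1%N, forall a b, K a -> K b -> K (a * b)%N,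
      forall a, K (a %% q)%N = K a & forall a, K a -> coprime q a].

Lemma residue_group_inv K a : residue_group K -> K a ->
  exists2 b, K b & (a * b = 1 %[mod q])%N.
Proof.
move=> [K1 KM Km Kc] Ka; exists (a ^ (totient q).-1)%N.
  by elim: (totient q).-1 => [|k IH]; rewrite ?expn0 // expnS KM.
by rewrite -expnS prednK ?totient_gt0 // Euler_exp_totient // coprime_sym Kc.
Qed.

(* Multiplication by a member of [K] permutes the residues lying in [K]. *)
Lemma sum_residue_group_shift (V : nmodType) (K : pred nat) (F : nat -> V) a :
  residue_group K -> (forall n, F (n %% q)%N = F n) -> K a ->
  \sum_(k < q | K k) F (a * k)%N = \sum_(k < q | K k) F k.
Proof.
move=> HK Fm Ka; have [b Kb ab] := residue_group_inv HK Ka.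
have [K1 KM Km Kc] := HK.
have lt n : (n %% q < q)%N by rewrite ltn_pmod.
rewrite [RHS](reindex_onto (fun i : 'I_q => Ordinal (lt (a * i)%N))
                    (fun j : 'I_q => Ordinal (lt (b * j)%N))) /=; last first.
  move=> j Kj; apply: val_inj => /=.
  by rewrite modnMmr mulnA -modnMml ab modnMml mul1n modn_small.
apply: eq_big => [i|i _]; last by rewrite Fm.
rewrite Km; apply/idP/andP => [Ki|[Kai /eqP <-] /=].
  split; first exact: KM.
  apply/eqP/val_inj => /=.
  by rewrite modnMmr mulnA [(b * a)%N]mulnC -modnMml ab modnMml mul1n modn_small.
by rewrite Km KM // Km.
Qed.

Lemma sum_char_residue_group chi (K : pred nat) :
  dirichlet_character q chi -> residue_group K ->
  (exists2 b, K b & chi b <> 1) -> \sum_(k < q | K k) chi k = 0.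
Proof.
move=> [c1 cM cm _] HK [b Kb cb].
have := sum_residue_group_shift HK cm Kb.
under eq_bigr do rewrite cM.
rewrite -mulr_sumr => /eqP; rewrite -{2}[\sum_(_ < _ | _) _]mul1r -subr_eq0 -mulrBl mulf_eq0.
by rewrite subr_eq0 => /orP[/eqP//|/eqP].
Qed.

Lemma residue_group_coprime : residue_group (coprime q).
Proof.
split=> //; first exact: coprimen1.
- by move=> a b ca cb; rewrite coprimeMr ca.
- by move=> a; rewrite coprime_modr.
Qed.

Lemma sum_nontrivial_char chi : dirichlet_character q chi -> ~ trivial_char chi ->
  \sum_(k < q) chi k = 0.
Proof.
move=> H /nontrivial_char nt.
rewrite -[RHS](sum_char_residue_group H residue_group_coprime nt) [RHS]big_mkcond /=.
apply: eq_bigr => k _; case: ifPn => // nck.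
by case: H => _ _ _ ->.
Qed.

Lemma char_sum_bound chi : dirichlet_character q chi -> ~ trivial_char chi ->
  forall M N, cabs (\sum_(M <= n < N) chi n) <= (2 * q)%:R.
Proof.
move=> H nt; have [_ _ cm _] := H.
have s0 := sum_nontrivial_char H nt.
have small r : (r <= q)%N -> cabs (\sum_(0 <= n < r) chi n) <= q%:R.
  move=> rq; apply: le_trans (cabs_sum _ _ _) _.
  apply: le_trans (ler_sum _ (fun i _ => char_cabs_le1 i H)) _.
  by rewrite sumr_const_nat subn0 ler_nat.
have pre N : \sum_(0 <= n < N) chi n = \sum_(0 <= n < N %% q) chi n.
  rewrite {1}(divn_eq N q); elim: (N %/ q)%N => [|k IH]; first by rewrite mul0n add0n.
  rewrite mulSn -addnA (big_cat_nat (n := q)) ?leq_addr //= big_mkord s0 add0r -IH.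
  rewrite -{1}[q]add0n big_addn addKn.
  by apply: eq_bigr => i _; rewrite -cm modnDr cm.
have pb N : cabs (\sum_(0 <= n < N) chi n) <= q%:R.
  by rewrite pre small // ltnW // ltn_pmod.
move=> M N; have [MN|NM] := leqP M N; last first.
  by rewrite big_geq ?cabs0 ?ler0n // ltnW.
have -> : \sum_(M <= n < N) chi n = \sum_(0 <= n < N) chi n - \sum_(0 <= n < M) chi n.
  by rewrite [X in _ = X - _](big_cat_nat (n := M)) //= addrAC subrr add0r.
apply: le_trans (cabsB _ _) _; rewrite mul2n -addnn natrD; exact: lerD.
Qed.

Section Family.
Variable chi : 'I_(totient q) -> nat -> R[i].
Hypothesis chiP : forall i, dirichlet_character q (chi i).
Hypothesis chiS : forall a, \sum_i chi i a =
  if (a == 1 %[mod q])%N then (totient q)%:R else 0.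

Definition in_annihilator (K : pred nat) i := `[< forall a, K a -> chi i a = 1 >].

(** Both sides are the sum of [chi i (a k)] over all [i] and all [k] in [K]. Summed over [k], only
    the characters trivial on [K] survive; summed over [i], only the inverse of [a]. *)
Lemma sum_annihilator K a : residue_group K ->
  (\sum_(k < q | K k) 1) * (\sum_(i | in_annihilator K i) chi i a) =
  if K a then (totient q)%:R else 0.
Proof.
move=> HK; have [K1 KM Km Kc] := HK.
have sumK i : \sum_(k < q | K k) chi i k =
    if in_annihilator K i then \sum_(k < q | K k) 1 else 0.
  rewrite /in_annihilator; case: asboolP => [H|nH]; first by apply: eq_bigr => k /H.
  apply: (sum_char_residue_group (chiP i) HK); apply: contrapT => H; apply: nH => b Kb.
  by apply: contrapT => cb; apply: H; exists b.
have -> : (\sum_(k < q | K k) 1) * (\sum_(i | in_annihilator K i) chi i a) =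
   \sum_i \sum_(k < q | K k) chi i (a * k)%N.
  rewrite mulr_sumr big_mkcond; apply: eq_bigr => i _.
  have [_ cM _ _] := chiP i; under [RHS]eq_bigr do rewrite cM.
  by rewrite -mulr_sumr sumK; case: ifP => _; rewrite ?mulr0 // mulrC.
rewrite exchange_big /=; under eq_bigr do rewrite chiS.
case: ifPn => [Ka|nKa]; last first.
  apply: big1 => k Kk; case: ifP => // /eqP ak.
  case/negP: nKa; have [b Kb kb] := residue_group_inv HK Kk.
  by rewrite -Km -[a]muln1 -modnMmr -kb modnMmr mulnA -modnMml ak modnMml mul1n Km.
rewrite (sum_residue_group_shift (F := fun n => if (n == 1 %[mod q])%N then _ else _) HK) //; last first.
  by move=> n; rewrite modn_mod.
have l1 : (1 %% q < q)%N by rewrite ltn_pmod.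
rewrite (bigD1 (Ordinal l1)) /= ?Km // modn_mod eqxx big1 ?addr0 // => k /andP[_ kn].
case: eqP => // ek; case/eqP: kn; apply: val_inj => /=.
by rewrite -ek modn_small.
Qed.

Lemma card_annihilator K : residue_group K ->
  (\sum_(k < q | K k) 1 : R) * (\sum_(i | in_annihilator K i) 1) = (totient q)%:R.
Proof.
move=> HK; have := sum_annihilator 1 HK; have [-> _ _ _] := HK.
under [X in _ * X]eq_bigr => i _ do case: (chiP i) => -> _ _ _.
rewrite !sumr_const -!natrM => /eqP; rewrite eqr_nat => /eqP ->.
by [].
Qed.

(** The family is known only through its orthogonality relation; that it contains every character
    exactly once follows by evaluating the sum of [chi j a / psi a] over [j] and the [a] prime to
    [q] in both orders. *)
Lemma char_unique psi : dirichlet_character q psi ->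
  exists i, forall j, (forall a, chi j a = psi a) <-> j = i.
Proof.
move=> H; have [p1 pM pm p0] := H.
pose E j := `[< forall a, chi j a = psi a >].
have tq : (0 < totient q)%N by rewrite totient_gt0.
have S j : \sum_(a < q | coprime q a) ((psi a)^-1 * chi j a) = if E j then (totient q)%:R else 0.
  have [c1 cM cm cc] := chiP j.
  have HD : dirichlet_character q (fun a => (psi a)^-1 * chi j a).
    split; first by rewrite p1 c1 invr1 mulr1.
    - by move=> a b; rewrite pM cM invfM; ring.
    - by move=> a; rewrite pm cm.
    - by move=> a ca; rewrite cc // mulr0.
  have pne a : coprime q a -> psi a != 0.
    move=> ca; have := char_cabs H ca; apply: contra_eq_neq => ->.
    by rewrite cabs0 eq_sym oner_neq0.
  rewrite /E; case: asboolP => [Ej|nEj].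
    under eq_bigr => a ca do rewrite Ej mulVf ?pne //.
    rewrite sumr_const totient_count_coprime; congr (_ *+ _).
    by rewrite -sum1_card big_mkord -big_mkcond.
  apply: (sum_char_residue_group HD residue_group_coprime).
  apply: nontrivial_char => T; apply: nEj => a.
  have [ca|nca] := boolP (coprime q a); last by rewrite cc // p0.
  have := T a ca; have := pne a ca => pa /(congr1 (fun z => psi a * z)).
  by rewrite mulrA divff // mul1r mulr1.
have : \sum_j (if E j then (totient q)%:R else 0) = (totient q)%:R :> R[i].
  under eq_bigr do rewrite -S.
  rewrite exchange_big /=.
  under eq_bigr => a _ do rewrite -mulr_sumr chiS.
  have l1 : (1 %% q < q)%N by rewrite ltn_pmod.
  rewrite (bigD1 (Ordinal l1)) /= ?coprime_modr ?coprimen1 //.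
  rewrite pm p1 modn_mod eqxx invr1 mul1r big1 ?addr0 // => a /andP[_ an].
  case: eqP; rewrite ?mulr0 // => ea; case/eqP: an; apply: val_inj => /=.
  by rewrite -ea modn_small.
rewrite -big_mkcond /= sumr_const -mulrnA => /eqP; rewrite eqr_nat.
set D := (X in (_ * #|X|)%N) => h; have /mem_card1[i Ei] : #|D| = 1%N.
  by apply/eqP; rewrite -(eqn_pmul2l tq) muln1.
exists i => j; have := Ei j; rewrite !inE /E => e; split.
  by move/asboolP; rewrite unfold_in in e; rewrite e => /eqP.
by move=> ->; apply/asboolP; have := Ei i; rewrite !inE unfold_in /E eqxx.
Qed.

End Family.
End DirichletCharacters.

(** * Nonvanishing at 1 *)

Section DivisorSum.
Variables (R : realDomainType) (x : nat -> R).
Hypotheses (x1 : x 1%N = 1) (xM : forall a b, x (a * b)%N = x a * x b).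
Hypothesis xv : forall n, [\/ x n = 0, x n = 1 | x n = -1].

Definition divisor_sum m := \sum_(d <- divisors m) x d.

Lemma divisor_sum_pfactorS p k m : prime p -> ~~ (p %| m)%N -> (0 < m)%N ->
  divisor_sum (p ^ k.+1 * m) = divisor_sum (p ^ k * m) + x p ^+ k.+1 * divisor_sum m.
Proof.
move=> pp pm m0; have p0 := prime_gt0 pp.
have pk0 j : (0 < p ^ j)%N by rewrite expn_gt0 p0.
have xX j : x (p ^ j)%N = x p ^+ j by elim: j => // j IH; rewrite expnS xM IH exprS.
rewrite /divisor_sum -xX mulr_sumr; under [X in _ + X]eq_bigr do rewrite -xM.
rewrite -(big_map (fun d => p ^ k.+1 * d)%N xpredT x) -big_cat; apply: perm_big.
apply: uniq_perm.
- exact: divisors_uniq.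
- rewrite cat_uniq divisors_uniq map_inj_uniq ?divisors_uniq ?andbT /=.
    apply/hasPn => _ /mapP[d dm ->]; rewrite -dvdn_divisors ?muln_gt0 ?pk0 //.
    rewrite expnSr -mulnA dvdn_pmul2l //; apply: contra pm.
    exact: dvdn_trans (dvdn_mulr _ (dvdnn _)).
  by move=> a b /eqP; rewrite eqn_pmul2l // => /eqP.
- move=> d; rewrite mem_cat -!dvdn_divisors ?muln_gt0 ?pk0 //.
  apply/idP/orP => [dd|[|/mapP[d']]]; last 2 first.
  + by move=> h; apply: (dvdn_trans h); rewrite dvdn_pmul2r // dvdn_exp2l.
  + by rewrite -dvdn_divisors // => d'm ->; rewrite dvdn_pmul2l.
  have d0 : (0 < d)%N by apply: dvdn_gt0 dd; rewrite muln_gt0 pk0.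
  have [d1 cd1 ed] := pfactor_coprime pp d0.
  have cp : coprime p m by rewrite prime_coprime.
  have d1m : (d1 %| m)%N.
    have : (d1 %| p ^ k.+1 * m)%N by apply: dvdn_trans dd; rewrite ed dvdn_mulr.
    by rewrite Gauss_dvdr // coprime_sym coprimeXl.
  have jk : (logn p d <= k.+1)%N.
    have := dvdn_leq_log p _ dd; rewrite muln_gt0 pk0 m0 => /(_ isT).
    by rewrite lognM // pfactorK // (logn_coprime cp) addn0.
  move: jk; rewrite leq_eqVlt => /predU1P[jk|jk].
    right; apply/mapP; exists d1; first by rewrite -dvdn_divisors.
    by rewrite {1}ed jk mulnC.
  by left; rewrite ed mulnC dvdn_mul // dvdn_exp2l.
Qed.

Lemma divisor_sum_pfactor p k m : prime p -> ~~ (p %| m)%N -> (0 < m)%N ->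
  divisor_sum (p ^ k * m) = (\sum_(j < k.+1) x p ^+ j) * divisor_sum m.
Proof.
move=> pp pm m0; elim: k => [|k IH]; first by rewrite mul1n big_ord1 mul1r.
by rewrite divisor_sum_pfactorS // IH [in RHS]big_ord_recr /= mulrDl.
Qed.

Lemma geom_sum_ge0 n k : 0 <= \sum_(j < k.+1) x n ^+ j /\
   1 <= \sum_(j < k.*2.+1) x n ^+ j.
Proof.
have alternating i : \sum_(j < i) (-1 : R) ^+ j = (odd i)%:R.
  elim: i => [|i IH]; first by rewrite big_ord0.
  rewrite big_ord_recr /= IH -signr_odd; case: (odd i) => /=.
    by rewrite expr1 subrr.
  by rewrite expr0 add0r.
case: (xv n) => ->; split.
- by rewrite big_ord_recl /= expr0 addr_ge0 // sumr_ge0 // => j _; rewrite exprn_ge0.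
- by rewrite big_ord_recl /= expr0 lerDl sumr_ge0 // => j _; rewrite exprn_ge0.
- by apply: sumr_ge0 => j _; rewrite expr1n.
- by rewrite big_ord_recl /= expr0 lerDl sumr_ge0 // => j _; rewrite expr1n.
- by rewrite alternating ler0n.
- by rewrite alternating /= odd_double.
Qed.

Lemma divisor_sum1 : divisor_sum 1 = 1.
Proof. by rewrite /divisor_sum (_ : divisors 1 = [:: 1%N]) // big_seq1. Qed.

Lemma divisor_sum_ge0 m : (0 < m)%N -> 0 <= divisor_sum m.
Proof.
elim/ltn_ind: m => m IH m0; have [->|m1] := eqVneq m 1%N; first by rewrite divisor_sum1 ler01.
have m2 : (1 < m)%N by rewrite ltn_neqAle eq_sym m1.
have pp := pdiv_prime m2; set p := pdiv m in pp.
have [m' cm em] := pfactor_coprime pp m0.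
have m'0 : (0 < m')%N by move: m0; rewrite em muln_gt0 => /andP[].
rewrite em mulnC divisor_sum_pfactor -?prime_coprime //.
apply: mulr_ge0; first by case: (geom_sum_ge0 p (logn p m)).
apply: IH => //; rewrite [X in (_ < X)%N]em ltn_Pmulr //.
by rewrite -[1%N](expn0 p) ltn_exp2l ?prime_gt1 // logn_gt0 mem_primes pp m0 pdiv_dvd.
Qed.

Lemma divisor_sum_square m : (0 < m)%N -> 1 <= divisor_sum (m ^ 2).
Proof.
elim/ltn_ind: m => m IH m0; have [->|m1] := eqVneq m 1%N; first by rewrite divisor_sum1.
have m2 : (1 < m)%N by rewrite ltn_neqAle eq_sym m1.
have pp := pdiv_prime m2; set p := pdiv m in pp.
have [m' cm em] := pfactor_coprime pp m0.
have m'0 : (0 < m')%N by move: m0; rewrite em muln_gt0 => /andP[].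
rewrite em expnMn mulnC -expnM muln2 divisor_sum_pfactor -?prime_coprime //; last first.
- by rewrite expn_gt0 m'0.
- by rewrite coprimeXr.
rewrite -[1]mulr1; apply: ler_pM => //; first by case: (geom_sum_ge0 p (logn p m)).
apply: IH => //; rewrite [X in (_ < X)%N]em ltn_Pmulr //.
by rewrite -[1%N](expn0 p) ltn_exp2l ?prime_gt1 // logn_gt0 mem_primes pp m0 pdiv_dvd.
Qed.

End DivisorSum.

(** * Lambert series and real characters *)

Section Lambert.
Variable R : realType.
Variable u : R.
Hypotheses (u0 : 0 < u) (u1 : u < 1).
(** A square, so that the AM-GM lower bound [n t^((n-1)/2)] of the geometric sum is an integral
    power of [u]. *)
Let t := u ^+ 2.

Let geo n : R := \sum_(j < n) t ^+ j.

Lemma lambert_t_bounds : 0 < t < 1.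
Proof. by rewrite /t exprn_gt0 //= exprn_ilt1 // ltW. Qed.

Lemma geoE n : (1 - t) * geo n = 1 - t ^+ n.
Proof. by rewrite -opprB mulNr -subrX1 opprB. Qed.

(* AM-GM on the terms [j] and [n.-1 - j] of the geometric sum. *)
Lemma geo_ge n : n%:R * u ^+ n.-1 <= geo n.
Proof.
case: n => [|n]; first by rewrite mul0r /geo big_ord0.
suff : (n.+1%:R * u ^+ n) *+ 2 <= geo n.+1 *+ 2 by rewrite lerMn2r.
rewrite [leRHS]mulr2n {2}/geo (reindex_inj rev_ord_inj) /= -big_split /=.
have -> : n.+1%:R * u ^+ n *+ 2 = \sum_(i < n.+1) u ^+ n *+ 2.
  by rewrite sumr_const card_ord mulr_natl -!mulrnA mulnC.
apply: ler_sum => i _; rewrite subSS.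
have -> : u ^+ n = u ^+ i * u ^+ (n - i) by rewrite -exprD subnKC // -ltnS.
rewrite /t -!exprM ![(2 * _)%N]mulnC !exprM.
have := sqr_ge0 (u ^+ i - u ^+ (n - i)); rewrite mulr2n; nra.
Qed.

Definition lambert_weight n : R := (n%:R * (1 - t))^-1 - t ^+ n / (1 - t ^+ n).

Lemma geo_gt0 n : (0 < n)%N -> 0 < geo n.
Proof.
move=> n0; apply: lt_le_trans (geo_ge n); rewrite mulr_gt0 ?ltr0n //.
exact: exprn_gt0.
Qed.

Lemma lambert_weightE n : (0 < n)%N ->
  lambert_weight n = (n%:R^-1 - t ^+ n / geo n) / (1 - t).
Proof.
move=> n0; have /andP[t0 t1] := lambert_t_bounds.
have d : 0 < 1 - t by rewrite subr_gt0.
have g := geo_gt0 n0.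
rewrite /lambert_weight -geoE; field; rewrite !gt_eqF ?ltr0n //.
Qed.

Lemma lambert_weight_ge0 n : (0 < n)%N -> 0 <= lambert_weight n.
Proof.
move=> n0; have /andP[t0 t1] := lambert_t_bounds.
have d : 0 < 1 - t by rewrite subr_gt0.
have g := geo_gt0 n0.
rewrite lambert_weightE // divr_ge0 ?(ltW d) // subr_ge0 ler_pdivrMr // mulrC.
rewrite ler_pdivlMr ?ltr0n // mulrC; apply: le_trans (geo_ge n).
rewrite ler_pM2l ?ltr0n // /t -exprM; apply: ler_wiXn2l; rewrite ?ltW //; lia.
Qed.

Lemma lambert_weight1 : lambert_weight 1 = 1.
Proof.
have /andP[t0 t1] := lambert_t_bounds.
by rewrite /lambert_weight expr1 mul1r; field; rewrite subr_eq0 gt_eqF.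
Qed.

(** Up to the factor [1 / (1 - t)] the difference is [1 / (n (n+1)) - t^n / (geo n * geo (n+1))].
    The AM-GM bounds give [geo n * geo (n+1) >= n (n+1) u^(2n-1)], and
    [u^(2n-1) >= u^(2n) = t^n]. *)
Lemma lambert_weightS n : (0 < n)%N -> lambert_weight n.+1 <= lambert_weight n.
Proof.
move=> n0; have /andP[t0 t1] := lambert_t_bounds.
have d : 0 < 1 - t by rewrite subr_gt0.
have g := geo_gt0 n0; have g' := geo_gt0 (ltn0Sn n).
rewrite !lambert_weightE // ler_pM2r ?invr_gt0 // -subr_ge0.
have gS : geo n.+1 = 1 + t * geo n.
  rewrite /geo big_ord_recl /= expr0 mulr_sumr; congr (_ + _).
  by apply: eq_bigr => i _; rewrite exprS.
have n0' : 0 < n%:R :> R by rewrite ltr0n.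
have -> : n%:R^-1 - t ^+ n / geo n - (n.+1%:R^-1 - t ^+ n.+1 / geo n.+1) =
   (n%:R * n.+1%:R)^-1 - t ^+ n / (geo n * geo n.+1).
  have e : t ^+ n / geo n - t ^+ n.+1 / geo n.+1 = t ^+ n / (geo n * geo n.+1).
    have -> : t ^+ n / geo n - t ^+ n.+1 / geo n.+1 =
       t ^+ n * (geo n.+1 - t * geo n) / (geo n * geo n.+1).
      by rewrite exprS; field; rewrite !gt_eqF.
    by rewrite gS addrK mulr1.
  rewrite -e -natr1; field; rewrite !gt_eqF // ?natr1 ?ltr0n //.
rewrite subr_ge0 ler_pdivrMr ?mulr_gt0 // mulrC ler_pdivlMr ?mulr_gt0 ?ltr0n //.
apply: le_trans (_ : (n%:R * u ^+ n.-1) * (n.+1%:R * u ^+ n) <= _); last first.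
  by apply: ler_pM; rewrite ?geo_ge // mulr_ge0 ?ler0n // exprn_ge0 // ltW.
have -> : n%:R * u ^+ n.-1 * (n.+1%:R * u ^+ n) = u ^+ (n.-1 + n) * (n%:R * n.+1%:R).
  by rewrite exprD; ring.
rewrite ler_pM2r ?mulr_gt0 ?ltr0n // /t -exprM; apply: ler_wiXn2l; rewrite ?ltW //; lia.
Qed.

Lemma sum_multiples d N : (0 < d)%N ->
  \sum_(1 <= m < N.+1 | (d %| m)%N) t ^+ m =
  (t ^+ d - t ^+ (d * (N %/ d).+1)) / (1 - t ^+ d).
Proof.
move=> d0; have /andP[t0 t1] := lambert_t_bounds.
have dd : 1 - t ^+ d != 0.
  by rewrite subr_eq0 gt_eqF // exprn_ilt1 // ?ltW // -lt0n.
elim: N => [|N IH].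
  by rewrite big_geq // div0n muln1 subrr mul0r.
rewrite big_mkcond big_nat_recr //= -big_mkcond IH divnS //.
case: ifP => dN; last by rewrite add0n addr0.
have -> : N.+1 = (d * (N %/ d).+1)%N.
  by rewrite -[LHS](divnK dN) divnS // dN mulnC.
rewrite add1n [(d * (N %/ d).+2)%N]mulnS exprD; field.
exact: dd.
Qed.

Lemma mul_geo_small : forall e : R, 0 < e -> exists N0 : nat, forall N, (N0 <= N)%N ->
  N%:R * t ^+ N <= e.
Proof.
have /andP[t0 t1] := lambert_t_bounds.
have d : 0 < 1 - t by rewrite subr_gt0.
have b M : M%:R * t ^+ M <= (1 - t)^-1.
  apply: le_trans (_ : geo M <= _).
    rewrite mulr_natl -{2}(card_ord M) -sumr_const; apply: ler_sum => i _.
    by apply: ler_wiXn2l; [exact: ltW|exact: ltW|exact: ltnW].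
  by rewrite -div1r ler_pdivlMr // mulrC geoE gerBl exprn_ge0 // ltW.
(* For [M = N / 2] rounded down, [N t^N <= 4 M (t^M)^2] and [M t^M <= 1 / (1 - t)], so
   [N t^N <= 4 / ((1 - t)^2 M)], which is at most [e] once [M > C]. *)
move=> e e0; pose C := 4 * (1 - t)^-1 ^+ 2 / e.
exists (2 * (Num.truncn C).+1)%N => N hN.
have [M eM] : exists M, M = N./2 by exists N./2.
have eN : (odd N + 2 * M = N)%N by rewrite eM mul2n odd_double_half.
have o1 : (odd N <= 1)%N by case: (odd N).
move: (nat_of_bool _) eN o1 => o eN o1; clear eM.
move: (Num.truncn C) (truncnS_gt C) hN => k Ck hN.
have CM : C < M%:R.
  apply: lt_le_trans Ck _; rewrite ler_nat; lia.
have C0 : 0 < C by rewrite divr_gt0 // mulr_gt0 // exprn_gt0 // invr_gt0.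
have M0 : 0 < M%:R :> R by apply: lt_trans CM.
have NM : N%:R <= 4 * M%:R :> R.
  have M1 : (0 < M)%N by rewrite -(ltr0n R).
  rewrite -natrM ler_nat; lia.
have tM : t ^+ M <= (1 - t)^-1 / M%:R.
  by rewrite ler_pdivlMr // mulrC.
have tN : t ^+ N <= t ^+ M * t ^+ M.
  rewrite -exprD; apply: ler_wiXn2l; rewrite ?ltW //=; lia.
have tM0 : 0 <= t ^+ M by rewrite exprn_ge0 // ltW.
apply: (@le_trans _ _ ((4 * M%:R) * (t ^+ M * t ^+ M))).
  by apply: ler_pM => //; rewrite ?ler0n ?exprn_ge0 // ltW.
rewrite mulrA -[4 * _ * _]mulrA.
apply: (@le_trans _ _ (4 * (1 - t)^-1 * ((1 - t)^-1 / M%:R))).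
  apply: ler_pM => //; first by rewrite !mulr_ge0 // ?ler0n.
  by rewrite ler_pM2l.
rewrite !mulrA ler_pdivrMr // -mulrA -expr2.
by move/ltW: CM; rewrite /C ler_pdivrMr // mulrC [e * _]mulrC.
Qed.

End Lambert.

Section Monsky.
Variable R : realType.

Lemma bernoulli_ineq (y : R) m : 0 <= y <= 1 -> 1 - m%:R * y <= (1 - y) ^+ m.
Proof.
move=> /andP[y0 y1]; elim: m => [|m IH]; first by rewrite mul0r subr0 expr0.
rewrite exprS -natr1.
have : (1 - y) * (1 - m%:R * y) <= (1 - y) * (1 - y) ^+ m.
  by apply: ler_wpM2l => //; rewrite subr_ge0.
have : 0 <= m%:R * y ^+ 2 by rewrite mulr_ge0 ?ler0n ?sqr_ge0.
nra.
Qed.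

Variable x : nat -> R.
Hypotheses (x1 : x 1%N = 1) (xM : forall a b, x (a * b)%N = x a * x b).
Hypothesis xv : forall n, [\/ x n = 0, x n = 1 | x n = -1].
Variables B C : R.
Hypothesis hB : forall M N, `|\sum_(M <= n < N) x n| <= B.

Let x_le1 n : `|x n| <= 1.
Proof. by case: (xv n) => ->; rewrite ?normrN ?normr0 ?normr1 ?ler01. Qed.

(** Regrouping by divisors gives the sum of the [x k] times [t^k + t^(2k) + ...] cut at [N]. The
    three terms bound the contribution of the weights, by summation by parts; of the main terms
    [x n / (n (1 - t))]; and of the cut, at most [t^N / (1 - t)] for each [n]. *)
Lemma lambert_series_bound (u : R) N : 0 < u -> u < 1 ->
  \sum_(1 <= m < N.+1) divisor_sum x m * (u ^+ 2) ^+ m <=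
  B + `|\sum_(1 <= n < N.+1) x n / n%:R| / (1 - u ^+ 2)
    + N%:R * (u ^+ 2) ^+ N / (1 - u ^+ 2).
Proof.
move=> u0 u1; set t := u ^+ 2.
have /andP[t0 t1] : 0 < t < 1 := lambert_t_bounds u0 u1.
have d : 0 < 1 - t by rewrite subr_gt0.
have -> : \sum_(1 <= m < N.+1) divisor_sum x m * t ^+ m =
   \sum_(1 <= k < N.+1) x k * \sum_(1 <= m < N.+1 | (k %| m)%N) t ^+ m.
  under [RHS]eq_bigr do rewrite big_mkcond mulr_sumr.
  rewrite exchange_big /= [LHS]big_nat_cond [RHS]big_nat_cond.
  apply: eq_bigr => m; rewrite andbT => /andP[m0 mN].
  rewrite /divisor_sum mulr_suml.
  rewrite [RHS](eq_bigr (fun k => if (k %| m)%N then x k * t ^+ m else 0)); last first.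
    by move=> k _; case: ifP; rewrite ?mulr0.
  rewrite -big_mkcond -[RHS]big_filter; apply: perm_big; apply: uniq_perm.
  - exact: divisors_uniq.
  - by rewrite filter_uniq // iota_uniq.
  move=> k; rewrite mem_filter mem_index_iota -dvdn_divisors //.
  case: (boolP (k %| m)%N) => //= km; symmetry.
  by rewrite (dvdn_gt0 m0 km) ltnS (leq_trans (dvdn_leq m0 km)).
have b k : (0 < k)%N -> 0 < 1 - t ^+ k.
  by move=> k0; rewrite subr_gt0 exprn_ilt1 // ?ltW // -lt0n.
have -> : \sum_(1 <= k < N.+1) x k * \sum_(1 <= m < N.+1 | (k %| m)%N) t ^+ m =
   (\sum_(1 <= n < N.+1) x n / n%:R) / (1 - t)
    - \sum_(1 <= n < N.+1) x n * lambert_weight u n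
    - \sum_(1 <= n < N.+1) x n * (t ^+ (n * (N %/ n).+1) / (1 - t ^+ n)).
  rewrite mulr_suml -!sumrB [LHS]big_nat_cond [RHS]big_nat_cond.
  apply: eq_bigr => n; rewrite andbT => /andP[n0 _].
  rewrite (sum_multiples u0 u1) // /lambert_weight -/t invfM; ring.
have h1 : (\sum_(1 <= n < N.+1) x n / n%:R) / (1 - t) <=
   `|\sum_(1 <= n < N.+1) x n / n%:R| / (1 - t).
  by rewrite ler_pM2r ?invr_gt0 // ler_norm.
have h2 : - \sum_(1 <= n < N.+1) x n * lambert_weight u n <= B.
  have := @abel_bound R (fun n => (x n)%:C) (fun n => if (0 < n)%N then lambert_weight u n else 0)
    B 1 N.+1 (ltn0Sn N).
  have Bk k : cabs (\sum_(1 <= n < k) (x n)%:C) <= B.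
    by rewrite -(rmorph_sum (real_complex R)) cabs_real.
  move=> /(_ _ _ Bk) H; apply: le_trans (_ : B * lambert_weight u 1 <= _); last first.
    by rewrite lambert_weight1 // mulr1.
  apply: le_trans (H _ _); last first.
  - by move=> n n0; rewrite n0; apply: lambert_weightS.
  - by move=> n n0; rewrite n0; apply: lambert_weight_ge0.
  under [X in cabs X]eq_bigr => n _ do rewrite -rmorphM.
  rewrite -(rmorph_sum (real_complex R)) cabs_real.
  rewrite (_ : \sum_(1 <= n < N.+1) x n * lambert_weight u n =
     \sum_(1 <= n < N.+1) x n * (if (0 < n)%N then lambert_weight u n else 0)).
    by rewrite -normrN ler_norm.
  by apply: eq_big_nat => n /andP[-> _].
have h3 : - \sum_(1 <= n < N.+1) x n * (t ^+ (n * (N %/ n).+1) / (1 - t ^+ n)) <=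
   N%:R * t ^+ N / (1 - t).
  rewrite -sumrN.
  apply: (@le_trans _ _ (\sum_(1 <= n < N.+1) t ^+ N / (1 - t))); last first.
    by rewrite sumr_const_nat subSS subn0 -[leLHS]mulr_natl mulrA.
  rewrite [leLHS]big_nat_cond [leRHS]big_nat_cond; apply: ler_sum => n.
  rewrite andbT => /andP[n0 _].
  apply: (@le_trans _ _ (t ^+ (n * (N %/ n).+1) / (1 - t ^+ n))).
    rewrite -mulNr -[leRHS]mul1r; apply: ler_wpM2r.
      by rewrite divr_ge0 ?(ltW (b _ n0)) // exprn_ge0 // ltW.
    by apply: le_trans (ler_norm _) _; rewrite normrN.
  apply: ler_pM.
  - by rewrite exprn_ge0 // ltW.
  - by rewrite invr_ge0 (ltW (b _ n0)).
  - apply: ler_wiXn2l; rewrite ?ltW //; have := ltn_ceil N n0; rewrite mulnC => /ltnW //.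
  - rewrite lef_pV2 ?posrE // ?b // lerB // -[leRHS]expr1; apply: ler_wiXn2l => //; exact: ltW.
lra.
Qed.

(* If the series vanished, the Lambert series [sum x_n t^n / (1 - t^n)] would stay bounded as
   [t] tends to 1, because the weights [1 / (n (1 - t)) - t^n / (1 - t^n)] decrease in [n]; but
   its coefficients are nonnegative, and at least 1 on squares. *)
Lemma real_L_nonvanishing :
  ~ (forall N, `|\sum_(1 <= n < N.+1) x n / n%:R| <= C / N.+1%:R).
Proof.
move=> hC.
have B0 : 0 <= B by apply: le_trans (hB 0 0).
have C0 : 0 <= C.
  by have := hC 0%N; rewrite divr1; apply: le_trans.
(* The left side will be at least [J / 2], from the [J] squares up to [J^2], as [t^(J^2) >= 1/2] by
   Bernoulli's inequality for [y = 1 / (4 J^2)]. For large [N] the right side is at most [B + 2],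
   and [J] is chosen to contradict this. *)
pose J := (Num.truncn (2 * (B + 2))).+1.
have hJ : 2 * (B + 2) < J%:R by apply: truncnS_gt.
have J0 : 0 < J%:R :> R by rewrite ltr0n.
have J1 : 1 <= J%:R :> R by rewrite ler1n.
pose y : R := (4 * J%:R ^+ 2)^-1.
have y4 : 0 < 4 * J%:R ^+ 2 :> R by rewrite mulr_gt0 // exprn_gt0.
have y0 : 0 < y by rewrite invr_gt0.
have y1 : y <= 4^-1.
  by rewrite lef_pV2 ?posrE //; have := exprn_ege1 2 J1; lra.
pose u := 1 - y.
have u0 : 0 < u by rewrite /u; lra.
have u1 : u < 1 by rewrite /u; lra.
pose t := u ^+ 2.
have /andP[t0 t1] : 0 < t < 1 := lambert_t_bounds u0 u1.
have d : 0 < 1 - t by rewrite subr_gt0.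
have tJ : 2^-1 <= t ^+ (J ^ 2).
  rewrite /t -exprM; apply: le_trans (bernoulli_ineq _ _); last by rewrite (ltW y0) /=; lra.
  have -> : (2 * J ^ 2)%:R * y = 2^-1.
    by rewrite /y natrM natrX; field; rewrite gt_eqF.
  lra.
have [N0 hN0] := mul_geo_small u0 u1 (d : 0 < 1 - u ^+ 2).
pose N := (N0 + J ^ 2 + Num.truncn (C / (1 - t)))%N.
have NJ : (J ^ 2 <= N)%N by rewrite /N -addnA addnCA leq_addr.
have := lambert_series_bound N u0 u1; rewrite -/t.
have h3 : N%:R * t ^+ N / (1 - t) <= 1.
  by rewrite ler_pdivrMr // mul1r; apply: hN0; rewrite /N -addnA leq_addr.
have h2 : `|\sum_(1 <= n < N.+1) x n / n%:R| / (1 - t) <= 1.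
  rewrite ler_pdivrMr // mul1r; apply: le_trans (hC N) _.
  rewrite ler_pdivrMr ?ltr0n // mulrC -ler_pdivrMr //.
  apply: (@le_trans _ _ (Num.truncn (C / (1 - t))).+1%:R).
    exact/ltW/truncnS_gt.
  by rewrite ler_nat ltnS leq_addl.
have h1 : J%:R / 2 <= \sum_(1 <= m < N.+1) divisor_sum x m * t ^+ m.
  apply: (@le_trans _ _ (\sum_(1 <= j < J.+1) divisor_sum x (j ^ 2) * t ^+ (j ^ 2))).
    have -> : J%:R / 2 = \sum_(1 <= j < J.+1) (2^-1 : R).
      by rewrite sumr_const_nat subSS subn0 -[RHS]mulr_natl.
    rewrite [leLHS]big_nat_cond [leRHS]big_nat_cond; apply: ler_sum => j.
    rewrite andbT => /andP[j0 jJ]; rewrite -[leLHS]mul1r; apply: ler_pM => //.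
    - exact: divisor_sum_square.
    - apply: le_trans tJ _; apply: ler_wiXn2l; rewrite ?ltW // leq_exp2r //.
  rewrite -(big_map (fun j => j ^ 2)%N xpredT (fun m => divisor_sum x m * t ^+ m)).
  set s := map _ _.
  have us : uniq s.
    rewrite map_inj_in_uniq ?iota_uniq // => a b _ _ /eqP; rewrite eqn_exp2r //.
    by move/eqP.
  rewrite [leRHS](bigID (mem s)) /= -[leLHS]addr0; apply: lerD.
    rewrite le_eqVlt; apply/orP; left; apply/eqP.
    rewrite -[RHS]big_filter; apply: perm_big; apply: uniq_perm => //.
      by rewrite filter_uniq // iota_uniq.
    move=> m; rewrite mem_filter mem_index_iota; case: (boolP (m \in s)) => //.
    move=> /mapP[j]; rewrite mem_index_iota => /andP[j0 jJ] ->; symmetry => /=.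
    rewrite expn_gt0 j0 /= ltnS; apply: leq_trans NJ; rewrite leq_exp2r //.
  rewrite big_nat_cond; apply: sumr_ge0 => m /andP[/andP[m0 _] _].
  by rewrite mulr_ge0 ?divisor_sum_ge0 // exprn_ge0 // ltW.
lra.
Qed.

End Monsky.

Lemma uniform_threshold (I : finType) (P : I -> nat -> Prop) :
  (forall i, exists n0, forall n, (n0 <= n)%N -> P i n) ->
  exists n0, forall n, (n0 <= n)%N -> forall i, P i n.
Proof.
move=> /choice[g hg]; exists (\max_i g i) => n hn i.
by apply: hg; apply: leq_trans hn; apply: leq_bigmax.
Qed.

Section ReAux.
Variable R : realType.

Lemma Re_sum (I : Type) (r : seq I) (P : pred I) (F : I -> R[i]) :
  complex.Re (\sum_(i <- r | P i) F i) = \sum_(i <- r | P i) complex.Re (F i).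
Proof. by apply: (big_morph (@complex.Re R)) => // -[a b] [c d]. Qed.

Lemma Re_mul_real (z : R[i]) (x : R) : complex.Re (z * x%:C) = complex.Re z * x.
Proof. by case: z => a b /=; rewrite mulr0 subr0. Qed.

Lemma real_complex_of_Re (z : R[i]) : complex.Im z = 0 -> z = (complex.Re z)%:C.
Proof. by case: z => a b /= ->. Qed.

Lemma cabs_conj (z : R[i]) : cabs (conjc z) = cabs z.
Proof. by case: z => a b /=; rewrite sqrrN. Qed.

End ReAux.

(** * Logarithms of L-functions as sums over primes *)

Section LogL.
Variables (R : realType) (q : nat).
Hypothesis q0 : (0 < q)%N.

Section OneCharacter.
Variable chi : nat -> R[i].
Hypothesis H : dirichlet_character q chi.

Lemma twistM e a b : twist chi e (a * b) = twist chi e a * twist chi e b.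
Proof.
case: H => _ cM _ _; rewrite /twist cM natrM powRM ?ler0n // rmorphM /=; ring.
Qed.

Lemma twist1 e : twist chi e 1 = 1.
Proof. by case: H => c1 _ _ _; rewrite /twist c1 powR1 mul1r. Qed.

Lemma cabs_twist e n : cabs (twist chi e n) <= (n%:R : R) `^ (- (e + 1)).
Proof.
rewrite /twist cabsM cabs_real ger0_norm ?powR_ge0 //.
by rewrite -[leRHS]mul1r ler_wpM2r ?powR_ge0 // (char_cabs_le1 q0 _ H).
Qed.

Lemma sum_twist_sqr e Y : 0 <= e ->
  \sum_(0 <= p < Y.+1 | prime p) cabs (twist chi e p) ^+ 2 <= 1.
Proof.
move=> e0; case: Y => [|Y].
  by rewrite big_mkcond big_nat1 /= ler01.
apply: (@le_trans _ _ (\sum_(1 <= n < Y.+1) (n.+1%:R : R) `^ (- (1 + 1)))); last first.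
  have := @sum_powRN_le R 1 1 Y.+1 ltr01 isT isT.
  by rewrite divr1 powR1.
rewrite big_mkcond /= big_ltn // big_ltn //= !add0r big_add1 /=.
rewrite [leLHS]big_nat_cond [leRHS]big_nat_cond; apply: ler_sum => n.
rewrite andbT => /andP[n0 _]; case: ifP => _; last exact: powR_ge0.
have n1 : (0 < n.+1)%N by [].
apply: (@le_trans _ _ ((n.+1%:R^-1 : R) ^+ 2)).
  apply: lerXn2r; rewrite ?nnegrE ?cabs_ge0 ?invr_ge0 ?ler0n //.
  exact: le_trans (cabs_twist _ _) (powRN_le_inv e0 n1).
by rewrite -[1 + 1]/(2%:R) powR_invn ?ler0n // exprVn.
Qed.

(** The constant 14 is 1 for [ln |L Q|], with [|L Q|] between 1/2 and 3/2, plus 13 for the quadratic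
    errors of the factors [1 - chi(p) p^(-s)], since the [p^(-2)] sum to at most 1. *)
Lemma ln_Lsum_one e : 0 < e -> exists Y0, forall Y, (Y0 <= Y)%N ->
  exists N0, forall N, (N0 <= N)%N ->
    0 < cabs (Lsum chi e N) /\
    `|ln (cabs (Lsum chi e N)) -
       \sum_(0 <= p < Y.+1 | prime p) complex.Re (twist chi e p)| <= 14.
Proof.
move=> e0.
have [Y0 hY0] := euler_product e0 (twist1 e) (twistM e) (fun n _ => cabs_twist e n).
exists Y0 => Y /hY0[N0 hN0]; exists N0 => N /hN0.
rewrite -[\sum_(_ <= _ < _) _]/(Lsum chi e N).
set L := Lsum _ _ _; set Q := \prod_(_ <= _ < _ | _) _ => hLQ.
have small p : prime p -> p%:R^-1 <= 2^-1 :> R.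
  by move=> pp; rewrite lef_pV2 ?posrE ?ltr0n ?prime_gt0 // ler_nat prime_gt1.
have lnP p (pp : prime p) := ln_cabs_one_sub (le_trans (cabs_twist e p)
  (le_trans (powRN_le_inv (ltW e0) (prime_gt0 pp)) (small p pp))).
have Qpos : 0 < cabs Q.
  by rewrite cabs_prod; apply: prodr_gt0 => p pp; case: (lnP p pp).
have lnQ : ln (cabs Q) = \sum_(0 <= p < Y.+1 | prime p) ln (cabs (1 - twist chi e p)).
  rewrite cabs_prod.
  suff [] : 0 < \prod_(0 <= p < Y.+1 | prime p) cabs (1 - twist chi e p) /\
     ln (\prod_(0 <= p < Y.+1 | prime p) cabs (1 - twist chi e p)) =
     \sum_(0 <= p < Y.+1 | prime p) ln (cabs (1 - twist chi e p)) by [].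
  apply: (big_ind2 (fun (x y : R) => 0 < x /\ ln x = y)); first by rewrite ln1.
    move=> x1 y1 x2 y2 [h1 <-] [h2 <-]; split; first exact: mulr_gt0.
    by rewrite lnM.
  by move=> p pp; case: (lnP p pp).
have LQ1 : 2^-1 <= cabs L * cabs Q.
  have := cabs_sub_ge 1 (1 - L * Q); rewrite cabs1 opprB addrCA subrr addr0 cabsM.
  rewrite cabs_distC in hLQ; lra.
have LQ2 : cabs L * cabs Q <= 3/2.
  have := cabsD (L * Q - 1) 1; rewrite subrK cabsM cabs1; lra.
have Lpos : 0 < cabs L.
  have : 0 < cabs L * cabs Q by apply: lt_le_trans LQ1; rewrite invr_gt0.
  by rewrite pmulr_lgt0.
split => //.
have lnLQ : ln (cabs L * cabs Q) = ln (cabs L) + ln (cabs Q) by rewrite lnM.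
have up : ln (cabs L * cabs Q) <= 1.
  apply: le_trans (_ : cabs L * cabs Q - 1 <= _); last lra.
  have := @le_ln1Dx R (cabs L * cabs Q - 1); rewrite [1 + _]addrC subrK; apply; lra.
have lo : -1 <= ln (cabs L * cabs Q).
  have h : 0 < cabs L * cabs Q by rewrite mulr_gt0.
  have : ln ((cabs L * cabs Q)^-1) <= 1.
    apply: le_trans (_ : (cabs L * cabs Q)^-1 - 1 <= _).
      have := @le_ln1Dx R ((cabs L * cabs Q)^-1 - 1); rewrite [1 + _]addrC subrK; apply.
      by rewrite -subr_gt0 opprK subrK invr_gt0.
    rewrite lerBlDr -[1 + 1]invrK lef_pV2 ?posrE ?invr_gt0 //; lra.
  rewrite lnV ?posrE //; lra.
have S2 := sum_twist_sqr Y (ltW e0).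
set S := \sum_(_ <= _ < _ | _) complex.Re _.
have S20 : 0 <= \sum_(0 <= p < Y.+1 | prime p) cabs (twist chi e p) ^+ 2.
  by apply: sumr_ge0 => p _; rewrite sqr_ge0.
have Q1 : ln (cabs Q) <= - S + \sum_(0 <= p < Y.+1 | prime p) cabs (twist chi e p) ^+ 2.
  rewrite lnQ -sumrN -big_split; apply: ler_sum => p pp; by case: (lnP p pp).
have Q2 : - S - 13 * \sum_(0 <= p < Y.+1 | prime p) cabs (twist chi e p) ^+ 2 <= ln (cabs Q).
  rewrite lnQ mulr_sumr -sumrN -sumrB; apply: ler_sum => p pp; by case: (lnP p pp).
rewrite ler_norml; lra.
Qed.

End OneCharacter.

Section Family.
Variable chi : 'I_(totient q) -> nat -> R[i].
Hypothesis chiP : forall i, dirichlet_character q (chi i).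
Hypothesis chiS : forall a, \sum_i chi i a =
  if (a == 1 %[mod q])%N then (totient q)%:R else 0.

Lemma ln_Lsum e : 0 < e -> exists Y0, forall Y, (Y0 <= Y)%N ->
  exists N0, forall N, (N0 <= N)%N -> forall i,
    0 < cabs (Lsum (chi i) e N) /\
    `|ln (cabs (Lsum (chi i) e N)) -
       \sum_(0 <= p < Y.+1 | prime p) complex.Re (twist (chi i) e p)| <= 14.
Proof.
move=> e0.
have [Y0 hY0] := uniform_threshold (fun i => ln_Lsum_one (chiP i) e0).
exists Y0 => Y YY0; have [N0 hN0] := uniform_threshold (hY0 _ YY0).
by exists N0 => N NN0 i; apply: hN0.
Qed.

Definition principal a : R[i] := if coprime q a then 1 else 0.

Lemma principal_character : dirichlet_character q principal.
Proof.
split=> [|a b|a|a]; rewrite /principal ?coprimen1 ?coprime_modr //.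
  by rewrite coprimeMr; case: coprime; case: coprime; rewrite ?mulr0 ?mul0r ?mulr1.
by move/negbTE ->.
Qed.

Lemma trivial_index : exists it, [/\ trivial_char q (chi it),
  forall a, chi it a = principal a & forall i, i <> it -> ~ trivial_char q (chi i)].
Proof.
have [it hit] := char_unique q0 chiP chiS principal_character.
have it1 := (hit it).2 erefl.
exists it; split => // [a ca|i nit T]; first by rewrite it1 /principal ca.
apply: nit; apply/hit => a; rewrite /principal; case: ifPn => [|nca]; first exact: T.
by case: (chiP i) => _ _ _ ->.
Qed.

Lemma principal_upper e N : 0 < e <= 1 -> cabs (Lsum principal e N) <= 2 / e.
Proof.
move=> /andP[e0 e1]; apply: le_trans (cabs_sum _ _ _) _.
apply: (@le_trans _ _ (\sum_(1 <= n < N.+1) (n%:R : R) `^ (- (e + 1)))).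
  by apply: ler_sum => n _; apply: cabs_twist principal_character _ _.
case: N => [|N]; first by rewrite big_geq // divr_ge0 // ltW.
rewrite big_nat_recl //= powR1.
have := @sum_powRN_le R e 1 N.+1 e0 isT isT; rewrite powR1 => h.
apply: le_trans (lerD (lexx 1) h) _.
by rewrite ler_pdivlMr // mulrDl divfK ?gt_eqF // mul1r; lra.
Qed.

(** Only the [n = q (k-1) + 1] are kept. Each is at most [q k], [q^(-(1+e)) >= q^(-2)], and the sum
    of [k^(-(1+e))] over [k <= K] is at least [1 / (2 e)]. *)
Lemma principal_lower e : 0 < e <= 1 -> exists N0, forall N, (N0 <= N)%N ->
  (2 * q%:R ^+ 2 * e)^-1 <= cabs (Lsum principal e N).
Proof.
move=> /andP[e0 e1].
have [K hK] := powRN_lt_eventually e0 (divr_gt0 ltr01 (ltr0n R 2)).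
have q0' : 0 < q%:R :> R by rewrite ltr0n.
have q1' : 1 <= q%:R :> R by rewrite ler1n.
exists (q * K)%N => N hN.
have -> : Lsum principal e N =
    (\sum_(1 <= n < N.+1 | coprime q n) (n%:R : R) `^ (- (e + 1)))%:C.
  rewrite rmorph_sum [RHS]big_mkcond; apply: eq_bigr => n _.
  by rewrite /twist /principal; case: ifP => _; rewrite ?mul1r ?mul0r.
rewrite cabs_real; apply: le_trans (ler_norm _).
apply: (@le_trans _ _ (\sum_(1 <= k < K.+1) ((q * k)%:R : R) `^ (- (e + 1)))).
  under eq_bigr do rewrite natrM powRM ?ler0n //.
  rewrite -mulr_sumr.
  apply: (@le_trans _ _ ((q%:R ^+ 2)^-1 * (2 * e)^-1)).
    by rewrite -invfM [_ * (2 * e)]mulrA [_ * 2]mulrC.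
  apply: ler_pM; rewrite ?invr_ge0 ?exprn_ge0 ?ler0n ?mulr_ge0 ?(ltW e0) //.
    by rewrite -powR_invn ?ler0n // ler_powR // lerN2; lra.
  apply: le_trans (sum_powRN_ge _ e0).
  by rewrite invfM ler_pM2r ?invr_gt0 //; have := hK _ (leqnSn K); lra.
pose g k := (q * k.-1).+1.
apply: (@le_trans _ _ (\sum_(1 <= k < K.+1) ((g k)%:R : R) `^ (- (e + 1)))).
  rewrite [leLHS]big_nat_cond [leRHS]big_nat_cond; apply: ler_sum => k.
  rewrite andbT => /andP[k0 _].
  rewrite !powRN lef_pV2 ?posrE ?powR_gt0 ?ltr0n ?muln_gt0 ?q0 //.
  apply: ge0_ler_powR; rewrite ?nnegrE ?ler0n ?addr_ge0 ?(ltW e0) // ler_nat.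
  rewrite /g -{2}(prednK k0) mulnS; lia.
rewrite -(big_map g xpredT (fun n : nat => (n%:R : R) `^ (- (e + 1)))) -[leRHS]big_filter.
set s := [seq g i | i <- _]; set s' := [seq x <- _ | _].
have us : uniq s.
  rewrite map_inj_in_uniq ?iota_uniq // => a b.
  rewrite !mem_index_iota => /andP[a0 _] /andP[b0 _] [] /eqP.
  by rewrite eqn_pmul2l // => /eqP ab; rewrite -(prednK a0) ab prednK.
rewrite [leRHS](bigID (mem s)) /= -[leLHS]addr0; apply: lerD; last first.
  by apply: sumr_ge0 => n _; apply: powR_ge0.
rewrite le_eqVlt; apply/orP; left; apply/eqP.
rewrite -[RHS]big_filter; apply: perm_big; apply: uniq_perm => //.
  by rewrite !filter_uniq // iota_uniq.
move=> n; rewrite !mem_filter mem_index_iota; case: (boolP (n \in s)) => //.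
move=> /mapP[k]; rewrite mem_index_iota => /andP[k0 kK] ->; symmetry => /=.
rewrite /g -addn1 [(q * _)%N]mulnC /coprime gcdnMDl gcdn1 eqxx addn1 ltnS mulnC /=; apply: leq_trans hN.
by rewrite ltn_pmul2l // prednK // -ltnS.
Qed.

End Family.
End LogL.

(** * Nonvanishing for every nontrivial character, and the density of primes in a subgroup *)

Section NonVanishing.
Variables (R : realType) (q : nat).
Hypothesis q0 : (0 < q)%N.
Variable chi : 'I_(totient q) -> nat -> R[i].
Hypothesis chiP : forall i, dirichlet_character q (chi i).
Hypothesis chiS : forall a, \sum_i chi i a =
  if (a == 1 %[mod q])%N then (totient q)%:R else 0.
Variable B : R.
Hypothesis BE : B = (2 * q)%:R.

Let B2 : 2 <= B.
Proof. by rewrite BE ler_nat; lia. Qed.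

(** Summed over all characters, [chi i p] gives 0 or [totient q], so every prime contributes a
    nonnegative amount to the logarithm of the product; what remains is the error 14 of each
    factor. *)
Lemma sum_ln_Lsum_ge (n := (totient q)%:R : R) e : 0 < e ->
  exists N0, forall N, (N0 <= N)%N ->
   (forall i, 0 < cabs (Lsum (chi i) e N)) /\
   - (14 * n) <= \sum_i ln (cabs (Lsum (chi i) e N)).
Proof.
move=> e0; have [Y0 hY0] := ln_Lsum q0 chiP e0.
have [N0 hN0] := hY0 _ (leqnn Y0).
exists N0 => N /hN0 h; split; first by move=> i; case: (h i).
have E : 0 <= \sum_i \sum_(0 <= p < Y0.+1 | prime p) complex.Re (twist (chi i) e p).
  rewrite exchange_big /=; apply: sumr_ge0 => p pp.
  rewrite -Re_sum; under eq_bigr do rewrite /twist.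
  rewrite -mulr_suml chiS Re_mul_real mulr_ge0 ?powR_ge0 //.
  case: ifP => _ //=; rewrite -(rmorph_nat (real_complex R)) /=; exact: ler0n.
apply: (@le_trans _ _ (\sum_(i < totient q)
   (\sum_(0 <= p < Y0.+1 | prime p) complex.Re (twist (chi i) e p) - 14))).
  rewrite sumrB sumr_const card_ord -[14 *+ _]mulr_natr; rewrite /n; lra.
by apply: ler_sum => i _; have [_] := h i; rewrite ler_norml; lra.
Qed.

(** Vanishing at 1 is expressed by the rate [2 B / (M+1)]. Later partial sums differ from the [M]-th
    by at most [B / (M+1)], so once one exceeds twice that bound, all later ones stay away from
    0. *)
Lemma Lsum_dichotomy i : ~ trivial_char q (chi i) ->
  (exists2 c : R, 0 < c & exists M0, forall N, (M0 <= N)%N -> c <= cabs (Lsum (chi i) 0 N)) \/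
  (forall M, cabs (Lsum (chi i) 0 M) <= 2 * B / M.+1%:R).
Proof.
move=> nt; have B2' := B2; have hB := char_sum_bound q0 (chiP i) nt; rewrite -BE in hB.
have [H|H] := pselect (forall M, cabs (Lsum (chi i) 0 M) <= 2 * B / M.+1%:R); first by right.
left; have [M hM] : exists M, 2 * B / M.+1%:R < cabs (Lsum (chi i) 0 M).
  by apply: contrapT => H'; apply: H => M; rewrite leNgt; apply/negP => h; apply: H'; exists M.
exists (B / M.+1%:R); first by apply: divr_gt0; rewrite ?ltr0Sn //; lra.
exists M => N MN.
have h1 := Lsum_dist hB (lexx 0) MN.
have h2 := cabs_sub_ge (Lsum (chi i) 0 M) (Lsum (chi i) 0 M - Lsum (chi i) 0 N).
rewrite opprB addrCA subrr addr0 in h2.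
rewrite cabs_distC in h1.
rewrite -mulrA in hM; move: (B / _) hM h1 => b hM h1; lra.
Qed.

(* If [L(1, chi) = 0] with [chi] not real, then the conjugate character vanishes too; two
   factors of size [O(e)] outweigh the pole [2 / e] of the principal factor, whereas the
   product of all the factors is bounded below. *)
Lemma nonreal_nonvanishing i : ~ trivial_char q (chi i) ->
  (exists a, complex.Im (chi i a) <> 0) ->
  ~ (forall M, cabs (Lsum (chi i) 0 M) <= 2 * B / M.+1%:R).
Proof.
move=> nt [a0 Ia0] van; have B2' := B2; have hB := char_sum_bound q0 (chiP i) nt; rewrite -BE in hB.
have [c1 cM cm cc] := chiP i.
have conjP : dirichlet_character q (fun a => conjc (chi i a)).
  split; first by rewrite c1 conjc1.
  - by move=> a b; rewrite cM rmorphM.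
  - by move=> a; rewrite cm.
  - by move=> a /cc ->; rewrite conjc0.
have [i1 hi1] := char_unique q0 chiP chiS conjP.
have e1 := (hi1 i1).2 erefl.
have ni1 : i1 != i.
  apply/eqP => ei; have := e1 a0; rewrite ei; case: (chi i a0) Ia0 => x y /= y0 [] /eqP.
  by rewrite -addr_eq0 -mulr2n mulrn_eq0 /= => /eqP.
have [it [tit etit ntit]] := trivial_index q0 chiP chiS.
have nt1 : ~ trivial_char q (chi i1).
  move=> T; apply: nt => a ca; have := T a ca; rewrite e1.
  by move/(congr1 (@conjc R)); rewrite conjcK conjc1.
have iit : i != it by apply/eqP => ei; apply: nt; rewrite ei.
have i1it : i1 != it by apply/eqP => ei; apply: nt1; rewrite ei.
have L1 e N : cabs (Lsum (chi i1) e N) = cabs (Lsum (chi i) e N).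
  rewrite -[RHS]cabs_conj /Lsum rmorph_sum /=; congr (cabs _); apply: eq_bigr => k _.
  by rewrite /twist rmorphM /= e1 oppr0.
pose n : R := (totient q)%:R.
have n0 : 0 <= n by apply: ler0n.
(* With [e = exp (- T)], the logarithms of the factors sum to at most [ln 2 + 2 ln (2 B) + n B - T],
   while the product formula bounds them below by [- 14 n]; [T] violates this by 1. *)
pose T := 14 * n + n * B + ln 2 + 2 * ln (2 * B) + 1.
have B0 : 0 < B by lra.
have l2 : 0 <= ln (2 : R) by rewrite ln_ge0 //; lra.
have l2B : 0 <= ln (2 * B) by rewrite ln_ge0 //; lra.
have nB : 0 <= n * B by rewrite mulr_ge0 // ltW.
pose e := expR (- T).
have e0 : 0 < e by apply: expR_gt0.
have e1' : e <= 1 by rewrite expR_le1 /T; lra.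
have [N0 hN0] := sum_ln_Lsum_ge e0.
pose N := maxn N0 (Num.truncn (2 / e)).+1.
have [pos lo] := hN0 N (leq_maxl _ _).
have Ne : 2 / e <= N.+1%:R.
  apply: (@le_trans _ _ (Num.truncn (2 / e)).+1%:R); first exact/ltW/truncnS_gt.
  by rewrite ler_nat ltnW // ltnS leq_maxr.
have Li : cabs (Lsum (chi i) e N) <= 2 * B * e.
  have h1 := Lsum_diff N hB (ltW e0).
  have h2 := van N.
  have h3 : 2 * B / N.+1%:R <= B * e.
    rewrite ler_pdivrMr ?ltr0n //.
    have : 2 <= e * N.+1%:R by rewrite mulrC -ler_pdivrMr.
    by move=> h; rewrite -mulrA [2 * B]mulrC ler_pM2l.
  have := cabsD (Lsum (chi i) e N - Lsum (chi i) 0 N) (Lsum (chi i) 0 N).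
  have h4 := le_trans h2 h3; rewrite subrK; clear h2 h3; lra.
have lnLi : ln (cabs (Lsum (chi i) e N)) <= ln (2 * B) - T.
  rewrite -[T]opprK opprK -(expRK (- T)) -/e -lnM ?posrE //; last lra.
  by rewrite ler_ln ?posrE // mulr_gt0 //; lra.
have lnLt : ln (cabs (Lsum (chi it) e N)) <= ln 2 + T.
  have h : cabs (Lsum (chi it) e N) <= 2 / e.
    have -> : Lsum (chi it) e N = Lsum (principal R q) e N.
      by apply: eq_bigr => k _; rewrite /twist etit.
    by apply: principal_upper; rewrite // e0.
  have -> : ln 2 + T = ln (2 / e).
    by rewrite ln_div ?posrE // /e expRK opprK.
  by rewrite ler_ln ?posrE // divr_gt0.
have lnLj j : j != it -> ln (cabs (Lsum (chi j) e N)) <= B.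
  move=> /eqP /ntit ntj.
  have h := Lsum_bound N (char_sum_bound q0 (chiP j) ntj) (ltW e0); rewrite -BE in h.
  by apply: le_trans h; apply/ltW/ln_sublinear.
have up : \sum_j ln (cabs (Lsum (chi j) e N)) <=
   (ln 2 + T) + (2 * (ln (2 * B) - T) + n * B).
  rewrite (bigD1 it) //=; apply: lerD => //.
  rewrite (bigD1 i) //= (bigD1 i1) /=; last by rewrite i1it.
  rewrite L1 addrA; apply: lerD; first lra.
  apply: (@le_trans _ _ (\sum_(j < totient q) B)); last first.
    by rewrite sumr_const card_ord -[leLHS]mulr_natl.
  rewrite big_mkcond; apply: ler_sum => j _; case: ifP; last by move=> _; lra.
  by move=> /andP[/andP[/lnLj]].
rewrite -/n in lo; rewrite /T in up; lra.
Qed.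

Lemma real_nonvanishing i : ~ trivial_char q (chi i) ->
  (forall a, complex.Im (chi i a) = 0) ->
  ~ (forall M, cabs (Lsum (chi i) 0 M) <= 2 * B / M.+1%:R).
Proof.
move=> nt re van; have hB := char_sum_bound q0 (chiP i) nt; rewrite -BE in hB.
have [c1 cM cm cc] := chiP i.
pose x a := complex.Re (chi i a).
have ex a : chi i a = (x a)%:C by apply: real_complex_of_Re.
have x1 : x 1%N = 1 by rewrite /x c1.
have xM a b : x (a * b)%N = x a * x b.
  by apply: (@complexI R); rewrite rmorphM /= -!ex cM.
have xv a : [\/ x a = 0, x a = 1 | x a = -1].
  have [ca|nca] := boolP (coprime q a); last by constructor 1; rewrite /x cc.
  have := char_cabs q0 (chiP i) ca; rewrite ex cabs_real.
  case: (ger0P (x a)) => _ h; first by constructor 2.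
  by constructor 3; rewrite -h opprK.
apply: (@real_L_nonvanishing R x x1 xM xv B (2 * B)) => [M N|N].
  have := hB M N; under eq_bigr do rewrite ex.
  by rewrite -(rmorph_sum (real_complex R)) cabs_real.
have := van N.
have -> : Lsum (chi i) 0 N = (\sum_(1 <= n < N.+1) x n / n%:R)%:C.
  rewrite rmorph_sum /=; apply: eq_bigr => n _.
  by rewrite /twist ex add0r powR_inv1 ?ler0n // -rmorphM.
by rewrite cabs_real.
Qed.

Lemma L_nonvanishing i : ~ trivial_char q (chi i) ->
  exists2 c : R, 0 < c & exists M0, forall N, (M0 <= N)%N -> c <= cabs (Lsum (chi i) 0 N).
Proof.
move=> nt; case: (Lsum_dichotomy nt) => // van; exfalso.
have [H|H] := pselect (forall a, complex.Im (chi i a) = 0).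
  exact: (real_nonvanishing nt H van).
apply: (nonreal_nonvanishing nt _ van); apply: contrapT => H'; apply: H => a.
by apply: contrapT => h; apply: H'; exists a.
Qed.

Lemma L_nonvanishing_uniform :
  exists2 c : R, 0 < c <= 1 & exists M0, forall N, (M0 <= N)%N -> forall i,
    ~ trivial_char q (chi i) -> c <= cabs (Lsum (chi i) 0 N).
Proof.
have H i : exists c : R, 0 < c /\ exists M0, forall N, (M0 <= N)%N ->
   ~ trivial_char q (chi i) -> c <= cabs (Lsum (chi i) 0 N).
  have [t|nt] := pselect (trivial_char q (chi i)).
    by exists 1; split => //; exists 0%N.
  have [c c0 [M0 hM0]] := L_nonvanishing nt.
  by exists c; split => //; exists M0 => N /hM0.
have [g hg] := choice H.
pose S := 1 + \sum_i (g i)^-1.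
have S1 : 1 <= S by rewrite lerDl sumr_ge0 // => i _; rewrite invr_ge0 ltW //; case: (hg i).
exists S^-1; first by rewrite invr_gt0 (lt_le_trans ltr01 S1) invf_le1 // (lt_le_trans ltr01 S1).
have [M0 hM0] := uniform_threshold (fun i => (hg i).2).
exists M0 => N MN i nt; apply: le_trans (hM0 _ MN i nt).
have [gi _] := hg i.
rewrite -[leRHS]invrK lef_pV2 ?posrE ?invr_gt0 ?(lt_le_trans ltr01 S1) //.
rewrite /S (bigD1 i) //= addrCA lerDl addr_ge0 // sumr_ge0 // => j _.
by rewrite invr_ge0 ltW //; case: (hg j).
Qed.

(** Up to a bounded error, orthogonality turns the sum over the primes in [K] into the sum of
    [ln |L|] over the characters trivial on [K], divided by their number [nX]. The principal one
    contributes [ln (1/e)], the others are bounded below by nonvanishing at 1, and [nX] is the index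
    of [K]. *)
Lemma density_of_family (K : pred nat) : residue_group q K ->
  exists C : R, forall e, 0 < e <= 1 -> exists Y0, forall Y, (Y0 <= Y)%N ->
   (\sum_(k < q | K k) 1) / (totient q)%:R * ln e^-1 - C <=
   \sum_(0 <= p < Y.+1 | prime p && K p) (p%:R : R) `^ (- (e + 1)).
Proof.
move=> HK; have B2' := B2; have [K1 KM Km Kc] := HK.
have [it [tit etit ntit]] := trivial_index q0 chiP chiS.
have [c /andP[c0 c1] [M0 hM0]] := L_nonvanishing_uniform.
pose X := in_annihilator chi K.
pose nX : R := \sum_(i < totient q | X i) 1.
pose k : R := \sum_(i < q | K i) 1.
pose n : R := (totient q)%:R.
have n0 : 0 < n by rewrite ltr0n totient_gt0.
have kX : k * nX = n := card_annihilator q0 chiP chiS HK.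
have Xit : X it by apply/asboolP => a /Kc; apply: tit.
have nX1 : 1 <= nX.
  by rewrite /nX (bigD1 it) //= lerDl sumr_ge0.
have nXn : nX <= n.
  rewrite /nX big_mkcond /=; apply: le_trans (_ : \sum_(i < totient q) 1 <= _).
    by apply: ler_sum => i _; case: ifP.
  by rewrite sumr_const card_ord.
have kE : k / n = nX^-1.
  by rewrite -kX; field; rewrite gt_eqF ?(lt_le_trans ltr01 nX1) //= -/nX;
     apply: contra_eq_neq kX => ->; rewrite mul0r eq_sym gt_eqF.
have B0 : 0 < B by lra.
have q0' : 0 < q%:R :> R by rewrite ltr0n.
have q1' : 1 <= q%:R :> R by rewrite ler1n.
pose e1 := c / (2 * B).
have e10 : 0 < e1 by rewrite divr_gt0 // mulr_gt0.
have e11 : e1 <= 1 by rewrite ler_pdivrMr ?mulr_gt0 // mul1r; lra.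
pose D := - ln (c / 2).
have D0 : 0 <= D by rewrite oppr_ge0 ln_le0 //; lra.
pose G := ln (2 * q%:R ^+ 2 : R).
have q21 : 1 <= q%:R ^+ 2 :> R by apply: exprn_ege1.
have G0 : 0 <= G by apply: ln_ge0; lra.
exists (G + n * D + 14 * n - ln e1) => e /andP[e0 el1].
have lne : ln e^-1 = - ln e by rewrite lnV.
have lne0 : 0 <= - ln e by rewrite -lne ln_ge0 // invf_ge1.
have lne1 : ln e1 <= 0 by apply: ln_le0.
rewrite kE lne.
have nXi : 0 < nX^-1 <= 1 by rewrite invr_gt0 (lt_le_trans ltr01 nX1) invf_le1 // (lt_le_trans ltr01 nX1).
have nD0 : 0 <= n * D by rewrite mulr_ge0 // ltW.
(* For [e <= e1], continuity keeps [|L(1 + e, chi)|] above [c - B e >= c / 2]; for larger [e] the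
   term [- ln e1] of the constant makes the left side nonpositive. *)
have [ele|elt] := leP e e1; last first.
  exists 0%N => Y _; apply: le_trans (_ : 0 <= _); last first.
    by apply: sumr_ge0 => p _; apply: powR_ge0.
  have h : ln e1 <= ln e by rewrite ler_ln ?posrE // ltW.
  have : nX^-1 * - ln e <= 1 * - ln e by apply: ler_wpM2r; lra.
  lra.
have [Y0 hY0] := ln_Lsum q0 chiP e0.
exists Y0 => Y /hY0[N1 hN1].
have [N2 hN2] := @principal_lower R q q0 e (introT andP (conj e0 el1)).
pose N := (maxn M0 (maxn N1 N2)).
have h1 := hN1 N (leq_trans (leq_maxl _ _) (leq_maxr _ _)).
have h2 := hN2 N (leq_trans (leq_maxr _ _) (leq_maxr _ _)).
have h3 := hM0 N (leq_maxl _ _).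
have lnt : - G - ln e <= ln (cabs (Lsum (chi it) e N)).
  have -> : - G - ln e = ln ((2 * q%:R ^+ 2 * e)^-1).
    rewrite lnV ?posrE ?mulr_gt0 ?exprn_gt0 // lnM ?posrE ?mulr_gt0 ?exprn_gt0 //.
    by rewrite opprD.
  rewrite ler_ln ?posrE ?invr_gt0 ?mulr_gt0 ?exprn_gt0 //; last by case: (h1 it).
  rewrite (_ : Lsum (chi it) e N = Lsum (principal R q) e N) //.
  by apply: eq_bigr => m _; rewrite /twist etit.
have lnj j : j != it -> - D <= ln (cabs (Lsum (chi j) e N)).
  move=> /eqP /ntit ntj; rewrite /D opprK ler_ln ?posrE ?divr_gt0 //; last by case: (h1 j).
  have d1 := Lsum_diff N (char_sum_bound q0 (chiP j) ntj) (ltW e0); rewrite -BE in d1.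
  have d2 := h3 j ntj.
  have d3 : B * e <= c / 2.
    have : B * e <= B * e1 by rewrite ler_pM2l.
    by rewrite /e1 (_ : B * (c / (2 * B)) = c / 2) //; field; rewrite gt_eqF.
  have := cabs_sub_ge (Lsum (chi j) 0 N) (Lsum (chi j) 0 N - Lsum (chi j) e N).
  rewrite opprB addrCA subrr addr0 cabs_distC; lra.
have key : nX * \sum_(0 <= p < Y.+1 | prime p && K p) (p%:R : R) `^ (- (e + 1)) =
   \sum_(i | X i) \sum_(0 <= p < Y.+1 | prime p) complex.Re (twist (chi i) e p).
  rewrite exchange_big /= mulr_sumr big_mkcondr; apply: eq_bigr => p pp /=.
  rewrite -Re_sum /twist -mulr_suml Re_mul_real.
  have := sum_annihilator q0 chiP chiS p HK.
  have -> : \sum_(k0 < q | K k0) 1 = k%:C by rewrite /k rmorph_sum /= rmorph1.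
  rewrite -/X mulrC => /(congr1 (@complex.Re R)); rewrite Re_mul_real => ES.
  have k0 : 0 < k by rewrite -(pmulr_lgt0 _ (lt_le_trans ltr01 nX1)) kX.
  have -> : complex.Re (\sum_(i < totient q | X i) chi i p) = if K p then nX else 0.
    apply: (mulIf (lt0r_neq0 k0)); rewrite ES; case: ifP => _.
      by rewrite mulrC kX -(rmorph_nat (real_complex R)).
    by rewrite mul0r.
  by case: ifP => _; rewrite ?mul0r.
have S1 : \sum_(i | X i) (ln (cabs (Lsum (chi i) e N)) - 14) <=
   nX * \sum_(0 <= p < Y.+1 | prime p && K p) (p%:R : R) `^ (- (e + 1)).
  rewrite key; apply: ler_sum => i _; have [_] := h1 i; rewrite ler_norml; lra.
have S2 : - G - ln e - n * D - 14 * n <= \sum_(i | X i) (ln (cabs (Lsum (chi i) e N)) - 14).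
  rewrite sumrB sumr_const.
  have e14 : 14 *+ #|X| = 14 * nX :> R by rewrite /nX sumr_const mulr_natr.
  rewrite e14.
  have s1 : - G - ln e - n * D <= \sum_(i | X i) ln (cabs (Lsum (chi i) e N)).
    rewrite (bigD1 it) //=; apply: lerD => //.
    apply: (@le_trans _ _ (\sum_(i < totient q) - D)).
      by rewrite sumr_const card_ord mulNrn -[leRHS]opprK opprK lerN2 mulr_natl.
    rewrite [leRHS]big_mkcond /=; apply: ler_sum => i _; case: ifP; last by rewrite oppr_le0.
    by move=> /andP[_ /lnj].
  lra.
have S3 := le_trans S2 S1.
have nX0 := lt_le_trans ltr01 nX1.
rewrite -(ler_pM2l nX0) mulrBr mulrA mulfV ?gt_eqF // mul1r.
apply: le_trans S3.
have : 0 <= (nX - 1) * (G + n * D + 14 * n - ln e1).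
  by apply: mulr_ge0; lra.
have n0' := ltW n0.
lra.
Qed.

End NonVanishing.

Theorem dirichlet_density (R : realType) (q : nat) (K : pred nat) :
  (0 < q)%N -> residue_group q K ->
  exists C : R, forall e, 0 < e <= 1 -> exists Y0, forall Y, (Y0 <= Y)%N ->
   (\sum_(k < q | K k) 1) / (totient q)%:R * ln e^-1 - C <=
   \sum_(0 <= p < Y.+1 | prime p && K p) (p%:R : R) `^ (- (e + 1)).
Proof.
move=> q0 HK; have [chi [chiP chiS]] := exists_dirichlet_characters R[i] q0.
exact: (density_of_family q0 chiP chiS erefl HK).
Qed.

(** * The sieve *)

Section SumAux.
Variable R : numDomainType.

Lemma sum_uniq_subset (T : eqType) (s s' : seq T) (F : T -> R) :
  uniq s -> uniq s' -> {subset s <= s'} -> (forall x, x \in s' -> 0 <= F x) ->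
  \sum_(x <- s) F x <= \sum_(x <- s') F x.
Proof.
move=> us us' sub F0; rewrite [leRHS](bigID (mem s)) /= -[leLHS]addr0; apply: lerD.
  rewrite le_eqVlt; apply/orP; left; apply/eqP.
  rewrite -[RHS]big_filter; apply: perm_big; apply: uniq_perm => //.
    by rewrite filter_uniq.
  by move=> x; rewrite mem_filter; case: (boolP (x \in s)) => //= /sub ->.
by rewrite big_seq_cond; apply: sumr_ge0 => x /andP[/F0].
Qed.

Lemma sum_inj_subset (S T : eqType) (s : seq S) (s' : seq T) (g : S -> T) (F : T -> R) :
  uniq s -> uniq s' -> {in s &, injective g} -> (forall x, x \in s -> g x \in s') ->
  (forall y, y \in s' -> 0 <= F y) ->
  \sum_(x <- s) F (g x) <= \sum_(y <- s') F y.
Proof.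
move=> us us' gi gs F0; rewrite -(big_map g xpredT F); apply: sum_uniq_subset => //.
  by rewrite map_inj_in_uniq.
by move=> _ /mapP[x xs ->]; apply: gs.
Qed.

End SumAux.

(** * Chebyshev's upper bound *)

Section Chebyshev.
Variable R : realType.

Lemma logn_count p n B : prime p -> (0 < n)%N -> (n <= B)%N ->
  (logn p n = \sum_(1 <= e < B.+1) (p ^ e %| n))%N.
Proof.
move=> pp n0 nB; have lB : (logn p n <= B)%N.
  by apply: leq_trans nB; apply/ltnW/ltn_logl.
rewrite (eq_bigr (fun e => if (e <= logn p n)%N then 1%N else 0%N)); last first.
  by move=> e _; rewrite pfactor_dvdn //; case: (_ <= _)%N.
rewrite (big_cat_nat (n := (logn p n).+1)) //=.
rewrite big_nat_cond (eq_bigr (fun=> 1%N)); last by move=> e /andP[/andP[_]]; rewrite ltnS => ->.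
rewrite -big_nat_cond sum_nat_const_nat muln1 subSS subn0.
rewrite big_nat_cond big1 ?addn0 // => e /andP[/andP[h _] _].
by rewrite leqNgt h.
Qed.

Lemma ln_factorization (B n : nat) : (0 < n)%N -> (n <= B)%N ->
  ln (n%:R : R) = \sum_(0 <= p < B.+1 | prime p) \sum_(1 <= e < B.+1)
    (p ^ e %| n)%N%:R * ln p%:R.
Proof.
move=> n0 nB.
have en : n = (\prod_(0 <= p < B.+1 | prime p) p ^ logn p n)%N.
  rewrite -{1}(partnT n0) (widen_partn _ nB).
  rewrite [RHS]big_mkcond; apply: eq_bigr => p _.
  by case: ifPn => // np; rewrite (_ : logn p n = 0%N) // lognE (negbTE np).
rewrite {1}en.
have : 0 < ((\prod_(0 <= p < B.+1 | prime p) p ^ logn p n)%N%:R : R) /\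
  ln ((\prod_(0 <= p < B.+1 | prime p) p ^ logn p n)%N%:R : R) =
  \sum_(0 <= p < B.+1 | prime p) ln ((p%:R : R) ^+ logn p n).
  apply: (big_ind2 (fun (a : nat) (b : R) => 0 < (a%:R : R) /\ ln (a%:R : R) = b)).
  - by rewrite ln1 ltr01.
  - move=> a b a' b' [a0 <-] [a0' <-]; rewrite natrM; split; first exact: mulr_gt0.
    by rewrite lnM.
  - by move=> p pp; rewrite natrX; split => //; rewrite exprn_gt0 // ltr0n prime_gt0.
move=> [_ ->]; apply: eq_bigr => p pp.
rewrite lnXn ?ltr0n ?prime_gt0 // -mulr_suml -[LHS]mulr_natl; congr (_ * _).
by rewrite (logn_count pp n0 nB) natr_sum.
Qed.

(** Chebyshev's function [psi (N)] when [N <= B]; the bound [B] gives all [N] a common range of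
    primes and exponents, so that they can be compared term by term. *)
Definition chebyshev_psi B N : R :=
  \sum_(0 <= p < B.+1 | prime p) \sum_(1 <= e < B.+1) (p ^ e <= N)%N%:R * ln p%:R.

Lemma ln_prime_ge0 p : prime p -> 0 <= ln (p%:R : R).
Proof. by move=> pp; apply: ln_ge0; rewrite ler1n prime_gt0. Qed.

Lemma ln_fact_sum B n : (n <= B)%N ->
  ln (n`!%:R : R) = \sum_(0 <= p < B.+1 | prime p) \sum_(1 <= e < B.+1)
    (n %/ p ^ e)%N%:R * ln p%:R.
Proof.
elim: n => [|n IH] nB.
  rewrite fact0 ln1 big1 // => p _; rewrite big1 // => e _.
  by rewrite div0n mul0r.
rewrite factS natrM lnM ?posrE ?ltr0n ?fact_gt0 // IH 1?ltnW //.
rewrite (ln_factorization (ltn0Sn n) nB) -big_split; apply: eq_bigr => p pp /=.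
rewrite -big_split; apply: eq_bigr => e _ /=.
by rewrite -mulrDl -natrD divnS ?expn_gt0 ?prime_gt0.
Qed.

Lemma central_bin_le n : ('C(n.*2, n) <= 2 ^ n.*2)%N.
Proof.
have := expnDn 1 1 n.*2; rewrite addn1 => ->.
rewrite (bigD1 (inord n)) //= inordK; last by rewrite ltnS -addnn leq_addr.
by rewrite !exp1n !muln1 leq_addr.
Qed.

(** By Legendre's formula the logarithm of the central binomial coefficient sums
    [(floor (2n/d) - 2 floor (n/d)) ln p] over the prime powers [d = p^e]. The coefficient is
    nonnegative, and it is 1 for [n < d <= 2n], the terms of [psi (2n) - psi (n)]. *)
Lemma chebyshev_psi_double B n : (n.*2 <= B)%N ->
  chebyshev_psi B n.*2 - chebyshev_psi B n <= n.*2%:R.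
Proof.
move=> nB; have nB' : (n <= B)%N by apply: leq_trans nB; rewrite -addnn leq_addr.
have ebin : ln (n.*2`!%:R : R) = ln ('C(n.*2, n)%:R) + 2 * ln (n`!%:R).
  have := bin_fact (leq_trans (leq_addr n n) (eq_leq (addnn n))).
  rewrite -[in (_ - n)%N]addnn addnK => <-.
  have b0 : (0 < 'C(n.*2, n))%N by rewrite bin_gt0 -addnn leq_addr.
  rewrite !natrM !lnM ?posrE ?mulr_gt0 ?ltr0n ?fact_gt0 //; ring.
apply: (@le_trans _ _ (ln ('C(n.*2, n)%:R : R))).
  have -> : ln ('C(n.*2, n)%:R : R) = ln (n.*2`!%:R : R) - 2 * ln (n`!%:R).
    by rewrite ebin addrK.
  rewrite (ln_fact_sum nB) (ln_fact_sum nB') mulr_sumr -!sumrB; apply: ler_sum => p pp.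
  rewrite mulr_sumr -!sumrB [leLHS]big_nat_cond [leRHS]big_nat_cond.
  apply: ler_sum => e; rewrite andbT => /andP[e0 _].
  rewrite -mulrBl mulrA -mulrBl; apply: ler_wpM2r; first exact: ln_prime_ge0.
  set d := (p ^ e)%N; have d0 : (0 < d)%N by rewrite expn_gt0 prime_gt0.
  have h : ((d <= n.*2) + 2 * (n %/ d) <= (d <= n) + n.*2 %/ d)%N.
    have h1 : (2 * (n %/ d) <= n.*2 %/ d)%N.
      by rewrite leq_divRL // -mulnA mul2n leq_double leq_divM.
    have [dn|nd] := leqP d n.
      by rewrite (leq_trans dn) -1?addnn ?leq_addr //= leq_add2l addnn.
    rewrite (divn_small nd) muln0 addn0 add0n; case: (leqP d n.*2) => // dn.
    by rewrite -[nat_of_bool true]/1%N divn_gt0.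
  rewrite -natrM lerBrDr addrAC lerBlDr -!natrD ler_nat; lia.
apply: (@le_trans _ _ (ln ((2 ^ n.*2)%N%:R : R))).
  rewrite ler_ln ?posrE ?ltr0n ?expn_gt0 ?bin_gt0 ?ler_nat ?central_bin_le //.
  by rewrite -addnn leq_addr.
rewrite natrX lnXn ?ltr0n // -[leLHS]mulr_natl -[leRHS]mulr1; apply: ler_wpM2l; first exact: ler0n.
have := @le_ln1Dx R 1; rewrite -[1 + 1]/(2%:R); apply; lra.
Qed.

Lemma chebyshev_psi_le B N : (N < B)%N -> chebyshev_psi B N <= 6 * N%:R.
Proof.
elim/ltn_ind: N => N IH NB; have [N1|N2] := leqP N 1.
  rewrite /chebyshev_psi big1 ?mulr_ge0 ?ler0n // => p pp.
  rewrite big_nat_cond big1 // => e /andP[/andP[e0 _] _].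
  rewrite leqNgt (leq_ltn_trans N1) ?mul0r //.
  by rewrite -{1}(expn0 p) ltn_exp2l ?prime_gt1.
pose n := N.+1./2.
have e1 : (odd N.+1 + 2 * n = N.+1)%N by rewrite mul2n odd_double_half.
have o1 : (odd N.+1 <= 1)%N by case: (odd N.+1).
have nN : (n < N)%N by move: e1 o1 N2; lia.
have Nn : (N <= n.*2)%N by move: e1 o1; lia.
have nB : (n.*2 <= B)%N by move: e1 o1 NB; lia.
have h1 := chebyshev_psi_double nB.
have h2 := IH n nN (ltn_trans nN NB).
have h3 : chebyshev_psi B N <= chebyshev_psi B n.*2.
  apply: ler_sum => p pp; apply: ler_sum => e _; apply: ler_wpM2r.
    exact: ln_prime_ge0.
  by rewrite ler_nat; case: (leqP _ N) => // h; rewrite (leq_trans h Nn).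
(* [n] is [N / 2] rounded up, hence at most [3 N / 4] for [N >= 2], so
   [psi (N) <= 2 n + 6 n <= 6 N]. *)
have h4 : 4 * n%:R <= 3 * N%:R :> R.
  by rewrite -!natrM ler_nat; move: e1 o1 N2; lia.
have h5 : n.*2%:R = 2 * n%:R :> R by rewrite -mul2n natrM.
have h6 : 0 <= N%:R :> R by apply: ler0n.
lra.
Qed.

End Chebyshev.

(** * Euler product bounds for sums of multiplicative weights *)

Section MultiplicativeBound.
Variables (R : realType) (w : nat -> R) (s : R).
Hypothesis w01 : forall p, 0 <= w p <= 1.
Hypothesis s1 : 1 <= s.

(** The factor [w p] enters once for each prime divisor, whatever its multiplicity, since the sieve
    conditions concern the set of prime factors. *)
Definition weight n : R := (n%:R `^ (- s)) * \prod_(p <- primes n) w p.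

Lemma weight_ge0 n : 0 <= weight n.
Proof.
by rewrite mulr_ge0 ?powR_ge0 // prodr_ge0 // => p _; case/andP: (w01 p).
Qed.

Lemma weight_pfactor p j n : prime p -> ~~ (p %| n)%N -> (0 < n)%N -> (0 < j)%N ->
  weight (p ^ j * n) = w p * (p ^ j)%:R `^ (- s) * weight n.
Proof.
move=> pp pn n0 j0; have pj0 : (0 < p ^ j)%N by rewrite expn_gt0 prime_gt0.
rewrite /weight (perm_big (p :: primes n)) /=.
  by rewrite big_cons natrM powRM ?ler0n //; ring.
apply: uniq_perm; first exact: primes_uniq.
  by rewrite /= primes_uniq mem_primes (negbTE pn) !andbF.
by move=> r; rewrite primesM // primesX // primes_prime // !inE.
Qed.

Definition smooth (ps : seq nat) n := all (fun p => p \in ps) (primes n).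

(** Splitting off the full power of [p] embeds the integers up to [N] into pairs of an exponent and
    an integer prime to [p]; enlarging the range to all pairs only adds nonnegative terms. *)
Lemma smooth_sum ps N : all prime ps -> uniq ps ->
  \sum_(1 <= n < N.+1 | smooth ps n) weight n <=
  \prod_(p <- ps) (1 + w p * \sum_(1 <= j < N.+1) (p ^ j)%:R `^ (- s)).
Proof.
elim: ps => [_ _|p ps IH /= /andP[pp aps] /andP[pps ups]].
  rewrite big_nil; apply: (@le_trans _ _ (\sum_(n <- [:: 1%N]) weight n)); last first.
    by rewrite big_seq1 /weight powR1 mul1r (_ : primes 1 = [::]) // big_nil.
  rewrite -big_filter; apply: sum_uniq_subset => //.
  - by rewrite filter_uniq // iota_uniq.
  - move=> n; rewrite mem_filter mem_index_iota !inE => /andP[sn /andP[n0 _]].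
    rewrite eqn_leq n0 andbT leqNgt; apply/negP => n1.
    by have /(allP sn) : pdiv n \in primes n by rewrite mem_primes pdiv_prime // n0 pdiv_dvd.
  - by move=> n _; apply: weight_ge0.
rewrite big_cons.
pose c j : R := if j is 0%N then 1 else w p * (p ^ j)%:R `^ (- s).
have c0 j : 0 <= c j.
  by case: j => [|j] //; rewrite mulr_ge0 ?powR_ge0 //; case/andP: (w01 p).
pose S := [seq n <- index_iota 1 N.+1 | smooth ps n].
apply: (@le_trans _ _ (\sum_(j <- iota 0 N.+1) \sum_(n <- S) c j * weight n)); last first.
  have -> : \sum_(j <- iota 0 N.+1) \sum_(n <- S) c j * weight n =
      (\sum_(j <- iota 0 N.+1) c j) * \sum_(n <- S) weight n.
    by rewrite mulr_suml; apply: eq_bigr => j _; rewrite mulr_sumr.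
  have -> : \sum_(j <- iota 0 N.+1) c j = 1 + \sum_(1 <= j < N.+1) c j.
    by rewrite big_cons /index_iota subSS subn0.
  apply: ler_pM.
  - by rewrite addr_ge0 // sumr_ge0.
  - by apply: sumr_ge0 => n _; apply: weight_ge0.
  - rewrite lerD2l mulr_sumr [leLHS]big_nat_cond [leRHS]big_nat_cond; apply: ler_sum => j.
    by rewrite andbT => /andP[j0 _]; case: j j0.
  - by rewrite /S big_filter; apply: IH.
rewrite -(big_allpairs (F := fun z => c z.1 * weight z.2)) -big_filter.
pose g n := (logn p n, n %/ p ^ logn p n)%N.
have dec n : (0 < n)%N -> [/\ n = (p ^ logn p n * (n %/ p ^ logn p n))%N,
    (0 < n %/ p ^ logn p n)%N & ~~ (p %| n %/ p ^ logn p n)%N].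
  move=> n0; have [m cm en] := pfactor_coprime pp n0.
  have pl0 : (0 < p ^ logn p n)%N by rewrite expn_gt0 prime_gt0.
  have em : (n %/ p ^ logn p n)%N = m by rewrite {1}en mulnK.
  rewrite em mulnC -en; split => //; last by rewrite -prime_coprime.
  by move: n0; rewrite {1}en muln_gt0 => /andP[].
apply: (@le_trans _ _ (\sum_(n <- [seq n <- index_iota 1 N.+1 | smooth (p :: ps) n])
    c (g n).1 * weight (g n).2)).
  rewrite le_eqVlt; apply/orP; left; apply/eqP.
  apply: eq_big_seq => n; rewrite mem_filter mem_index_iota => /andP[_ /andP[n0 _]].
  have [en m0 pm] := dec n n0; rewrite /g /=.
  case l: (logn p n) en m0 pm => [|l'] en m0 pm; first by rewrite expn0 divn1 mul1r.
  by rewrite {1}en weight_pfactor.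
apply: (sum_inj_subset (F := fun z : nat * nat => c z.1 * weight z.2)).
- by rewrite filter_uniq // iota_uniq.
- apply: allpairs_uniq; [exact: iota_uniq|by rewrite filter_uniq // iota_uniq|].
  by move=> [x1 y1] [x2 y2].
- move=> a b; rewrite !mem_filter !mem_index_iota => /andP[_ /andP[a0 _]] /andP[_ /andP[b0 _]].
  have [ea _ _] := dec a a0; have [eb _ _] := dec b b0.
  by rewrite /g => -[e1 e2]; rewrite ea eb e2 e1.
- move=> n; rewrite mem_filter mem_index_iota => /andP[sn /andP[n0 nN]].
  have [en m0 pm] := dec n n0.
  apply/allpairsP; exists (g n); split; last by [].
    rewrite mem_iota add0n; apply: leq_trans nN; exact: ltnW (ltn_logl _ n0).
  rewrite [(g n).2]/= mem_filter mem_index_iota m0 /= ltnS (leq_trans (leq_div _ _)) // andbT.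
  apply/allP => r; rewrite mem_primes => /and3P[pr _ rm].
  have : r \in primes n by rewrite mem_primes pr n0 {1}en dvdn_mull.
  move/(allP sn); rewrite inE => /predU1P[er|//].
  by rewrite er (negbTE pm) in rm.
- by move=> [j n] _; rewrite mulr_ge0 // weight_ge0.
Qed.

Lemma geometric_pow_bound p N : prime p ->
  \sum_(1 <= j < N.+1) (p ^ j)%:R `^ (- s) <=
    (p%:R : R) `^ (- s) + 2 * (p%:R ^- 2 : R).
Proof.
move=> pp; set x : R := p%:R `^ (- s).
have p0 : 0 < p%:R :> R by rewrite ltr0n prime_gt0.
have xp : x <= p%:R^-1.
  rewrite -powR_inv1 ?ler0n //; apply: ler_powR; last by rewrite lerN2.
  by rewrite ler1n prime_gt0.
have p2 : p%:R^-1 <= 2^-1 :> R.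
  by rewrite lef_pV2 ?posrE // ler_nat prime_gt1.
have x0 : 0 <= x by apply: powR_ge0.
have ex j : (p ^ j)%:R `^ (- s) = x ^+ j.
  rewrite natrX /x; elim: j => [|j IH]; first by rewrite !expr0 powR1.
  by rewrite !exprS powRM ?exprn_ge0 ?ler0n // IH.
under eq_bigr do rewrite ex.
have H : \sum_(1 <= j < N.+1) x ^+ j <= x + 2 * x ^+ 2.
  case: N => [|N]; first by rewrite big_geq // addr_ge0 // mulr_ge0 // sqr_ge0.
  suff : \sum_(1 <= j < N.+2) x ^+ j + 2 * x ^+ N.+2 <= x + 2 * x ^+ 2.
    have : 0 <= x ^+ N.+2 by apply: exprn_ge0.
    lra.
  elim: N => [|N IH]; first by rewrite big_nat1 expr1.
  apply: le_trans IH; rewrite [X in X + _ <= _]big_nat_recr //= -addrA lerD2l.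
  have : 0 <= x ^+ N.+2 by apply: exprn_ge0.
  rewrite [x ^+ N.+3]exprS; nra.
apply: le_trans H _; rewrite lerD2l ler_pM2l // -exprVn; apply: lerXn2r => //.
by rewrite nnegrE invr_ge0 ltW.
Qed.

Lemma sum_inv_prime_squares Y :
  \sum_(0 <= p < Y.+1 | prime p) (p%:R ^- 2 : R) <= 2.
Proof.
apply: (@le_trans _ _ (\sum_(2 <= p < Y.+2) (p.-1%:R^-1 - p%:R^-1 : R))).
  case: Y => [|Y]; first by rewrite big_mkcond big_nat1 /= big_geq.
  rewrite big_mkcond /= big_ltn // big_ltn //= !add0r.
  rewrite [leRHS]big_nat_recr //= -[leLHS]addr0; apply: lerD; last first.
    by rewrite subr_ge0 lef_pV2 ?posrE ?ltr0n // ler_nat leqnSn.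
  rewrite [leLHS]big_nat_cond [leRHS]big_nat_cond; apply: ler_sum => p.
  rewrite andbT => /andP[p2 _]; case: p p2 => [|[|p]] // _ /=.
  have h1 : 0 < p.+1%:R :> R by rewrite ltr0n.
  have h2 : p.+2%:R = p.+1%:R + 1 :> R by rewrite natr1.
  have e : p.+1%:R^-1 - p.+2%:R^-1 = (p.+1%:R * p.+2%:R)^-1 :> R.
    rewrite h2; move: (p.+1%:R : R) h1 => a a0; field.
    by rewrite !gt_eqF // addr_gt0.
  rewrite e; case: ifP => _; last by rewrite invr_ge0 mulr_ge0 ?ler0n.
  rewrite lef_pV2 ?posrE ?exprn_gt0 ?mulr_gt0 ?ltr0n // expr2 ler_pM2r ?ltr0n //.
  by rewrite ler_nat.
rewrite big_add1 /=; under eq_bigr do rewrite -opprB.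
rewrite sumrN telescope_sumr // opprB invr1; have : 0 <= Y.+1%:R^-1 :> R by rewrite invr_ge0.
move: (Y.+1%:R^-1 : R) => z z0; lra.
Qed.

(** The 4 bounds the higher powers: [p^2, p^3, ...] contribute at most [2 p^(-2)] for each prime,
    and the [p^(-2)] sum to at most 2. The cut [Y] is left free above [N] because the prime sums are
    estimated only for large [Y]. *)
Lemma weight_sum_bound N Y : (N <= Y)%N ->
  \sum_(1 <= n < N.+1) weight n <=
  expR (\sum_(0 <= p < Y.+1 | prime p) w p * p%:R `^ (- s) + 4).
Proof.
move=> NY; pose ps := [seq p <- index_iota 0 Y.+1 | prime p].
have aps : all prime ps by apply: filter_all.
have ups : uniq ps by rewrite filter_uniq // iota_uniq.
apply: le_trans (_ : \sum_(1 <= n < N.+1 | smooth ps n) weight n <= _).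
  rewrite [leRHS]big_mkcond [leLHS]big_nat_cond [leRHS]big_nat_cond; apply: ler_sum => n.
  rewrite andbT => /andP[n0 nN]; rewrite (_ : smooth ps n = true) //.
  apply/allP => p; rewrite mem_primes => /and3P[pp _ pn].
  by rewrite mem_filter pp mem_index_iota /= ltnS (leq_trans _ NY) // -ltnS (leq_ltn_trans _ nN) // dvdn_leq.
apply: le_trans (smooth_sum N aps ups) _.
apply: (@le_trans _ _ (\prod_(p <- ps) expR (w p * p%:R `^ (- s) + 2 * p%:R ^- 2))).
  rewrite big_seq_cond [leRHS]big_seq_cond; apply: ler_prod => p /andP[pps _].
  have pp := allP aps p pps; have /andP[w0 w1] := w01 p.
  have S0 : 0 <= \sum_(1 <= j < N.+1) (p ^ j)%:R `^ (- s) :> R.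
    by apply: sumr_ge0 => j _; apply: powR_ge0.
  rewrite addr_ge0 ?mulr_ge0 //=; apply: le_trans (expR_ge1Dx _); rewrite lerD2l.
  have h := geometric_pow_bound N pp.
  have i0 : 0 <= p%:R ^- 2 :> R by rewrite invr_ge0 exprn_ge0.
  apply: le_trans (ler_wpM2l w0 h) _; rewrite mulrDr lerD2l.
  by rewrite -[leRHS]mul1r; apply: ler_wpM2r => //; rewrite mulr_ge0.
rewrite -expR_sum ler_expR big_filter big_split /= lerD2l -mulr_sumr.
have := sum_inv_prime_squares Y; lra.
Qed.

End MultiplicativeBound.

Definition odd_part n := (n %/ 2 ^ logn 2 n)%N.

Lemma odd_partP n : (0 < n)%N ->
  [/\ n = (2 ^ logn 2 n * odd_part n)%N, (0 < odd_part n)%N & odd (odd_part n)].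
Proof.
move=> n0; have [m cm en] := pfactor_coprime (isT : prime 2) n0.
have em : odd_part n = m by rewrite /odd_part {1}en mulnK // expn_gt0.
rewrite em mulnC -en; split => //; last by rewrite -coprime2n.
by move: n0; rewrite {1}en muln_gt0 => /andP[].
Qed.

Lemma odd_partE k m : odd m -> odd_part (2 ^ k * m) = m /\ logn 2 (2 ^ k * m) = k.
Proof.
move=> om; have m0 := odd_gt0 om.
have l : logn 2 (2 ^ k * m) = k.
  by rewrite lognM ?expn_gt0 // pfactorK // (@logn_coprime 2 m) ?coprime2n // addn0.
by rewrite /odd_part l mulKn ?expn_gt0.
Qed.

Lemma odd_part_le n : (odd_part n <= n)%N.
Proof. exact: leq_div. Qed.

(** * Counting the admissible integers *)

Section Sieve.
Variables (R : realType) (bad semi : pred nat).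

Definition sieve_weight p : R := if bad p then 0 else if semi p then 2^-1 else 1.

(** The conditions that [support_structure] imposes on [n = 2^k m], for one modulus and one semi-bad
    coset. *)
Definition admissible n :=
  ~~ has bad (primes (odd_part n)) &&
  (count semi (primes (odd_part n)) <= (logn 2 n).+1)%N.

Lemma sieve_weight01 p : 0 <= sieve_weight p <= 1.
Proof.
rewrite /sieve_weight; case: (bad p); first by rewrite lexx ler01.
by case: (semi p); rewrite ?ler01 ?lexx // invr_ge0 invf_le1 ?ler1n ?ler0n.
Qed.

Lemma weightE s m : ~~ has bad (primes m) ->
  weight sieve_weight s m = m%:R `^ (- s) * 2^-1 ^+ count semi (primes m).
Proof.
rewrite /weight => nb; congr (_ * _).
elim: (primes m) nb => [_|p l IH] /=; first by rewrite big_nil expr0.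
rewrite negb_or => /andP[bp nb]; rewrite big_cons IH // /sieve_weight (negbTE bp).
by case: (semi p); rewrite ?add1n ?add0n ?exprS ?mul1r.
Qed.

Lemma geometric_tail a K : \sum_(0 <= k < K | (a <= k)%N) (2^-1 : R) ^+ k <= 2 * 2^-1 ^+ a.
Proof.
have [Ka|aK] := leqP K a.
  rewrite big_nat_cond big1; first by rewrite mulr_ge0 // exprn_ge0.
  by move=> k /andP[/andP[_ kK] ak]; have := leq_trans (leq_trans kK Ka) ak; rewrite ltnn.
have : \sum_(0 <= k < K | (a <= k)%N) (2^-1 : R) ^+ k + 2 * 2^-1 ^+ K <= 2 * 2^-1 ^+ a.
  elim: K aK => // K IH; rewrite ltnS leq_eqVlt big_mkcond big_nat_recr //= -big_mkcond.
  move=> /predU1P[<-|aK].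
    rewrite leqnn big_nat_cond big1 ?add0r; first by rewrite exprS; lra.
    by move=> k /andP[/andP[_ ka] ak]; have := leq_trans ka ak; rewrite ltnn.
  rewrite (ltnW aK); have := IH aK; rewrite exprS; lra.
have : 0 <= (2^-1 : R) ^+ K by rewrite exprn_ge0.
lra.
Qed.

(** If [m] has [o] prime factors in [semi], admissibility of [2^k m] requires [k >= o - 1]; the
    [(2^k)^(-s) <= 2^(-k)] then sum to at most [4 * 2^(-o)], which is where each such prime gets its
    weight 1/2. *)
Lemma admissible_sum_le (s : R) N : 1 <= s ->
  \sum_(1 <= n < N.+1 | admissible n) (n%:R : R) `^ (- s) <=
  4 * \sum_(1 <= m < N.+1) weight sieve_weight s m.
Proof.
move=> s1.
pose F (z : nat * nat) : R :=
  if ~~ has bad (primes z.2) && (count semi (primes z.2) <= z.1.+1)%N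
  then (2^-1) ^+ z.1 * (z.2%:R `^ (- s)) else 0.
have F0 z : 0 <= F z.
  by rewrite /F; case: ifP => // _; rewrite mulr_ge0 ?powR_ge0 // exprn_ge0.
pose g n := (logn 2 n, odd_part n).
apply: (@le_trans _ _ (\sum_(n <- [seq n <- index_iota 1 N.+1 | admissible n]) F (g n))).
  rewrite -big_filter big_seq_cond [leRHS]big_seq_cond; apply: ler_sum => n.
  rewrite mem_filter mem_index_iota andbT => /andP[an /andP[n0 _]].
  have [en m0 _] := odd_partP n0.
  rewrite /F /= -/(admissible n) an {1}en natrM powRM ?ler0n //.
  apply: ler_wpM2r; first exact: powR_ge0.
  rewrite natrX exprVn -powR_invn // -powR_mulrn // -powRrM.
  apply: ler_powR; first by rewrite ler1n.
  rewrite mulrN lerN2 -[leLHS]mulr1; apply: ler_wpM2l => //.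
apply: le_trans (_ : \sum_(z <- [seq (k, m) | k <- iota 0 N.+1, m <- index_iota 1 N.+1]) F z <= _).
  apply: (sum_inj_subset (F := F)).
  - by rewrite filter_uniq // iota_uniq.
  - by apply: allpairs_uniq; rewrite ?iota_uniq // => -[x1 y1] [x2 y2].
  - move=> a b; rewrite !mem_filter !mem_index_iota => /andP[_ /andP[a0 _]] /andP[_ /andP[b0 _]].
    have [ea _ _] := odd_partP a0; have [eb _ _] := odd_partP b0.
    by rewrite /g => -[e1 e2]; rewrite ea eb e1 e2.
  - move=> n; rewrite mem_filter mem_index_iota => /andP[_ /andP[n0 nN]].
    have [en m0 _] := odd_partP n0.
    apply/allpairsP; exists (g n); split; last by [].
      by rewrite mem_iota add0n; apply: leq_trans nN; exact: ltnW (ltn_logl _ n0).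
    by rewrite mem_index_iota m0 /= ltnS (leq_trans (odd_part_le n)).
  - by [].
rewrite big_allpairs exchange_big /= mulr_sumr.
rewrite [leLHS]big_nat_cond [leRHS]big_nat_cond; apply: ler_sum => m.
rewrite andbT => /andP[m0 _]; rewrite /F /=.
have [hb|nb] := boolP (has bad (primes m)).
  rewrite big1 //=; rewrite mulr_ge0 // weight_ge0 //; exact: sieve_weight01.
rewrite weightE //= -big_mkcond -mulr_suml mulrC mulrCA; apply: ler_wpM2l; first exact: powR_ge0.
set o := count _ _.
apply: le_trans (_ : 2 * 2^-1 ^+ o.-1 <= _).
  apply: le_trans (geometric_tail o.-1 N.+1); rewrite le_eqVlt; apply/orP; left; apply/eqP.
  by apply: eq_bigl => k; case: o.
case: o => [|o]; first by rewrite !expr0; lra.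
by rewrite exprS /=; lra.
Qed.

Lemma admissible_div n d : (0 < n)%N -> odd d -> (d %| odd_part n)%N -> admissible n ->
  admissible (n %/ d).
Proof.
move=> n0 od dn; have [en m0 om] := odd_partP n0.
have d0 := odd_gt0 od.
have ed : (n %/ d = 2 ^ logn 2 n * (odd_part n %/ d))%N.
  by rewrite {1}en muln_divA.
have dm : (odd_part n %/ d %| odd_part n)%N by rewrite -{2}(divnK dn) dvdn_mulr.
have om' : odd (odd_part n %/ d) by apply: dvdn_odd dm om.
have [e1 e2] := odd_partE (logn 2 n) om'.
rewrite /admissible ed e1 e2 => /andP[/hasPn nb cs].
have sub : {subset primes (odd_part n %/ d) <= primes (odd_part n)}.
  move=> p; rewrite !mem_primes m0 => /and3P[-> _ pd] /=; exact: dvdn_trans dm.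
apply/andP; split; first by apply/hasPn => p /sub /nb.
apply: leq_trans cs; rewrite -!size_filter; apply: uniq_leq_size.
  by rewrite filter_uniq // primes_uniq.
by move=> p; rewrite !mem_filter => /andP[-> /sub].
Qed.

(* Each [ln (odd_part n)] is a sum of [ln p] over the prime powers [p^e] dividing it, and
   [n %/ p^e] is again admissible. *)
Lemma sum_ln_odd_part N :
  \sum_(1 <= n < N.+1 | admissible n) ln ((odd_part n)%:R : R) <=
  6 * N%:R * \sum_(1 <= n < N.+1 | admissible n) (n%:R^-1 : R).
Proof.
pose B := N.+1.
apply: (@le_trans _ _ (\sum_(1 <= n < N.+1 | admissible n) chebyshev_psi R B (N %/ n))); last first.
  rewrite mulr_sumr [leLHS]big_nat_cond [leRHS]big_nat_cond; apply: ler_sum => n.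
  move=> /andP[/andP[n0 nN] _].
  apply: le_trans (chebyshev_psi_le R _) _; first by rewrite /B ltnS leq_div.
  rewrite -mulrA ler_pM2l // ler_pdivlMr ?ltr0n // -natrM ler_nat; exact: leq_divM.
have -> : \sum_(1 <= n < N.+1 | admissible n) ln ((odd_part n)%:R : R) =
   \sum_(0 <= p < B.+1 | prime p) \sum_(1 <= e < B.+1)
     (\sum_(1 <= n < N.+1 | admissible n) (p ^ e %| odd_part n)%N%:R) * ln (p%:R : R).
  rewrite big_nat_cond (eq_bigr (fun n => \sum_(0 <= p < B.+1 | prime p)
     \sum_(1 <= e < B.+1) (p ^ e %| odd_part n)%N%:R * ln (p%:R : R))); last first.
    move=> n /andP[/andP[n0 nN] _]; have [_ m0 _] := odd_partP n0.
    by rewrite (ln_factorization R m0 (leq_trans (odd_part_le n) (ltnW nN) : odd_part n <= B)%N).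
  rewrite -big_nat_cond exchange_big /=; apply: eq_bigr => p _.
  rewrite exchange_big /=; apply: eq_bigr => e _; by rewrite mulr_suml.
rewrite /chebyshev_psi [leRHS]exchange_big /=; apply: ler_sum => p pp.
rewrite [leRHS]exchange_big /= [leLHS]big_nat_cond [leRHS]big_nat_cond; apply: ler_sum => e.
rewrite andbT => /andP[e0 _]; rewrite -[leRHS]mulr_suml.
apply: ler_wpM2r; first exact: ln_prime_ge0.
have d0 : (0 < p ^ e)%N by rewrite expn_gt0 prime_gt0.
have [ep|op] := boolP (odd (p ^ e)); last first.
  apply: (@le_trans _ _ 0); last by apply: sumr_ge0 => n _; apply: ler0n.
  rewrite big_nat_cond big1 // => n /andP[/andP[n0 _] _]; have [_ _ om] := odd_partP n0.
  case: (boolP (p ^ e %| odd_part n)%N) => // h.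
  by rewrite (dvdn_odd h om) in op.
have ind (P b : pred nat) : \sum_(1 <= n < N.+1 | P n) (b n)%:R =
    \sum_(n <- [seq n <- index_iota 1 N.+1 | P n && b n]) (1 : R).
  by rewrite big_filter big_mkcondr; apply: eq_bigr => n _; case: (b n).
rewrite (ind _ (fun n => p ^ e %| odd_part n)%N) (ind _ (fun n => p ^ e <= N %/ n)%N).
(* Division by [p^e] maps the admissible [n <= N] whose odd part is a multiple of [p^e] injectively
   to admissible [n'] with [p^e <= N / n']. *)
apply: (sum_inj_subset (g := fun n => (n %/ p ^ e)%N) (F := fun=> 1 : R)).
- by rewrite filter_uniq // iota_uniq.
- by rewrite filter_uniq // iota_uniq.
- have pdn n : (p ^ e %| odd_part n)%N -> (0 < n)%N -> (p ^ e %| n)%N.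
    move=> h n0; have [en _ _] := odd_partP n0.
    by apply: (dvdn_trans h); rewrite {2}en dvdn_mull.
  move=> a b; rewrite !mem_filter !mem_index_iota.
  move=> /andP[/andP[_ ha] /andP[a0 _]] /andP[/andP[_ hb] /andP[b0 _]] ab.
  by rewrite -(divnK (pdn a ha a0)) ab (divnK (pdn b hb b0)).
- move=> n; rewrite !mem_filter !mem_index_iota => /andP[/andP[an h] /andP[n0 nN]].
  have pn : (p ^ e %| n)%N.
    have [en _ _] := odd_partP n0.
    by apply: (dvdn_trans h); rewrite {2}en dvdn_mull.
  have q0 : (0 < n %/ p ^ e)%N by rewrite divn_gt0 // dvdn_leq.
  rewrite admissible_div //= q0 /= ltnS (leq_trans (leq_div _ _)) // andbT.
  by rewrite leq_divRL // mulnC divnK.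
- by move=> *; apply: ler01.
Qed.

Lemma ln_ge1_gt0 (x : R) : 1 <= ln x -> 0 < x.
Proof.
move=> L1; rewrite ltNge; apply/negP => x0.
by have := ln_le0 (le_trans x0 ler01); lra.
Qed.

Section Count.
Variables (c C0 : R).
Hypotheses (c02 : 0 <= c <= 2).
Hypothesis density : forall e : R, 0 < e <= 1 -> exists Y0, forall Y, (Y0 <= Y)%N ->
  \sum_(0 <= p < Y.+1 | prime p) sieve_weight p * (p%:R : R) `^ (- (e + 1)) <=
  (1 - c) * ln e^-1 + C0.

(** With [e = 1 / ln x], [n^e <= exp 1] for [n <= x], so passing from [1/n] to [n^(-(1+e))] costs
    the factor [expR 1]; the factor 4 comes from the sum over the powers of 2, and [ln e^-1] is
    [ln (ln x)]. *)
Lemma sum_inv_admissible (x : R) : 1 <= ln x ->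
  \sum_(1 <= n < (Num.truncn x).+1 | admissible n) (n%:R^-1 : R) <=
  (4 * expR 1 * expR (C0 + 4)) * (ln x) `^ (1 - c).
Proof.
move=> L1; have x0 := ln_ge1_gt0 L1; set L := ln x in L1 *; have L0 : 0 < L by apply: lt_le_trans L1.
pose e := L^-1; have e0 : 0 < e by rewrite invr_gt0.
have e1 : e <= 1 by rewrite invf_le1.
have eL : e * L = 1 by rewrite mulVf // gt_eqF.
set X := Num.truncn x.
apply: (@le_trans _ _ (\sum_(1 <= n < X.+1 | admissible n) expR 1 * (n%:R : R) `^ (- (e + 1)))).
  rewrite big_nat_cond [leRHS]big_nat_cond; apply: ler_sum => n /andP[/andP[n0 nX] _].
  have n0' : 0 < n%:R :> R by rewrite ltr0n.
  have nx : n%:R <= x by rewrite -truncn_ge_nat ?(ltW x0) // -ltnS.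
  rewrite opprD addrC powRD; last by apply/implyP => _; rewrite gt_eqF.
  rewrite (powR_inv1 (ltW n0')) mulrCA -[leLHS]mulr1; apply: ler_wpM2l; first by rewrite invr_ge0 ltW.
  rewrite powRN ler_pdivlMr ?powR_gt0 // mul1r /powR gt_eqF // ler_expR -[leRHS]eL.
  by rewrite ler_pM2l // /L ler_ln ?posrE.
rewrite -mulr_sumr [4 * _]mulrC -!mulrA; apply: ler_wpM2l; first exact: expR_ge0.
have [Y0 hY0] := density (introT andP (conj e0 e1)).
have h1 := @admissible_sum_le (e + 1) X (ltW (ltr_pwDl e0 (lexx 1))).
apply: le_trans h1 _; rewrite ler_pM2l //.
have hY := hY0 _ (leq_maxl Y0 X).
have s1 : 1 <= e + 1 by rewrite lerDr ltW.
apply: le_trans (weight_sum_bound sieve_weight01 s1 (leq_maxr Y0 X)) _.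
have -> : L `^ (1 - c) = expR ((1 - c) * ln L) by rewrite /powR gt_eqF.
rewrite -expRD ler_expR; rewrite invrK in hY; lra.
Qed.

Lemma ln2_ge_half : 2^-1 <= ln (2 : R).
Proof.
have := @le_ln1Dx R (- 2^-1); rewrite (_ : 1 + - 2^-1 = 2^-1); last by lra.
rewrite lnV ?posrE // => h; have : -1 < - 2^-1 :> R by lra.
by move=> /h; lra.
Qed.

(** Where the odd part is at most [sqrt x], its logarithm does not control [ln x], so these [n] are
    counted as pairs: at most [sqrt x] odd parts, and at most [2 ln x + 1] exponents of 2 since
    [ln 2 >= 1/2]. *)
Lemma small_odd_part_count (x : R) : 1 <= ln x ->
  \sum_(1 <= n < (Num.truncn x).+1 | ((odd_part n)%:R : R) <= Num.sqrt x) (1 : R) <=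
  (2 * ln x + 1) * Num.sqrt x.
Proof.
move=> L1; have x0 := ln_ge1_gt0 L1; set L := ln x in L1 *; have L0 : 0 < L by apply: lt_le_trans L1.
set X := Num.truncn x; pose K := (Num.truncn (2 * L)).+1.
pose T := Num.truncn (Num.sqrt x).
have sx : 0 <= Num.sqrt x by apply: sqrtr_ge0.
rewrite -big_filter.
apply: (@le_trans _ _ (\sum_(z <- [seq (k, m) | k <- iota 0 K, m <- index_iota 1 T.+1]) (1 : R))).
  apply: (sum_inj_subset (g := fun n => (logn 2 n, odd_part n)) (F := fun=> 1 : R)).
  - by rewrite filter_uniq // iota_uniq.
  - by apply: allpairs_uniq; rewrite ?iota_uniq // => -[x1 y1] [x2 y2].
  - move=> a b; rewrite !mem_filter !mem_index_iota => /andP[_ /andP[a0 _]] /andP[_ /andP[b0 _]].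
    have [ea _ _] := odd_partP a0; have [eb _ _] := odd_partP b0.
    by move=> -[e1 e2]; rewrite ea eb e1 e2.
  - move=> n; rewrite mem_filter mem_index_iota => /andP[ns /andP[n0 nN]].
    have [en m0 _] := odd_partP n0.
    apply/allpairsP; exists (logn 2 n, odd_part n); split; last by [].
      rewrite mem_iota add0n /= ltnS truncn_ge_nat; last by rewrite mulr_ge0 // ltW.
      have nx : n%:R <= x by rewrite -truncn_ge_nat ?ltW // -ltnS.
      have h : (logn 2 n)%:R * ln 2 <= L.
        rewrite mulr_natl -lnXn // -natrX ler_ln ?posrE ?ltr0n ?expn_gt0 //.
        apply: le_trans nx; rewrite ler_nat {2}en leq_pmulr //.
      have := ln2_ge_half; have : 0 <= (logn 2 n)%:R :> R by apply: ler0n.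
      nra.
    by rewrite mem_index_iota m0 /= ltnS truncn_ge_nat.
  - by move=> *; apply: ler01.
rewrite big_allpairs; under eq_bigr do rewrite sumr_const_nat subSS subn0.
rewrite big_const_seq count_predT size_iota iter_addr addr0 -[leLHS]mulr_natl.
apply: ler_pM; rewrite ?ler0n //.
  by rewrite /K -natr1 lerD2r truncn_le // mulr_ge0 // ltW.
by rewrite truncn_le.
Qed.

(** From [ln x <= 6 x^(1/6)], cubed, [(ln x)^3 <= 216 sqrt x]; with [c <= 2] and [2 L + 1 <= 3 L]
    for [L = ln x] this gives [3 * 216 = 648]. *)
Lemma sqrt_log_bound (x : R) : 1 <= ln x ->
  (2 * ln x + 1) * Num.sqrt x <= 648 * (x / (ln x) `^ c).
Proof.
move=> L1; have x0 := ln_ge1_gt0 L1; set L := ln x in L1 *; have L0 : 0 < L by apply: lt_le_trans L1.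
have s0 : 0 < Num.sqrt x by rewrite sqrtr_gt0.
have Lc : 0 < L `^ c by apply: powR_gt0.
rewrite mulrA ler_pdivlMr //.
have h1 : L `^ c <= L ^+ 2.
  by rewrite -powR_mulrn ?(ltW L0) //; apply: ler_powR => //; case/andP: c02.
have h2 : L <= 6 * x `^ (6^-1).
  have : ln (x `^ 6^-1) <= x `^ 6^-1 by apply/ltW/ln_sublinear/powR_gt0.
  rewrite ln_powR -/L => h; lra.
have h3 : L ^+ 3 <= 216 * Num.sqrt x.
  have -> : 216 * Num.sqrt x = (6 * x `^ 6^-1) ^+ 3.
    rewrite exprMn -[(x `^ _) ^+ 3]powR_mulrn ?powR_ge0 // -powRrM -powR12_sqrt ?(ltW x0) //.
    rewrite (_ : 6^-1 * 3%:R = 2^-1 :> R); last by lra.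
    by congr (_ * _); rewrite !exprS expr0; lra.
  by apply: lerXn2r; rewrite ?nnegrE ?mulr_ge0 ?powR_ge0 // ltW.
have xs : Num.sqrt x * Num.sqrt x = x by rewrite -expr2 sqr_sqrtr // ltW.
have h4 : (2 * L + 1) * L `^ c <= 3 * L ^+ 3.
  apply: (@le_trans _ _ ((3 * L) * L ^+ 2)); last by rewrite exprS; lra.
  apply: ler_pM; rewrite ?powR_ge0 //; lra.
rewrite mulrAC -[X in _ <= _ * X]xs [leRHS]mulrA; apply: ler_wpM2r; first exact: ltW.
lra.
Qed.

(** For an odd part above [sqrt x], [1 <= 2 ln (odd_part n) / ln x]. The factor 12 is this 2 times
    Chebyshev's 6, and the division by [ln x] turns [(ln x)^(1 - c)] into [(ln x)^(-c)]. *)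
Theorem sieve_count (x : R) : 1 <= ln x ->
  (\sum_(1 <= n < (Num.truncn x).+1 | admissible n) 1)%N%:R <=
  (648 + 12 * (4 * expR 1 * expR (C0 + 4))) * (x / (ln x) `^ c).
Proof.
move=> L1; have h1 := sum_inv_admissible L1; have h2 := small_odd_part_count L1.
have h3 := sqrt_log_bound L1; have x0 := ln_ge1_gt0 L1.
set L := ln x in L1 h1 h2 h3 *; have L0 : 0 < L by apply: lt_le_trans L1.
set X := Num.truncn x in h1 h2 *; set K1 := 4 * expR 1 * expR (C0 + 4) in h1 *.
have Xx : X%:R <= x by rewrite truncn_le // ltW.
have h4 := sum_ln_odd_part X.
have s0 : 0 < Num.sqrt x by rewrite sqrtr_gt0.
have h5 : (\sum_(1 <= n < X.+1 | admissible n) 1)%N%:R <=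
   \sum_(1 <= n < X.+1 | ((odd_part n)%:R : R) <= Num.sqrt x) (1 : R) +
   2 / L * \sum_(1 <= n < X.+1 | admissible n) ln ((odd_part n)%:R : R).
  rewrite natr_sum mulr_sumr big_mkcond [X in _ <= X + _]big_mkcond [X in _ <= _ + X]big_mkcond.
  rewrite -big_split [leLHS]big_nat_cond [leRHS]big_nat_cond; apply: ler_sum => n.
  rewrite andbT => /andP[n0 _] /=; have [_ m0 _] := odd_partP n0.
  have l0 : 0 <= ln ((odd_part n)%:R : R) by apply: ln_ge0; rewrite ler1n.
  have L2 : 0 <= 2 / L by rewrite divr_ge0 // ltW.
  case: ifP => _; last by rewrite addr0; case: ifP.
  case: (leP _ (Num.sqrt x)) => h; first by rewrite lerDl mulr_ge0.
  rewrite add0r mulrAC ler_pdivlMr // mul1r -/L.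
  have -> : L = 2 * ln (Num.sqrt x).
    by rewrite mulr_natl -lnXn // sqr_sqrtr // ltW.
  by rewrite ler_pM2l // ler_ln ?posrE ?ltr0n // ltW.
have Sinv : 0 <= \sum_(1 <= n < X.+1 | admissible n) (n%:R^-1 : R).
  by apply: sumr_ge0 => n _; rewrite invr_ge0.
have h6 : 2 / L * \sum_(1 <= n < X.+1 | admissible n) ln ((odd_part n)%:R : R) <=
   12 * K1 * (x / L `^ c).
  have hh : 2 / L * \sum_(1 <= n < X.+1 | admissible n) ln ((odd_part n)%:R : R) <=
     2 / L * (6 * x * (K1 * L `^ (1 - c))).
    apply: ler_wpM2l; first by rewrite divr_ge0 // ltW.
    apply: le_trans h4 _; apply: ler_pM => //.
    by rewrite ler_pM2l.
  apply: le_trans hh _; rewrite powRB ?(powRr1 (ltW L0)); last by apply/implyP => _; rewrite gt_eqF.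
  rewrite le_eqVlt; apply/orP; left; apply/eqP; field.
  by rewrite !gt_eqF // powR_gt0.
apply: le_trans h5 _; rewrite [leRHS]mulrDl; apply: lerD => //; exact: le_trans h2 h3.
Qed.

End Count.
End Sieve.

(** * The subgroup generated by 2 and its semi-bad cosets *)

Section Order2.
Variable q : nat.
Hypothesis oq : odd q.
Let q0 : (0 < q)%N := odd_gt0 oq.

Lemma order2P : [/\ (0 < order2 q)%N, (2 ^ order2 q = 1 %[mod q])%N &
  forall r, (0 < r)%N -> (2 ^ r = 1 %[mod q])%N -> (order2 q <= r)%N].
Proof.
rewrite /order2; case: ex_minnP => r /implyP/(_ oq)/andP[r0 /eqP er] rmin.
by split => // s s0 es; apply: rmin; rewrite oq s0 /=; apply/eqP.
Qed.

Lemma order2_le_totient : (order2 q <= totient q)%N.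
Proof.
have [_ _ rmin] := order2P; apply: rmin; first by rewrite totient_gt0.
by apply: Euler_exp_totient; rewrite coprime2n.
Qed.

Lemma pow2_mod_order e : (2 ^ e = 2 ^ (e %% order2 q) %[mod q])%N.
Proof.
have [r0 er _] := order2P.
rewrite {1}(divn_eq e (order2 q)) expnD [(_ %/ _ * _)%N]mulnC expnM.
by rewrite -modnMml -modnXm er modnXm exp1n modnMml mul1n.
Qed.

Lemma in_cosetP a p : reflect (exists e, p = a * 2 ^ e %[mod q])%N (in_coset q a p).
Proof.
have [r0 _ _] := order2P.
apply: (iffP existsP) => [[e /eqP he]|[e he]]; first by exists e.
exists (Ordinal (ltn_pmod e r0)) => /=; apply/eqP.
by rewrite he -modnMmr pow2_mod_order modnMmr.
Qed.

Lemma bad_class_coset p : bad_class q p = in_coset q 1 p.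
Proof. by apply: eq_existsb => e; rewrite mul1n. Qed.

Lemma bad_classP p : reflect (exists e, p = 2 ^ e %[mod q])%N (bad_class q p).
Proof.
rewrite bad_class_coset; apply: (iffP (in_cosetP 1 p)) => -[e he]; exists e.
  by rewrite he mul1n.
by rewrite he mul1n.
Qed.

Lemma coprime_of_mod a b : (a = b %[mod q])%N -> coprime q b -> coprime q a.
Proof. by move=> ab cb; rewrite -coprime_modr ab coprime_modr. Qed.

Lemma coprime_q_pow2 e : coprime q (2 ^ e).
Proof. by rewrite coprimeXr // coprime_sym coprime2n. Qed.

Lemma coset_count a : coprime q a -> (order2 q <= #|[pred k : 'I_q | in_coset q a k]|)%N.
Proof.
move=> ca; have [r0 er rmin] := order2P.
pose h (e : 'I_(order2 q)) : 'I_q := Ordinal (ltn_pmod (a * 2 ^ e) q0).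
have hinj : injective h.
  have aux (e e' : 'I_(order2 q)) : (e <= e')%N -> h e = h e' -> e = e'.
    move=> ee /(congr1 val) /= /esym/eqP; rewrite eqn_mod_dvd; last by rewrite leq_mul2l leq_pexp2l ?orbT.
    rewrite -mulnBr Gauss_dvdr // -(subnKC ee) expnD -{2}[(2 ^ e)%N]muln1 -mulnBr.
    rewrite Gauss_dvdr ?coprime_q_pow2 // => h1; apply/val_inj/eqP.
    rewrite /= eqn_leq ee /= leqNgt; apply/negP => lt.
    have : (order2 q <= e' - e)%N.
      apply: rmin; first by rewrite subn_gt0.
      by apply/eqP; rewrite eqn_mod_dvd // expn_gt0.
    by rewrite leqNgt (leq_ltn_trans (leq_subr _ _)).
  move=> e e'; have [le|/ltnW le] := leqP e e'; first exact: aux.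
  by move=> /esym /(aux _ _ le) ->.
rewrite -[X in (X <= _)%N]card_ord -(card_codom hinj); apply: subset_leq_card.
apply/fintype.subsetP => _ /codomP[e ->]; rewrite inE; apply/in_cosetP; exists e => /=.
by rewrite modn_mod.
Qed.

Lemma bad_residue_group : residue_group q (bad_class q).
Proof.
split.
- by apply/bad_classP; exists 0%N.
- move=> a b /bad_classP[e he] /bad_classP[e' he']; apply/bad_classP; exists (e + e')%N.
  by rewrite expnD -modnMm he he' modnMm.
- by move=> a; apply/bad_classP/bad_classP => -[e he]; exists e; rewrite ?modn_mod // -he modn_mod.
- by move=> a /bad_classP[e /coprime_of_mod]; apply; apply: coprime_q_pow2.
Qed.

Section SemiBad.
Variable a : nat.
Hypothesis sa : semi_bad_class q a.

Let ca : coprime q a.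
Proof. by case/and3P: sa; rewrite coprime_sym. Qed.

Lemma coset_not_bad p : in_coset q a p -> bad_class q p = false.
Proof.
move=> /in_cosetP[e he]; case: (bad_classP p) => // -[e' he'].
  exfalso.
case/and3P: sa => _ /negP na _; apply: na; apply/bad_classP.
(* [2^(e (r - 1))] inverts [2^e] modulo [q], [r] being the order of 2. *)
have [r0 er _] := order2P; exists (e' + e * (order2 q).-1)%N.
rewrite expnD -modnMml -he' he modnMml -mulnA -expnD.
have -> : (e + e * (order2 q).-1 = order2 q * e)%N by rewrite -{2}(prednK r0) mulSn mulnC.
by rewrite expnM -modnMmr -modnXm er modnXm exp1n modnMmr muln1.
Qed.

(** The square of [a] lies in [<2>], so the coset is its own inverse in the quotient by [<2>]. *)
Lemma semi_residue_group : residue_group q (predU (bad_class q) (in_coset q a)).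
Proof.
have [_ _ /bad_classP[b hb]] := and3P sa.
split.
- by apply/orP; left; apply/bad_classP; exists 0%N.
- move=> x y /orP[/bad_classP[e he]|/in_cosetP[e he]] /orP[/bad_classP[f hf]|/in_cosetP[f hf]];
    apply/orP.
  + by left; apply/bad_classP; exists (e + f)%N; rewrite expnD -modnMm he hf modnMm.
  + by right; apply/in_cosetP; exists (e + f)%N; rewrite expnD -modnMm he hf modnMm mulnCA.
  + by right; apply/in_cosetP; exists (e + f)%N; rewrite expnD -modnMm he hf modnMm mulnA.
  + left; apply/bad_classP; exists (b + (e + f))%N.
    by rewrite -modnMm he hf modnMm mulnACA mulnn -modnMml hb modnMml !expnD.
- move=> x; rewrite /= -[LHS]/(bad_class q (x %% q) || in_coset q a (x %% q)).
  congr (_ || _).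
    by apply/bad_classP/bad_classP => -[e he]; exists e; rewrite ?modn_mod // -he modn_mod.
  by apply/in_cosetP/in_cosetP => -[e he]; exists e; rewrite ?modn_mod // -he modn_mod.
- move=> x /orP[/bad_classP[e]|/in_cosetP[e]] /coprime_of_mod; apply.
    exact: coprime_q_pow2.
  by rewrite coprimeMr ca coprime_q_pow2.
Qed.

Lemma semi_count : (2 * order2 q <= #|[pred k : 'I_q | predU (bad_class q) (in_coset q a) k]|)%N.
Proof.
have h1 := coset_count (coprimen1 q); have h2 := coset_count ca.
rewrite mul2n -addnn; apply: leq_trans (leq_add h1 h2) _.
rewrite -cardUI [X in (_ + X)%N]eq_card0 ?addn0; last first.
  move=> k; rewrite !inE; apply/negP => /andP[k1 k2].
  by move: k1; rewrite -bad_class_coset coset_not_bad.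
by apply: subset_leq_card; apply/fintype.subsetP => k; rewrite !inE /= bad_class_coset.
Qed.

End SemiBad.
End Order2.

(** * Weighted prime sums and the exponent *)

Section Density.
Variable R : realType.

(** The principal character modulo 1 gives the zeta function, with partial sums at most [2 / e]; 15
    is the error 14 of the logarithm plus [ln 2 <= 1]. *)
Lemma prime_sum_upper (e : R) : 0 < e <= 1 -> exists Y0, forall Y, (Y0 <= Y)%N ->
  \sum_(0 <= p < Y.+1 | prime p) (p%:R : R) `^ (- (e + 1)) <= ln e^-1 + 15.
Proof.
move=> /andP[e0 e1].
have H := principal_character R 1.
have [Y0 hY0] := ln_Lsum_one (isT : (0 < 1)%N) H e0.
exists Y0 => Y /hY0[N0 /(_ N0 (leqnn _))[pos h]].
have up := @principal_upper R 1 isT e N0 (introT andP (conj e0 e1)).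
have S : \sum_(0 <= p < Y.+1 | prime p) complex.Re (twist (principal R 1) e p) =
   \sum_(0 <= p < Y.+1 | prime p) (p%:R : R) `^ (- (e + 1)).
  by apply: eq_bigr => p _; rewrite /twist /principal coprime1n mul1r.
rewrite S ler_norml in h.
have : ln (cabs (Lsum (principal R 1) e N0)) <= ln 2 + ln e^-1.
  by rewrite -lnM ?posrE ?invr_gt0 // ler_ln ?posrE ?divr_gt0.
have : ln (2 : R) <= 1.
  by have := @le_ln1Dx R 1; rewrite -[1 + 1]/(2%:R); apply; lra.
lra.
Qed.

(* [K] is the subgroup generated by the bad classes together with one semi-bad coset,
   or the bad classes themselves when there is no semi-bad class. *)
Lemma weighted_density (q : nat) (bad semi K : pred nat) (b k : nat) :
  (0 < q)%N -> residue_group q bad -> residue_group q K ->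
  (forall p, semi p -> bad p = false) -> (forall p, K p = bad p || semi p) ->
  (b <= #|[pred x : 'I_q | bad x]|)%N -> (k <= #|[pred x : 'I_q | K x]|)%N ->
  exists C0 : R, forall e : R, 0 < e <= 1 -> exists Y0, forall Y, (Y0 <= Y)%N ->
  \sum_(0 <= p < Y.+1 | prime p) sieve_weight R bad semi p * (p%:R : R) `^ (- (e + 1)) <=
  (1 - (b + k)%:R / (2 * (totient q)%:R)) * ln e^-1 + C0.
Proof.
move=> q0 Hb HK dis EK hb hk.
have [C1 h1] := dirichlet_density R q0 Hb.
have [C2 h2] := dirichlet_density R q0 HK.
exists (15 + C1 / 2 + C2 / 2) => e ee; have /andP[e0 e1] := ee.
have [Y1 hY1] := h1 e ee; have [Y2 hY2] := h2 e ee; have [Y3 hY3] := prime_sum_upper ee.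
exists (maxn Y1 (maxn Y2 Y3)) => Y; rewrite !geq_max => /and3P[/hY1 g1 /hY2 g2 /hY3 g3].
pose x p : R := p%:R `^ (- (e + 1)).
(* The weights 0, 1/2, 1 are [1 - [bad]/2 - [K]/2]. *)
have -> : \sum_(0 <= p < Y.+1 | prime p) sieve_weight R bad semi p * p%:R `^ (- (e + 1)) =
   \sum_(0 <= p < Y.+1 | prime p) x p - 2^-1 * \sum_(0 <= p < Y.+1 | prime p && bad p) x p
   - 2^-1 * \sum_(0 <= p < Y.+1 | prime p && K p) x p.
  rewrite !big_mkcondr !mulr_sumr -!sumrB; apply: eq_bigr => p _.
  rewrite EK /sieve_weight -/(x p); case sp: (semi p).
    by rewrite (dis p sp) /=; lra.
  by case: (bad p) => /=; lra.
have t0 : 0 < (totient q)%:R :> R by rewrite ltr0n totient_gt0.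
have l0 : 0 <= ln e^-1 by rewrite ln_ge0 // invf_ge1.
have card (P : pred nat) : \sum_(i < q | P i) (1 : R) = #|[pred x : 'I_q | P x]|%:R.
  by rewrite sumr_const; congr (_%:R); apply: eq_card.
rewrite !card in g1 g2.
have d1 : b%:R / (totient q)%:R * ln e^-1 <= #|[pred x : 'I_q | bad x]|%:R / (totient q)%:R * ln e^-1.
  by rewrite ler_wpM2r // ler_pM2r ?invr_gt0 // ler_nat.
have d2 : k%:R / (totient q)%:R * ln e^-1 <= #|[pred x : 'I_q | K x]|%:R / (totient q)%:R * ln e^-1.
  by rewrite ler_wpM2r // ler_pM2r ?invr_gt0 // ler_nat.
have -> : (1 - (b + k)%:R / (2 * (totient q)%:R)) * ln e^-1 =
   ln e^-1 - 2^-1 * (b%:R / (totient q)%:R * ln e^-1) - 2^-1 * (k%:R / (totient q)%:R * ln e^-1).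
  by rewrite natrD; field; rewrite gt_eqF.
rewrite -/(x _) in g1 g2 g3.
have g1' := le_trans (lerB d1 (lexx C1)) g1.
have g2' := le_trans (lerB d2 (lexx C2)) g2.
move: g1' g2' g3; rewrite /x; lra.
Qed.

End Density.

Lemma local_exponent_bounds (R : realType) q : odd q -> 0 <= local_exponent R q <= 2.
Proof.
move=> oq; have t0 : 0 < (totient q)%:R :> R by rewrite ltr0n totient_gt0 odd_gt0.
have rt : (order2 q)%:R <= (totient q)%:R :> R by rewrite ler_nat order2_le_totient.
have r0 : 0 <= (order2 q)%:R :> R by apply: ler0n.
have [c0 c2] : 0 <= c_factor R q /\ c_factor R q <= 2 by rewrite /c_factor; case: ifP => _; lra.
apply/andP; split; first by rewrite divr_ge0 ?mulr_ge0 // ltW.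
rewrite ler_pdivrMr //; apply: ler_pM => //.
Qed.

Lemma sieve_constant_ge0 (R : realType) (y : R) : 0 <= 648 + 12 * (4 * expR 1 * expR y).
Proof. by have := mulr_ge0 (expR_ge0 (1 : R)) (expR_ge0 y); lra. Qed.

(** One semi-bad coset is exploited, even if there are several, and accounts for the factor 3/2: the
    orders [r] and [2 r] of the two subgroups average to [3 r / 2]. Without one, both subgroups are
    [<2>]. *)
Lemma admissible_count (R : realType) q : odd q ->
  exists semi : pred nat,
    (forall ps m, (forall a, semi_bad_class q a -> count (in_coset q a) ps <= m)%N ->
       (count semi ps <= m)%N) /\
    exists C : R, 0 <= C /\ forall x : R, 1 <= ln x ->
      (\sum_(1 <= n < (Num.truncn x).+1 | admissible (bad_class q) semi n) 1)%N%:R <=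
      C * (x / (ln x) `^ (local_exponent R q)).
Proof.
move=> oq; have q0 := odd_gt0 oq.
have t0 : 0 < (totient q)%:R :> R by rewrite ltr0n totient_gt0.
have bc : (order2 q <= #|[pred x : 'I_q | bad_class q x]|)%N.
  apply: leq_trans (coset_count oq (coprimen1 q)) _; apply: eq_leq; apply: eq_card => x.
  by rewrite !inE bad_class_coset.
have [/existsP[a sa]|ns] := boolP [exists a : 'I_q, semi_bad_class q a].
  exists (in_coset q a); split; first by move=> ps m /(_ a sa).
  have [C0 H] := weighted_density R q0 (bad_residue_group oq) (semi_residue_group oq sa)
    (coset_not_bad oq sa) (fun p => erefl) bc (semi_count oq sa).
  exists (648 + 12 * (4 * expR 1 * expR (C0 + 4))).
  split; first exact: sieve_constant_ge0.
  have E : (order2 q + 2 * order2 q)%:R / (2 * (totient q)%:R) = local_exponent R q.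
    rewrite /local_exponent /c_factor ifT; last by apply/existsP; exists a.
    by rewrite natrD natrM; field; rewrite gt_eqF.
  rewrite E in H; exact: (sieve_count (local_exponent_bounds R oq) H).
exists pred0; split; first by move=> ps m _; rewrite count_pred0.
have [C0 H] := weighted_density R q0 (bad_residue_group oq) (bad_residue_group oq)
    (fun p (h : pred0 p) => False_ind _ (notF h)) (fun p => esym (orbF (bad_class q p))) bc bc.
exists (648 + 12 * (4 * expR 1 * expR (C0 + 4))).
split; first exact: sieve_constant_ge0.
have E : (order2 q + order2 q)%:R / (2 * (totient q)%:R) = local_exponent R q.
  rewrite /local_exponent /c_factor ifF; last exact: negbTE.
  by rewrite natrD; field; rewrite gt_eqF.
rewrite E in H; exact: (sieve_count (local_exponent_bounds R oq) H).
Qed.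

Theorem theorem3 (R : realType) (j : nat) (q : 'I_j.+1 -> nat) :
  exists C x0 : R,
  forall (P : {poly 'F_2}) (Pf : 'I_j.+1 -> {poly 'F_2}) (A : set nat),
    P.[0] = 1 ->
    P = \prod_(i < j.+1) Pf i ->
    (forall i : 'I_j.+1, irreducible_poly (Pf i)) ->
    (forall i : 'I_j.+1, is_poly_order (Pf i) (q i)) ->
    (forall n : nat, A n -> (0 < n)%N) ->
    (forall n : nat, (partition_count A n)%:R = P`_n :> 'F_2) ->
    forall x : R, x0 <= x ->
      (counting_function A x)%:R <= C * (x / (ln x) `^ (exponent R q)).
Proof.
have H (i : 'I_j.+1) : exists sC : pred nat * R, 0 <= sC.2 /\ (odd (q i) ->
    (forall ps m, (forall a, semi_bad_class (q i) a -> count (in_coset (q i) a) ps <= m)%N ->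
       (count sC.1 ps <= m)%N) /\
    forall x : R, 1 <= ln x ->
      (\sum_(1 <= n < (Num.truncn x).+1 | admissible (bad_class (q i)) sC.1 n) 1)%N%:R <=
      sC.2 * (x / (ln x) `^ (local_exponent R (q i)))).
  (* The constants must be fixed before the polynomials are given. An even [q i] is not the order of
     an irreducible polynomial, and 0 is a placeholder. *)
  have [oq|nq] := boolP (odd (q i)); last by exists ((fun=> false) : pred nat, 0 : R); split; [exact: lexx | by []].
  by have [semi [h1 [C [C0 h2]]]] := admissible_count R oq; exists (semi, C).
have [g hg] := choice H.
(* The counts for the single moduli are added. From [x >= exp 1] on, [ln x >= 1], so each
   [(ln x)^(-c_i)] is at most the one with the minimal exponent. *)
exists (\sum_i (g i).2), (expR 1) => P Pf A P0 eP irr ord Apos hP x xe.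
have oq i : odd (q i) := poly_order_odd (irr i) (ord i).
have x0 : 0 < x by apply: lt_le_trans xe; apply: expR_gt0.
have L1 : 1 <= ln x by rewrite -[1]expRK ler_ln ?posrE ?expR_gt0.
have L0 : 0 < ln x by apply: lt_le_trans L1.
apply: (@le_trans _ _ (\sum_i
  (\sum_(1 <= n < (Num.truncn x).+1 | admissible (bad_class (q i)) (g i).1 n) 1)%N%:R)).
  rewrite -natr_sum ler_nat /counting_function (exchange_big_dep xpredT) //=.
  rewrite [leqLHS]big_mkcond [leqLHS]big_nat_cond [leqRHS]big_nat_cond; apply: leq_sum => n.
  rewrite andbT => /andP[n0 _]; case: ifP => // /set_mem An.
  have [en m0 om] := odd_partP n0.
  rewrite {1}en in An.
  have [i [nb hs]] := support_structure P0 eP irr ord hP om An.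
  rewrite (bigD1 i) //=; apply/andP; split=> //.
  by have [_ /(_ (oq i))[h _]] := hg i; apply: h.
rewrite mulr_suml; apply: ler_sum => i _.
have [C0 /(_ (oq i))[_ h]] := hg i.
apply: le_trans (h x L1) _; apply: ler_wpM2l => //.
rewrite ler_pM2l // lef_pV2 ?posrE ?powR_gt0 //; apply: ler_powR => //.
exact: bigmin_le.
Qed.
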